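(* Assume that there exist constants $0<c_0<1$, $c_1>1$ and $t_0>0$ such that, for all $t_2>t_1>t_0$, $$f(t_2)\ge c_1 f(t_1)\quad\text{implies}\quad (1-c_0)f'(t_2)\ge f'(t_1).$$ Then there is a constant $c>0$ independent of $\alpha$ such that, for all sufficiently large $\alpha$, $$u^*_\alpha(0)\le cA,$$ where $A=A(\alpha)$ is a solution of $f'(A)=c\log\alpha$. Moreover, for any $1\le p<\infty$, $$\int_B (u^*_\alpha(x))^p\,dx\to 0\quad\text{as }\alpha\to\infty .$$
   Context: $B$ is the open unit disk in $\mathbb{R}^2$ centered at the origin, and $r=|x|$. Standing assumptions: $f:[0,\infty)\to(0,\infty)$ is a $C^1$ convex non-decreasing function with $\int_0^\infty \frac{ds}{f(s)}<\infty$; $\varphi,\psi$ are non-negative, non-increasing, Lipschitz continuous functions on $[0,1]$ with $\varphi(0)=\psi(0)=1$ and $\varphi>0$ on $[0,1)$; and $\int_0^1 M(s)\,ds<\infty$, where $M(s):=\max_{r\in[0,s]}\frac{\psi(r)}{\varphi(r)}$. For parameters $\lambda>0$, $\alpha>0$ consider the problem $$-\Delta u-\alpha r\varphi(r)\frac{\partial u}{\partial r}=\lambda\psi(r)f(u)\ \text{ in } B,\qquad u>0\ \text{ in } B,\qquad u=0\ \text{ on }\partial B. \quad (P_{\lambda,\alpha})$$ For each fixed $\alpha>0$, $\lambda^*(\alpha)\in(0,\infty)$ denotes the extremal value of $\lambda$: $(P_{\lambda,\alpha})$ has a unique minimal (pointwise smallest) classical solution $u_{\lambda,\alpha}$ for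 every $\lambda\in(0,\lambda^*(\alpha))$, and has no solution for $\lambda>\lambda^*(\alpha)$. The extremal solution is $u^*_\alpha(x):=\lim_{\lambda\uparrow\lambda^*(\alpha)}u_{\lambda,\alpha}(x)$; it is a classical solution of $(P_{\lambda,\alpha})$ with $\lambda=\lambda^*(\alpha)$, radially symmetric and strictly decreasing in $|x|$. *)

(* Defs.v *)
From HB Require Import structures.
From mathcomp Require Import all_boot all_order all_algebra.
From mathcomp Require Import all_classical all_reals all_analysis.

Set Implicit Arguments.
Unset Strict Implicit.
Unset Printing Implicit Defensive.

Import Order.TTheory GRing.Theory Num.Theory numFieldNormedType.Exports.

Local Open Scope classical_set_scope.
Local Open Scope ring_scope.

(* The library's norm on R * R is the sup norm (it induces the same topology
   and derivatives), so the Euclidean norm r = |x| is defined separately. *)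
Definition enorm (R : realType) (x : R * R) : R :=
  Num.sqrt (x.1 ^+ 2 + x.2 ^+ 2).

Definition disk (R : realType) : set (R * R) := [set x | enorm x < 1].
Definition closed_disk (R : realType) : set (R * R) := [set x | enorm x <= 1].
Definition circle (R : realType) : set (R * R) := [set x | enorm x = 1].

(* Derivative of a function on [0, +oo[: two-sided at t > 0, one-sided at 0;
   the values of f on negative reals are irrelevant. *)
Definition diffquot (R : realType) (f : R -> R) (t s : R) : R :=
  (f s - f t) / (s - t).

Definition deriv0y (R : realType) (f : R -> R) (t : R) : R :=
  lim (diffquot f t @ within `[0, +oo[ t^').

Definition C1_0y (R : realType) (f : R -> R) : Prop :=
  (forall t : R, 0 <= t -> cvg (diffquot f t @ within `[0, +oo[ t^')) /\
  {within `[0, +oo[, continuous (deriv0y f)}.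

Definition C1_on (R : realType) (D : set (R * R)) (u : R * R -> R) : Prop :=
  forall x, D x ->
    [/\ derivable u x (1, 0), derivable u x (0, 1),
        {for x, continuous ('D_(1, 0) u)} & {for x, continuous ('D_(0, 1) u)}].

Definition C2_on (R : realType) (D : set (R * R)) (u : R * R -> R) : Prop :=
  [/\ C1_on D u, C1_on D ('D_(1, 0) u) & C1_on D ('D_(0, 1) u)].

Definition laplacian (R : realType) (u : R * R -> R) (x : R * R) : R :=
  'D_(1, 0) ('D_(1, 0) u) x + 'D_(0, 1) ('D_(0, 1) u) x.

(* Directional derivative along x / |x|.  At x = 0 the direction is 0 by the
   convention 0^-1 = 0; there du/dr only occurs multiplied by r = 0. *)
Definition radial_deriv (R : realType) (u : R * R -> R) (x : R * R) : R :=
  'D_((enorm x)^-1 *: x) u x.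

Definition classical_solution (R : realType) (f phi psi : R -> R)
    (lambda alpha : R) (u : R * R -> R) : Prop :=
  [/\ C2_on (@disk R) u /\ {within @closed_disk R, continuous u},
      forall x, disk x ->
        - laplacian u x - alpha * enorm x * phi (enorm x) * radial_deriv u x
        = lambda * psi (enorm x) * f (u x),
      forall x, disk x -> 0 < u x
    & forall x, circle x -> u x = 0].

Definition minimal_solution (R : realType) (f phi psi : R -> R)
    (lambda alpha : R) (u : R * R -> R) : Prop :=
  classical_solution f phi psi lambda alpha u /\
  forall v, classical_solution f phi psi lambda alpha v ->
    forall x, disk x -> u x <= v x.

(* Minimality determines u on the closed disk, hence the minimal solution is
   unique there and uniqueness need not be required separately. *)
Definition extremal_value (R : realType) (f phi psi : R -> R)
    (alpha lambdastar : R) : Prop :=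
  [/\ 0 < lambdastar,
      forall lambda : R, 0 < lambda < lambdastar ->
        exists u, minimal_solution f phi psi lambda alpha u
    & forall lambda : R, lambdastar < lambda ->
        ~ exists u, classical_solution f phi psi lambda alpha u].

Definition extremal_solution (R : realType) (f phi psi : R -> R)
    (alpha : R) (ustar : R * R -> R) : Prop :=
  exists (lambdastar : R) (umin : R -> R * R -> R),
    [/\ extremal_value f phi psi alpha lambdastar,
        forall lambda : R, 0 < lambda < lambdastar ->
          minimal_solution f phi psi lambda alpha (umin lambda)
      & forall x, disk x ->
          umin lambda x @[lambda --> lambdastar^'-] --> ustar x].

(* A maximum for s < 1; phi may vanish at 1, so it is used on [0, 1[ only. *)
Definition Mratio (R : realType) (phi psi : R -> R) (s : R) : R :=
  sup [set psi r / phi r | r in `[0, s]].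

(* Main.v *)
(** Let [w r = exp (alpha int_0^r t phi t dt)]; a radial [V] solves the equation
    when [(r w V')' = - lambda r w psi f(V)], [V 1 = 0].  Iterating the
    corresponding integral operator from 0 gives a radial solution [V_lambda] for
    [lambda < lambda*], the iterates being bounded by any classical solution
    (maximum principle); minimal solutions lie below [V_lambda].

    For [lambda < lambda' < lambda*], convexity makes [Z = V_lambda' - V_lambda] a
    positive supersolution of the linearized equation.  Comparing [Z] with its
    flux [X = - r w Z'] at [rho] of order [alpha^(-1/2)] yields
    [lambda rho^2 f'(V rho) <= 16].  With [v = - V'] and [V = V_lambda], the energy
    [- w v^2 - alpha r^2 w phi v^2 + lambda r w psi f(V) v + v^2 X / Z] then has
    derivative at least [w v^2 / (2 r)] on [(0, rho]]; integrating twice,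
    [V 0 <= 194 V rho].  A supersolution obtained by inverting
    [G u = int_0^u ds / f s] gives [lambda* >= kappa alpha / log alpha] for every
    [kappa < 2 G(oo)] and large [alpha], so [f'(V rho) <= C log alpha], that is
    [V rho <= A].

    Finally [(G(V))' <= - (lambda / alpha) psi (1 - 1/w) / r]: integrated from
    [rho], this bounds [V] for [|x| >= alpha^(-1/4)] and makes it tend to 0 away
    from the origin.  As [int ds / f] converges, [A] is smaller than any power of
    [alpha], so the remaining disk of radius [alpha^(-1/4)] does not contribute to
    the limit of the integrals. *)
Require Import Defs.
From HB Require Import structures.
From mathcomp Require Import all_boot all_order all_algebra.
From mathcomp Require Import all_classical all_reals all_analysis.
From mathcomp Require Import measurable_realfun ring lra.

Set Implicit Arguments.
Unset Strict Implicit.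
Unset Printing Implicit Defensive.

Import Order.TTheory GRing.Theory Num.Theory numFieldNormedType.Exports.

Local Open Scope classical_set_scope.
Local Open Scope ring_scope.

(* Forgets what was introduced after [h] and does not occur in the goal: [lra]
   is slow in large contexts. *)
Ltac lra_after h :=
  repeat match goal with H : _ |- _ => first [constr_eq H h; fail 2 | clear H] end; lra.

(** A minimal solution is only a function on the disk whose symmetry is not known beforehand; lying
    below [V_lambda], it inherits bounds obtained from ordinary differential inequalities.

    [Z] acts as a substitute for the first eigenfunction of the linearized operator: a positive
    supersolution gives stability through Picone's identity. Since [v' = lambda psi f(V) - v/r -
    alpha r phi v] and [X = - r w Z'], the energy is [r w (v v' - v^2 Z'/Z)] with [v'] eliminated.
    Differentiating the equation would bring in the derivatives of [phi] and [psi], which are merely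
    Lipschitz; hence the elimination and the Dini derivatives.

    The scale [alpha^(-1/2)] is the one on which [1 <= w <= 2]. Beyond it, the radial solution with
    source [psi] has slope about [1/(alpha r)], so its value at 0 is about [log alpha / (2 alpha)]:
    this is the origin of [2 G(oo) alpha / log alpha]. The estimate of [G(V)] from above produces
    the same logarithm with the same constant, so nearly all of [G(oo)] is spent between
    [alpha^(-1/2)] and any fixed radius, which is why [V] tends to 0 there. *)

(** * One-variable calculus: mean values, primitives, Dini derivatives *)

Lemma continuous_of_derive (R : realType) (F : R -> R) (x l : R) :
  is_derive x 1 F l -> {for x, continuous F}.
Proof.
by move=> [dF _]; apply: differentiable_continuous; apply/derivable1_diffP.
Qed.

Lemma near_eq_continuous (T U : topologicalType) (f h : T -> U) (x : T) :
  (\forall y \near x, f y = h y) -> {for x, continuous f} -> {for x, continuous h}.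
Proof.
move=> fh cf; change (h @ x --> h x).
have /= <- := nbhs_singleton fh.
by apply: cvg_trans cf; exact: near_eq_cvg.
Qed.

Lemma mean_value (R : realType) (F dF : R -> R) (a b : R) : a < b ->
  (forall x, a < x < b -> is_derive x 1 F (dF x)) ->
  (forall x, a <= x <= b -> {for x, continuous F}) ->
  exists2 c, a < c < b & F b - F a = dF c * (b - a).
Proof.
move=> ab FD Fc.
have Fc' : {within `[a, b], continuous F}.
  by apply: continuous_in_subspaceT => x; rewrite inE /= in_itv /=; exact: Fc.
have [c cab E] : exists2 c, c \in `]a, b[ & F b - F a = dF c * (b - a).
  by apply: MVT => // x; rewrite in_itv /=; exact: FD.
by exists c => //; rewrite in_itv in cab.
Qed.

Lemma ge0_derive_le (R : realType) (F dF : R -> R) (a b : R) : a <= b ->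
  (forall x, a < x < b -> is_derive x 1 F (dF x)) ->
  (forall x, a < x < b -> 0 <= dF x) ->
  (forall x, a <= x <= b -> {for x, continuous F}) -> F a <= F b.
Proof.
rewrite le_eqVlt => /orP[/eqP -> //|ab] FD dF0 Fc.
have [c cab E] := mean_value ab FD Fc.
by rewrite -subr_ge0 E mulr_ge0 ?dF0// subr_ge0 ltW.
Qed.

Lemma gt0_derive_lt (R : realType) (F dF : R -> R) (a b : R) : a < b ->
  (forall x, a < x < b -> is_derive x 1 F (dF x)) ->
  (forall x, a < x < b -> 0 < dF x) ->
  (forall x, a <= x <= b -> {for x, continuous F}) -> F a < F b.
Proof.
move=> ab FD dF0 Fc; have [c cab E] := mean_value ab FD Fc.
by rewrite -subr_gt0 E mulr_gt0 ?dF0// subr_gt0.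
Qed.

(* Integrating from -1, not from 0, makes the primitive differentiable on both
   sides of 0; freezing it below -1/2 makes it continuous everywhere. *)
HB.lock Definition prim (R : realType) (g : R -> R) (x : R) : R :=
  (\int[lebesgue_measure]_(t in `[(-1)%R, (Num.max x (- 2^-1))%R]) g t -
   \int[lebesgue_measure]_(t in `[(-1)%R, 0%R]) g t)%R.

Lemma prim0 (R : realType) (g : R -> R) : prim g 0 = 0.
Proof. by rewrite prim.unlock (max_idPl _) ?subrr//; lra. Qed.

Lemma integrable_segment (R : realType) (g : R -> R) (a b : R) :
  continuous g -> (@lebesgue_measure R).-integrable `[a, b] (EFin \o g).
Proof.
move=> cg; apply: continuous_compact_integrable.
  exact: segment_compact.
by apply: continuous_subspaceT => x; exact: cg.
Qed.

Lemma is_derive_integral (R : realType) (g : R -> R) (a x : R) :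
  continuous g -> a < x ->
  is_derive x 1 (fun x => (\int[lebesgue_measure]_(t in `[a, x]) g t)%R) (g x).
Proof.
move=> cg x1.
have xx1 : x < x + 1 by rewrite ltrDl.
have [dF eF] := continuous_FTC1_closed xx1 (@integrable_segment R g a (x + 1) cg) x1 (cg x).
exact: (DeriveDef dF (etrans (esym (derive1E _ _)) eF)).
Qed.

Lemma continuous_prim (R : realType) (g : R -> R) : continuous g -> continuous (prim g).
Proof.
rewrite prim.unlock => cg x; apply: cvgB; last exact: cvg_cst.
apply: (@continuous_comp _ _ _ (fun x : R => Num.max x (- 2^-1))
   (fun x : R => (\int[lebesgue_measure]_(t in `[(-1)%R, x]) g t)%R)).
  by apply: (@continuous_max _ _ id (cst (- 2^-1))); [exact: cvg_id|exact: cvg_cst].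
apply: continuous_of_derive (is_derive_integral cg _).
have : - 2^-1 <= Num.max x (- 2^-1) by rewrite le_max lexx orbT.
lra.
Qed.

Lemma is_derive_prim (R : realType) (g : R -> R) (x : R) :
  continuous g -> - 2^-1 < x -> is_derive x 1 (prim g) (g x).
Proof.
move=> cg x1.
have h : is_derive x 1 (fun x => (\int[lebesgue_measure]_(t in `[(-1)%R, x]) g t)%R) (g x).
  by apply: is_derive_integral => //; lra.
set c := (\int[lebesgue_measure]_(t in `[(-1)%R, 0%R]) g t)%R.
have h2 : is_derive x 1 (fun x => (\int[lebesgue_measure]_(t in `[(-1)%R, x]) g t)%R - c) (g x).
  by apply: is_derive_eq; rewrite subr0.
apply: near_eq_is_derive h2.
near=> y.
rewrite prim.unlock (max_idPl _)//; apply: ltW.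
near: y; exact: lt_nbhsr.
Unshelve. all: by end_near. Qed.

Lemma integral_prim (R : realType) (g : R -> R) (a b : R) :
  continuous g -> 0 <= a -> a < b ->
  (\int[lebesgue_measure]_(x in `[a, b]) (g x)%:E
     = (prim g b - prim g a)%:E)%E.
Proof.
move=> cg a0 ab.
have dp (x : R) : 0 <= x -> is_derive x 1 (prim g) (g x).
  by move=> x0; apply: is_derive_prim => //; lra.
rewrite EFinB; apply: continuous_FTC2 => //.
- by apply: continuous_subspaceT => x; exact: cg.
- split.
  + by move=> x; rewrite in_itv /= => /andP[ax _]; case: (dp x) => //; lra.
  + by apply: cvg_at_right_filter; apply: continuous_of_derive (dp a _).
  + by apply: cvg_at_left_filter; apply: continuous_of_derive (dp b _); lra.
- move=> x; rewrite in_itv /= => /andP[ax _].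
  by rewrite derive1E; case: (dp x) => //; lra.
Qed.

Lemma prim_le (R : realType) (g1 g2 : R -> R) (a b : R) :
  continuous g1 -> continuous g2 -> 0 <= a -> a <= b ->
  (forall x, a < x < b -> g1 x <= g2 x) ->
  prim g1 b - prim g1 a <= prim g2 b - prim g2 a.
Proof.
move=> c1 c2 a0 ab le12.
have dp (g : R -> R) (x : R) : continuous g -> 0 <= x -> is_derive x 1 (prim g) (g x).
  by move=> cg x0; apply: is_derive_prim => //; lra.
suff : prim g2 a - prim g1 a <= prim g2 b - prim g1 b by lra.
apply: (@ge0_derive_le _ (fun x => prim g2 x - prim g1 x) (fun x => g2 x - g1 x)) => //.
- move=> x /andP[ax xb].
  have x0 : 0 <= x by lra.
  have h1 := dp g1 x c1 x0; have h2 := dp g2 x c2 x0.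
  by apply: is_derive_eq.
- by move=> x xab; rewrite subr_ge0; exact: le12.
- move=> x /andP[ax xb].
  have x0 : 0 <= x by lra.
  have h1 := dp g1 x c1 x0; have h2 := dp g2 x c2 x0.
  by apply: (@continuous_of_derive _ _ _ (g2 x - g1 x)); apply: is_derive_eq.
Qed.

(* A minorant [G] of [F] touching it at [s], with [G' s >= 0], says that the
   lower right Dini derivative of [F] at [s] is nonnegative. *)
Lemma dini_nondecreasing (R : realType) (F : R -> R) (a b : R) : a <= b ->
  (forall x, a <= x <= b -> {for x, continuous F}) ->
  (forall s, a <= s < b -> exists (G : R -> R) (d : R), [/\ 0 <= d, G s = F s,
     (forall x, s <= x <= b -> G x <= F x) & is_derive s 1 G d]) ->
  F a <= F b.
Proof.
move=> ab Fc FD.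
apply/ler_addgt0Pr => e e0.
have [/eqP ba|ba] := eqVneq a b.
  by rewrite (eqP ba) lerDl ltW.
have ab' : a < b by rewrite lt_neqAle ba.
(* The tilt [k * (x - a)] costs [e] in total and leaves a margin in the growth of [H]; [S] collects
   the points up to which [H >= 0], and its supremum turns out to be [b]. *)
pose k := e / (b - a).
have k0 : 0 < k by rewrite divr_gt0// subr_gt0.
pose H x := F x - F a + k * (x - a).
have Hc x : a <= x <= b -> {for x, continuous H}.
  move=> xab; apply: cvgD; first apply: cvgB.
  - exact: Fc.
  - exact: cvg_cst.
  - by apply: cvgMr; apply: cvgB; [exact: cvg_id|exact: cvg_cst].
suff : 0 <= H b.
  rewrite /H /k divfK ?subr_eq0 1?eq_sym//; lra.
pose S := [set x | a <= x <= b /\ forall y, a <= y <= x -> 0 <= H y].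
have Sa : S a.
  split; first by rewrite lexx.
  move=> y /andP[ay ya]; have -> : y = a by apply/le_anti; rewrite ya.
  by rewrite /H !subrr mulr0 addr0.
have Sb : ubound S b by move=> x [/andP[]].
have hS : has_sup S by split; [exists a|exists b].
pose s := sup S.
have as_ : a <= s by apply: ub_le_sup => //; case: hS.
have sb : s <= b by apply: ge_sup => //; exists a.
have Hlt y : a <= y -> y < s -> 0 <= H y.
  move=> ay /(sup_gt (ex_intro _ a Sa))[x [_ Sx] yx].
  by apply: Sx; rewrite ay ltW.
have Hs0 : 0 <= H s.
  rewrite leNgt; apply/negP => Hs.
  have : \forall x \near s, H x < 0.
    by move: (Hc s); rewrite as_ sb => /(_ isT) /cvgr_lt; apply.
  move=> [d /= d0 hd].
  have [sa|sa] := eqVneq s a.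
    by move: Hs; rewrite sa /H !subrr mulr0 addr0 ltxx.
  have as' : a < s by rewrite lt_neqAle eq_sym sa.
  pose y := Num.max a (s - d / 2).
  have ys : y < s by rewrite gt_max as' /=; lra.
  have ay : a <= y by rewrite le_max lexx.
  have := Hlt _ ay ys; rewrite leNgt => /negP; apply.
  apply: hd => /=; rewrite gtr0_norm ?subr_gt0//.
  have : s - d / 2 <= y by rewrite le_max lexx orbT.
  by lra.
have Ss : S s.
  split; first by rewrite as_ sb.
  move=> y /andP[ay]; rewrite le_eqVlt => /orP[/eqP ->//|].
  exact: Hlt.
have [->//|sb'] := eqVneq b s.
have {}sb' : s < b by rewrite lt_neqAle eq_sym sb'.
have [G [d [d0 Gs GF dG]]] : exists (G : R -> R) (d : R), [/\ 0 <= d, G s = F s,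
     (forall x, s <= x <= b -> G x <= F x) & is_derive s 1 G d].
  by apply: FD; rewrite as_ sb'.
have dG' : (G (s + h) - G s) / h @[h --> 0^'] --> d.
  case: dG => dG Gd; rewrite -Gd.
  have := dG; rewrite /derivable => /cvg_ex[l hl].
  rewrite /derive (cvg_lim _ hl)//.
  move: hl; apply: cvg_trans; apply: near_eq_cvg; near=> h.
  by rewrite /= /GRing.scale /= mulr1 [h + s]addrC mulrC.
(* As [d >= 0], the minorant [G] loses at most [k * (y - s)] just to the right of [s], which is
   exactly what the tilt gains. *)
have : \forall h \near 0^', d - k < (G (s + h) - G s) / h.
  by apply: (cvgr_gt d) => //; lra.
move=> [r /= r0 hr].
exfalso.
pose t := Num.min b (s + r / 2).
have st : s < t by rewrite lt_min sb' /=; lra.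
have tb : t <= b by rewrite ge_min lexx.
have tr : t <= s + r / 2 by rewrite ge_min lexx orbT.
suff : S t by move=> /(ub_le_sup (ex_intro _ b Sb)); rewrite leNgt -/s st.
split; first by rewrite tb andbT; lra.
move=> y /andP[ay yt].
have [ys|sy] := leP y s; first by apply: (proj2 Ss); rewrite ay.
have hy0 : 0 < y - s by rewrite subr_gt0.
have := hr (y - s); rewrite /= sub0r normrN gtr0_norm//.
have -> : y - s < r by lra.
move=> /(_ isT); rewrite gt_eqF// => /(_ isT).
rewrite ltr_pdivlMr// [s + _]addrC subrK Gs.
have : G y <= F y by apply: GF; lra.
have : 0 <= d * (y - s) by rewrite mulr_ge0// ltW.
move: Hs0; rewrite /H; lra.
Unshelve. all: by end_near. Qed.

(** * The radial linear equation *)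

(* [- u'' - u'/r - al r ph u' = g] reads [(r w u')' = - r w g] with [w = wt].
   Its solution with [u 1 = 0] is [rsol]; [flux] is [- r w u'], [slope] is
   [u' / r], [curv] is [u'' - u' / r].  The primitive is taken in the variable
   [r^2] so that [rsol] stays differentiable at 0. *)
HB.lock Definition wt (R : realType) (al : R) (ph : R -> R) (s : R) : R :=
  expR (al * prim (fun t : R => t * ph t) s).

HB.lock Definition flux (R : realType) (al : R) (ph g : R -> R) (s : R) : R :=
  prim (fun t => t * (wt al ph t * g t)) s.

HB.lock Definition slope (R : realType) (al : R) (ph g : R -> R) (r : R) : R :=
  - (if r <= 0 then g 0 / 2 else flux al ph g r / r ^+ 2) / wt al ph r.

HB.lock Definition rprim (R : realType) (al : R) (ph g : R -> R) (rho : R) : R :=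
  prim (fun t => slope al ph g (Num.sqrt t) / 2) rho.

HB.lock Definition rsol (R : realType) (al : R) (ph g : R -> R) (r : R) : R :=
  rprim al ph g (r ^+ 2) - rprim al ph g 1.

HB.lock Definition curv (R : realType) (al : R) (ph g : R -> R) (r : R) : R :=
  - g r - 2 * slope al ph g r - al * r ^+ 2 * ph r * slope al ph g r.

Section Weight.
Variables (R : realType) (al : R) (ph : R -> R).
Hypothesis cph : continuous ph.

Notation wt := (wt al ph).

Lemma continuous_idM (h : R -> R) : continuous h -> continuous (fun t : R => t * h t).
Proof. by move=> ch x; apply: cvgM; [exact: cvg_id|exact: ch]. Qed.

Lemma wtE s : wt s = expR (al * prim (fun t => t * ph t) s).
Proof. by rewrite wt.unlock. Qed.

Lemma wt_gt0 s : 0 < wt s. Proof. by rewrite wtE expR_gt0. Qed.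

Lemma wt0 : wt 0 = 1. Proof. by rewrite wtE prim0 mulr0 expR0. Qed.

Lemma continuous_wt : continuous wt.
Proof.
rewrite wt.unlock => x.
apply: (@continuous_comp _ _ _ (fun s : R => al * prim (fun t : R => t * ph t) s) expR);
  last exact: continuous_expR.
by apply: cvgMr; apply: continuous_prim; exact: continuous_idM.
Qed.

Lemma is_derive_wt (s : R) : - 2^-1 < s -> is_derive s 1 wt (al * s * ph s * wt s).
Proof.
move=> s0; have h := is_derive_prim (continuous_idM cph) s0.
have h2 : is_derive s 1 (fun s => al * prim (fun t : R => t * ph t) s) (al * (s * ph s)).
  by apply: is_derive_eq.
have h3 := @is_derive1_comp _ expR _ _ _ _ (is_derive_expR _) h2.
by move: h3; rewrite wt.unlock => h3; apply: is_derive_eq h3 _; ring.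
Qed.

End Weight.

Section RadialSolution.
Variables (R : realType) (al : R) (ph g : R -> R).
Hypothesis cph : continuous ph.
Hypothesis cg : continuous g.
Notation wt := (wt al ph).

Notation flux := (flux al ph g).
Notation slope := (slope al ph g).
Notation rprim := (rprim al ph g).
Notation rsol := (rsol al ph g).
Notation curv := (curv al ph g).
Notation ratio := (fun r : R => if r <= 0 then g 0 / 2 else flux r / r ^+ 2).

Lemma fluxE (s : R) : flux s = prim (fun t => t * (wt t * g t)) s.
Proof. by rewrite flux.unlock. Qed.

Lemma rsolE (r : R) : rsol r = rprim (r ^+ 2) - rprim 1.
Proof. by rewrite rsol.unlock. Qed.

Lemma curvE (r : R) :
  curv r = - g r - 2 * slope r - al * r ^+ 2 * ph r * slope r.
Proof. by rewrite curv.unlock. Qed.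

Lemma continuous_wtg : continuous (fun t : R => wt t * g t).
Proof. by move=> x; apply: cvgM; [exact: continuous_wt|exact: cg]. Qed.

Lemma flux0 : flux 0 = 0. Proof. by rewrite fluxE prim0. Qed.

Lemma is_derive_flux (s : R) : - 2^-1 < s -> is_derive s 1 flux (s * wt s * g s).
Proof.
move=> s0; rewrite flux.unlock.
apply: is_derive_eq (is_derive_prim (continuous_idM continuous_wtg) s0) _.
by rewrite mulrA.
Qed.

Lemma continuous_flux : continuous flux.
Proof. by rewrite flux.unlock; exact: continuous_prim (continuous_idM continuous_wtg). Qed.

Lemma prim_linear (c r : R) : 0 <= r -> prim (fun t : R => t * c) r = c * (r ^+ 2 / 2).
Proof.
move=> r0.
have cc : continuous (fun t : R => t * c) by move=> x; apply: cvgMl; exact: cvg_id.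
pose F x := prim (fun t : R => t * c) x - c * (x ^+ 2 / 2).
have dF (x : R) : 0 <= x -> is_derive x 1 F 0.
  move=> x0; have h : is_derive x 1 (prim (fun t : R => t * c)) (x * c).
    by apply: is_derive_prim => //; lra.
  by apply: is_derive_eq; rewrite /GRing.scale /=; field.
suff : F r = F 0.
  by rewrite /F prim0 expr0n /= mul0r mulr0 subrr => /subr0_eq.
have cF (x : R) : 0 <= x <= r -> {for x, continuous F}.
  by move=> /andP[x0 _]; apply: continuous_of_derive (dF x x0).
apply/le_anti/andP; split.
- rewrite -lerN2.
  apply: (@ge0_derive_le _ (fun x => - F x) (fun=> 0) _ _ r0).
  + move=> x /andP[/ltW/dF h _]; rewrite -[0 in X in is_derive _ _ _ X]oppr0.
    exact: is_deriveN.
  + by [].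
  + by move=> x xr; apply: cvgN; exact: cF.
- apply: (@ge0_derive_le _ F (fun x => 0)) => //.
  by move=> x /andP[/ltW/dF h _].
Qed.

(** At 0 the flux is squeezed between the primitives of [t * (g 0 - e)] and [t * (g 0 + e)], which
    are multiples of [r^2 / 2]; the value chosen for [r <= 0] is the resulting limit. *)
Lemma continuous_ratio : continuous ratio.
Proof.
move=> r1; have [r0|r0|->] := ltgtP r1 0.
- apply: (@near_eq_continuous _ _ (cst (g 0 / 2))); last exact: cvg_cst.
  by near=> x; rewrite ltW//; near: x; exact: lt_nbhsl.
- apply: (@near_eq_continuous _ _ (fun r => flux r / r ^+ 2)).
    near=> x; rewrite leNgt ifF//; apply/negbTE/negPn.
    by near: x; exact: lt_nbhsr.
  apply: cvgM; first exact: continuous_flux.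
  apply: cvgV; first by rewrite expf_neq0// gt_eqF.
  exact: exprn_continuous.
- apply/cvgrPdist_le => e e0.
  have h : \forall t \near (0 : R), `|wt t * g t - g 0| <= e.
    have := continuous_wtg (x := 0); rewrite /continuous_at wt0 mul1r.
    by move=> /cvgr_distC_le; apply.
  case: h => d /= d0 hd; exists d => //= r /=; rewrite sub0r normrN => rd.
  rewrite lexx; case: ifPn => [_|]; first by rewrite subrr normr0 ltW.
  rewrite -ltNge => r0; rewrite gtr0_norm// in rd.
  have hw (t : R) : 0 < t < r -> g 0 - e <= wt t * g t <= g 0 + e.
    move=> /andP[t0 tr].
    have := hd t; rewrite /= sub0r normrN gtr0_norm// => /(_ (lt_trans tr rd)).
    by rewrite ler_distl.
  have ci (c : R) : continuous (fun t : R => t * c).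
    by move=> x; apply: cvgMl; exact: cvg_id.
  have h1 : prim (fun t => t * (g 0 - e)) r - prim (fun t => t * (g 0 - e)) 0
            <= flux r - flux 0.
    rewrite !fluxE; apply: prim_le => //; [exact: continuous_idM continuous_wtg|exact: ltW|].
    by move=> t /[dup] /andP[t0 _] /hw /andP[h _]; rewrite ler_pM2l.
  have h2 : flux r - flux 0 <= 
     prim (fun t => t * (g 0 + e)) r - prim (fun t => t * (g 0 + e)) 0.
    rewrite !fluxE; apply: prim_le => //; [exact: continuous_idM continuous_wtg|exact: ltW|].
    by move=> t /[dup] /andP[t0 _] /hw /andP[_ h]; rewrite ler_pM2l.
  move: h1 h2; rewrite flux0 !prim0 !subr0 !(prim_linear _ (ltW r0)) => h1 h2.
  have r2 : 0 < r ^+ 2 by rewrite exprn_gt0.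
  rewrite distrC ler_distl ler_pdivlMr// ler_pdivrMr//.
  apply/andP; split; nra.
Unshelve. all: by end_near. Qed.

Lemma continuous_slope : continuous slope.
Proof.
rewrite slope.unlock => x; apply: cvgM; first by apply: cvgN; exact: continuous_ratio.
apply: cvgV; first by rewrite gt_eqF// wt_gt0.
exact: continuous_wt.
Qed.

Lemma slopeE (r : R) : 0 < r -> slope r = - flux r / (r ^+ 2 * wt r).
Proof.
move=> r0; rewrite slope.unlock leNgt r0 /=; field.
by rewrite !gt_eqF ?wt_gt0.
Qed.

Lemma slope0 : slope 0 = - g 0 / 2.
Proof. by rewrite slope.unlock lexx wt0 divr1 mulNr. Qed.

(** This zero makes the Hessian of the planar lift continuous at the origin, where the factor in
    front of [curv] depends on the direction of approach. *)
Lemma curv0 : curv 0 = 0.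
Proof. by rewrite curvE slope0; field. Qed.

Lemma is_derive_slope (r : R) : 0 < r -> is_derive r 1 slope (curv r / r).
Proof.
move=> r0.
have rN : - 2^-1 < r by lra.
have w0 := wt_gt0 al ph r.
have h1 := is_derive_flux rN; have h2 := is_derive_wt al cph rN.
have h3 : is_derive r 1 (fun r => r ^+ 2 * wt r) (2 * r * wt r + r ^+ 2 * (al * r * ph r * wt r)).
  by apply: is_derive_eq; rewrite /GRing.scale /=; ring.
have h4 : is_derive r 1 (fun r => (r ^+ 2 * wt r)^-1)
  (- (r ^+ 2 * wt r) ^- 2 *: (2 * r * wt r + r ^+ 2 * (al * r * ph r * wt r))).
  by apply: is_deriveV => //; rewrite gt_eqF// mulr_gt0// exprn_gt0.
have h5 : is_derive r 1 (fun r => - flux r / (r ^+ 2 * wt r)) (curv r / r).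
  apply: is_derive_eq; rewrite curvE slopeE// /GRing.scale /=.
  by field; rewrite !gt_eqF.
apply: near_eq_is_derive h5.
by near=> x; rewrite slopeE//; near: x; exact: lt_nbhsr.
Unshelve. all: by end_near. Qed.

Lemma continuous_curv : continuous curv.
Proof.
rewrite curv.unlock => x; apply: cvgB; first apply: cvgB.
- by apply: cvgN; exact: cg.
- by apply: cvgMr; exact: continuous_slope.
- apply: cvgM; last exact: continuous_slope.
  apply: cvgM; last exact: cph.
  by apply: cvgMr; exact: exprn_continuous.
Qed.

Lemma continuous_slope_sqrt : continuous (fun t : R => slope (Num.sqrt t) / 2).
Proof.
move=> x; apply: cvgMl.
apply: (@continuous_comp _ _ _ Num.sqrt slope); first exact: sqrt_continuous.
exact: continuous_slope.
Qed.

Lemma is_derive_rprim (t : R) : 0 <= t -> is_derive t 1 rprim (slope (Num.sqrt t) / 2).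
Proof. by move=> t0; rewrite rprim.unlock; apply: is_derive_prim; [exact: continuous_slope_sqrt|lra]. Qed.

Lemma is_derive_rsol (r : R) : 0 <= r -> is_derive r 1 rsol (r * slope r).
Proof.
move=> r0.
have h1 : is_derive r 1 (fun r : R => r ^+ 2) (2 * r).
  by apply: is_derive_eq; rewrite /GRing.scale /=; ring.
have h2 := @is_derive1_comp _ rprim (fun r : R => r ^+ 2) r _ _ (is_derive_rprim (sqr_ge0 r)) h1.
rewrite sqrtr_sqr ger0_norm// in h2.
have h3 : is_derive r 1 (fun r => (rprim \o (fun r : R => r ^+ 2)) r - rprim 1) (r * slope r).
  by apply: is_derive_eq; field.
by rewrite rsol.unlock; exact: h3.
Qed.

Lemma rsol1 : rsol 1 = 0.
Proof. by rewrite rsolE expr1n subrr. Qed.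

Lemma continuous_rsol : continuous rsol.
Proof.
rewrite rsol.unlock => x; apply: cvgB; last exact: cvg_cst.
apply: (@continuous_comp _ _ _ (fun r : R => r ^+ 2) rprim).
  exact: exprn_continuous.
by rewrite rprim.unlock; apply: continuous_prim; exact: continuous_slope_sqrt.
Qed.

End RadialSolution.

(** * Lifting radial solutions to the plane *)

Lemma is_derive_line (R : realType) (u : R * R -> R) (x b : R * R) (t l : R) :
  is_derive t 1 (fun h : R => u (x + h *: b)) l <-> is_derive (x + t *: b) b u l.
Proof.
have E : (fun h : R => h^-1 *: (((fun h : R => u (x + h *: b)) \o shift t) (h *: (1 : R)) -
      u (x + t *: b))) = (fun h : R => h^-1 *: ((u \o shift (x + t *: b)) (h *: b) - u (x + t *: b))).
  apply/funext => h /=; congr (_ *: (u _ - _)).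
  by rewrite scalerDl [h%:A]mulr1 addrCA.
split=> -[d1 d2]; split.
- by move: d1; rewrite /derivable E.
- by move: d2; rewrite /derive E.
- by move: d1; rewrite /derivable E.
- by move: d2; rewrite /derive E.
Qed.

Lemma is_derive_line0 (R : realType) (u : R * R -> R) (x b : R * R) (l : R) :
  is_derive (0 : R) 1 (fun h : R => u (x + h *: b)) l <-> is_derive x b u l.
Proof. by have := is_derive_line u x b 0 l; rewrite scale0r addr0. Qed.

Section Plane.
Variable R : realType.
Implicit Types x a b : R * R.

Definition dot x a : R := x.1 * a.1 + x.2 * a.2.

Lemma enorm_ge0 x : 0 <= enorm x. Proof. exact: sqrtr_ge0. Qed.

Lemma enorm_sqr x : enorm x ^+ 2 = x.1 ^+ 2 + x.2 ^+ 2.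
Proof. by rewrite sqr_sqrtr// addr_ge0// sqr_ge0. Qed.

Lemma dot_self x : dot x x = enorm x ^+ 2.
Proof. by rewrite enorm_sqr /dot -!expr2. Qed.

Lemma enorm0 : enorm (0 : R * R) = 0.
Proof. by rewrite /enorm /= expr0n /= addr0 sqrtr0. Qed.

Lemma enorm_eq0 x : (enorm x == 0) = (x == 0).
Proof.
rewrite /enorm sqrtr_eq0 le_eqVlt ltNge addr_ge0 ?sqr_ge0//= orbF.
by rewrite paddr_eq0 ?sqr_ge0// !sqrf_eq0; case: x.
Qed.

Lemma enorm_gt0 x : (0 < enorm x) = (x != 0).
Proof. by rewrite lt_neqAle enorm_ge0 andbT eq_sym enorm_eq0. Qed.

Lemma ler_dot_enorm x a : `|dot x a| <= enorm x * enorm a.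
Proof.
rewrite -ler_sqr ?nnegrE ?mulr_ge0 ?enorm_ge0//.
rewrite exprMn !enorm_sqr real_normK ?num_real// /dot.
have := sqr_ge0 (x.1 * a.2 - x.2 * a.1); lra.
Qed.

Lemma continuous_enorm : continuous (@enorm R).
Proof.
move=> x; apply: (@continuous_comp _ _ _ (fun x : R * R => x.1 ^+ 2 + x.2 ^+ 2) Num.sqrt).
  apply: cvgD.
    apply: (@continuous_comp _ _ _ fst (fun t : R => t ^+ 2)); last exact: exprn_continuous.
    exact: cvg_fst.
  apply: (@continuous_comp _ _ _ snd (fun t : R => t ^+ 2)); last exact: exprn_continuous.
  exact: cvg_snd.
exact: sqrt_continuous.
Qed.

Lemma continuous_dot a : continuous (dot^~ a).
Proof. by move=> x; apply: cvgD; apply: cvgMl; [exact: cvg_fst|exact: cvg_snd]. Qed.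

End Plane.

Lemma C1_on_derive (R : realType) (D : set (R * R)) (u d1 d2 : R * R -> R) :
  'D_(1, 0) u = d1 -> 'D_(0, 1) u = d2 ->
  (forall x, D x -> [/\ derivable u x (1, 0), derivable u x (0, 1),
     {for x, continuous d1} & {for x, continuous d2}]) -> C1_on D u.
Proof. by move=> <- <-. Qed.

Lemma C1_on_eq (R : realType) (D : set (R * R)) (u v : R * R -> R) :
  u = v -> C1_on D u -> C1_on D v.
Proof. by move=> ->. Qed.

Section Lift.
Variables (R : realType) (al : R) (ph g : R -> R).
Hypothesis cph : continuous ph.
Hypothesis cg : continuous g.
Implicit Types x a b : R * R.
Notation slope := (slope al ph g).
Notation rsol := (rsol al ph g).
Notation curv := (curv al ph g).

Definition radial x : R := rsol (enorm x).

Lemma is_derive_radial x b : is_derive x b radial (dot x b * slope (enorm x)).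
Proof.
apply/is_derive_line0.
pose N (h : R) : R := (x.1 + h * b.1) ^+ 2 + (x.2 + h * b.2) ^+ 2.
have -> : (fun h : R => radial (x + h *: b)) = (fun h => (rprim al ph g \o N) h - rprim al ph g 1).
  by apply/funext => h; rewrite /radial rsolE enorm_sqr.
have N0 : N 0 = x.1 ^+ 2 + x.2 ^+ 2 by rewrite /N !mul0r !addr0.
have dN : is_derive (0 : R) 1 N (2 * dot x b).
  by apply: is_derive_eq; rewrite /GRing.scale /= /dot !mul0r !addr0; ring.
have dr : is_derive (N 0) 1 (rprim al ph g) (slope (enorm x) / 2).
  rewrite N0; apply: is_derive_rprim => //.
  by rewrite addr_ge0// sqr_ge0.
have h := @is_derive1_comp _ _ _ _ _ _ dr dN.
by apply: is_derive_eq; field.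
Qed.

Lemma radialE x : radial x = rsol (enorm x). Proof. by []. Qed.

(** The Hessian of [u(|x|)] evaluated at [a] and [b]: [u'/r] times the identity, plus [u'' - u'/r]
    in the direction [x / |x|]. At the origin the second term is 0. *)
Definition radial2 a b x : R :=
  dot a b * slope (enorm x) + dot x a * dot x b / enorm x ^+ 2 * curv (enorm x).

Lemma is_derive_radial_grad x a b :
  is_derive x b (fun x => dot x a * slope (enorm x)) (radial2 a b x).
Proof.
apply/is_derive_line0.
have [->|x0] := eqVneq x 0.
  rewrite /radial2 enorm0 expr0n invr0 mulr0 mul0r addr0.
  (* The norm is not differentiable at the origin, but the difference quotient is
     [dot a b * slope (enorm (h *: b))], which is continuous in [h]. *)
  apply/is_derive1_caratheodory.
  exists (fun h : R => dot a b * slope (enorm (h *: b))); split.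
  - by move=> h; rewrite add0r scale0r addr0 enorm0 subr0 /dot /= !mul0r add0r mul0r subr0 /GRing.scale /=; ring.
  - apply: cvgMr; apply: (@continuous_comp _ _ _ (fun h : R => enorm (h *: b)) slope).
      apply: (@continuous_comp _ _ _ (fun h : R => h *: b) (@enorm R)).
        exact: scalel_continuous.
      exact: continuous_enorm.
    exact: continuous_slope.
  - by rewrite scale0r enorm0.
pose N (h : R) : R := (x.1 + h * b.1) ^+ 2 + (x.2 + h * b.2) ^+ 2.
have r0 : 0 < enorm x by rewrite enorm_gt0.
have N0 : N 0 = x.1 ^+ 2 + x.2 ^+ 2 by rewrite /N !mul0r !addr0.
have dN : is_derive (0 : R) 1 N (2 * dot x b).
  by apply: is_derive_eq; rewrite /GRing.scale /= /dot !mul0r !addr0; ring.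
have dq : is_derive (N 0) 1 Num.sqrt (2 * Num.sqrt (N 0))^-1.
  by apply: is_derive1_sqrt; rewrite N0 -enorm_sqr exprn_gt0.
have d1 := @is_derive1_comp _ _ _ _ _ _ dq dN.
have E0 : Num.sqrt (N 0) = enorm x by rewrite N0.
have ds : is_derive ((Num.sqrt \o N) 0) 1 slope (curv (enorm x) / enorm x).
  by rewrite /= E0; exact: is_derive_slope.
have d2 := @is_derive1_comp _ _ _ _ _ _ ds d1.
have -> : (fun h : R => dot (x + h *: b) a * slope (enorm (x + h *: b))) =
  (fun h => (dot x a + h * dot b a) * (slope \o (Num.sqrt \o N)) h).
  by apply/funext => h; rewrite /dot /= /GRing.scale /=; congr (_ * _); ring.
apply: is_derive_eq.
rewrite /GRing.scale /= E0 /radial2 /dot; field.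
by rewrite gt_eqF.
Qed.

Lemma continuous_radial_grad a : continuous (fun x => dot x a * slope (enorm x)).
Proof.
move=> x; apply: cvgM; first exact: continuous_dot.
apply: (@continuous_comp _ _ _ (@enorm R) slope); first exact: continuous_enorm.
exact: continuous_slope.
Qed.

Lemma continuous_radial2 a b : continuous (radial2 a b).
Proof.
move=> x; apply: cvgD.
  apply: cvgMr.
  apply: (@continuous_comp _ _ _ (@enorm R) slope); first exact: continuous_enorm.
  exact: continuous_slope.
have ccn : continuous (fun x => curv (enorm x)).
  move=> y; apply: (@continuous_comp _ _ _ (@enorm R) curv); first exact: continuous_enorm.
  exact: continuous_curv.
have [->|x0] := eqVneq x 0.
  rewrite /continuous_at enorm0 curv0 mulr0.
  apply/norm_cvg0P.
  (* By Cauchy-Schwarz the angular factor is at most [enorm a * enorm b], so the zero of [curv]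
     decides. *)
  apply: (@squeeze_cvgr _ _ _ _ (cst 0) (fun x => enorm a * enorm b * `|curv (enorm x)|)).
  - apply: nearW => y; rewrite normr_ge0 normrM ler_wpM2r//=.
    have [->|y0] := eqVneq y 0.
      by rewrite enorm0 expr0n invr0 mulr0 normr0 mulr_ge0 ?enorm_ge0.
    have r0 : 0 < enorm y by rewrite enorm_gt0.
    rewrite normrM normfV (ger0_norm (sqr_ge0 _)) ler_pdivrMr ?exprn_gt0// normrM.
    apply: (le_trans (ler_pM _ _ (ler_dot_enorm y a) (ler_dot_enorm y b))) => //.
    by rewrite le_eqVlt; apply/orP; left; apply/eqP; ring.
  - exact: cvg_cst.
  - have -> : 0 = enorm a * enorm b * `|curv (enorm (0 : R * R))|.
      by rewrite enorm0 curv0 normr0 mulr0.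
    by apply: cvgMr; apply: cvg_norm; exact: ccn.
apply: cvgM; last exact: ccn.
apply: cvgM; first by apply: cvgM; exact: continuous_dot.
apply: cvgV; first by rewrite expf_neq0// enorm_eq0.
apply: (@continuous_comp _ _ _ (@enorm R) (fun t : R => t ^+ 2)); first exact: continuous_enorm.
exact: exprn_continuous.
Qed.

Lemma derive_radial b : 'D_b radial = (fun x => dot x b * slope (enorm x)).
Proof. by apply/funext => x; apply: derive_val; exact: is_derive_radial. Qed.

Lemma derive_radial_grad a b : 'D_b (fun x => dot x a * slope (enorm x)) = radial2 a b.
Proof. by apply/funext => x; apply: derive_val; exact: is_derive_radial_grad. Qed.

Lemma derive_radial2 a b : 'D_b ('D_a radial) = radial2 a b.
Proof.
exact: (eq_ind_r (fun v => 'D_b v = radial2 a b) (derive_radial_grad a b) (derive_radial a)).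
Qed.

Lemma C1_radial_grad D a : C1_on D (fun x => dot x a * slope (enorm x)).
Proof.
apply: C1_on_derive (derive_radial_grad a (1, 0)) (derive_radial_grad a (0, 1)) _ => x _.
split.
- by case: (is_derive_radial_grad x a (1, 0)).
- by case: (is_derive_radial_grad x a (0, 1)).
- exact: continuous_radial2.
- exact: continuous_radial2.
Qed.

Lemma C2_radial D : C2_on D radial.
Proof.
split.
- apply: C1_on_derive (derive_radial (1, 0)) (derive_radial (0, 1)) _ => x _.
  split.
  + by case: (is_derive_radial x (1, 0)).
  + by case: (is_derive_radial x (0, 1)).
  + exact: continuous_radial_grad.
  + exact: continuous_radial_grad.
- exact: C1_on_eq (esym (derive_radial (1, 0))) (C1_radial_grad (1, 0)).
- exact: C1_on_eq (esym (derive_radial (0, 1))) (C1_radial_grad (0, 1)).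
Qed.

Lemma continuous_radial : continuous radial.
Proof.
move=> x; apply: (@continuous_comp _ _ _ (@enorm R) rsol); first exact: continuous_enorm.
exact: continuous_rsol.
Qed.

(** The trace of the Hessian is [2 * slope + curv], and [curv] is what the radial equation
    prescribes for [u'' - u'/r]. At the origin only [2 * slope 0 = - g 0] remains. *)
Lemma laplacian_radial x : 
  laplacian radial x = - g (enorm x) - al * enorm x ^+ 2 * ph (enorm x) * slope (enorm x).
Proof.
have -> : laplacian radial x = radial2 (1, 0) (1, 0) x + radial2 (0, 1) (0, 1) x.
  exact: (f_equal2 (fun u v => u x + v x) (derive_radial2 (1, 0) (1, 0))
            (derive_radial2 (0, 1) (0, 1))).
rewrite /radial2 /dot /=.
have [->|x0] := eqVneq x 0.
  by rewrite enorm0 curv0 slope0 !mulr0 expr0n !(mulr0, mul0r, mul1r, mulr1, addr0, add0r, subr0); field.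
rewrite curvE; set r := enorm x.
have rE : x.1 ^+ 2 + x.2 ^+ 2 = r ^+ 2 by rewrite enorm_sqr.
transitivity (2 * slope r + (x.1 ^+ 2 + x.2 ^+ 2) / r ^+ 2 *
  (- g r - 2 * slope r - al * r ^+ 2 * ph r * slope r)); first by ring.
rewrite rE divff; last by rewrite expf_neq0// enorm_eq0.
by ring.
Qed.

Lemma radial_deriv_radial x : radial_deriv radial x = enorm x * slope (enorm x).
Proof.
rewrite /radial_deriv.
have -> : 'D_((enorm x)^-1 *: x) radial x = dot x ((enorm x)^-1 *: x) * slope (enorm x).
  by apply: derive_val; exact: is_derive_radial.
congr (_ * _).
have -> : dot x ((enorm x)^-1 *: x) = (enorm x)^-1 * dot x x by rewrite /dot /= /GRing.scale /=; ring.
rewrite dot_self; have [->|x0] := eqVneq x 0; first by rewrite enorm0 expr0n mulr0.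
by rewrite expr2 mulrA mulVf ?mul1r// enorm_eq0.
Qed.

Lemma equation_radial x :
  - laplacian radial x - al * enorm x * ph (enorm x) * radial_deriv radial x = g (enorm x).
Proof. by rewrite laplacian_radial radial_deriv_radial; ring. Qed.

End Lift.

(** * Maximum principle on the disk *)

Lemma open_disk (R : realType) : open (@disk R).
Proof.
have -> : @disk R = @enorm R @^-1` [set t | t < 1] by [].
by apply: open_comp => [x _|]; [exact: continuous_enorm|exact: open_lt].
Qed.

Lemma compact_closed_disk (R : realType) : compact (@closed_disk R).
Proof.
apply: (@subclosed_compact _ _ (`[(-1 : R), 1] `*` `[(-1 : R), 1])).
- have -> : @closed_disk R = @enorm R @^-1` [set t | t <= 1] by [].
  by apply: closed_comp => [x _|]; [exact: continuous_enorm|exact: closed_le].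
- by apply: compact_setX; exact: segment_compact.
- move=> x; rewrite /closed_disk /= !in_itv /= -!ler_norml => x1.
  have x2 : x.1 ^+ 2 + x.2 ^+ 2 <= 1 by rewrite -enorm_sqr -(expr1n _ 2) lerXn2r ?nnegrE ?enorm_ge0.
  have := sqr_ge0 x.1; have := sqr_ge0 x.2 => h1 h2.
  by split; rewrite -ler_sqr ?nnegrE// expr1n real_normK ?num_real//; lra.
Qed.

(** A form of the mean value theorem for increments [k] of unknown sign, possibly 0. *)
Lemma mean_value_norm (R : realType) (F dF : R -> R) (k : R) :
  (forall t : R, `|t| <= `|k| -> is_derive t 1 F (dF t)) ->
  exists2 t, `|t| <= `|k| & F k - F 0 = k * dF t.
Proof.
move=> FD.
have Fc (t : R) : `|t| <= `|k| -> {for t, continuous F}.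
  by move=> /FD; exact: continuous_of_derive.
have [k0|k0|->] := ltgtP k 0; last first.
- by exists 0; rewrite // subrr mul0r.
- have [] := @MVT _ F dF 0 k k0.
  + move=> x; rewrite in_itv /= => /andP[x0 xk]; apply: FD; rewrite !gtr0_norm//; exact: ltW.
  + apply: continuous_in_subspaceT => x; rewrite inE /= in_itv /= => /andP[x0 xk].
    by apply: Fc; rewrite ger0_norm// gtr0_norm.
  + move=> c; rewrite in_itv /= => /andP[c0 ck] E.
    by exists c; rewrite ?E ?subr0 1?mulrC// !gtr0_norm// ltW.
- have [] := @MVT _ F dF k 0 k0.
  + move=> x; rewrite in_itv /= => /andP[x0 xk]; apply: FD; rewrite !ltr0_norm// lerN2; exact: ltW.
  + apply: continuous_in_subspaceT => x; rewrite inE /= in_itv /= => /andP[x0 xk].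
    by apply: Fc; rewrite ler0_norm// ltr0_norm// lerN2.
  + move=> c; rewrite in_itv /= => /andP[c0 ck] E.
    exists c; first by rewrite !ltr0_norm// lerN2 ltW.
    by rewrite -opprB E sub0r mulrN opprK mulrC.
Qed.

(** [C1_on] speaks of the two axes only, while [radial_deriv] differentiates along [x / |x|]. The
    increment is split into a horizontal and a vertical one, and the mean value theorem evaluates
    the partial derivatives at nearby points. *)
Lemma is_derive_C1 (R : realType) (D : set (R * R)) (u : R * R -> R) (x v : R * R) :
  open D -> C1_on D u -> D x ->
  is_derive x v u (v.1 * 'D_(1, 0) u x + v.2 * 'D_(0, 1) u x).
Proof.
move=> oD C1 Dx; apply/is_derive_line0.
set l := _ + _.
suff H : h^-1 *: (u (x + h *: v) - u x) @[h --> (0 : R)^'] --> l.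
  have E : (fun h : R => h^-1 *: (((fun h : R => u (x + h *: v)) \o shift (0 : R)) (h *: (1 : R)) -
      u (x + 0 *: v))) = (fun h : R => h^-1 *: (u (x + h *: v) - u x)).
    by apply/funext => h /=; rewrite scale0r !addr0 [h%:A]mulr1.
  split; first by rewrite /derivable E; apply: cvgP H.
  by rewrite /derive E; exact: cvg_lim.
have [_ _ c1 c2] := C1 x Dx.
apply/cvgrPdist_le => e e0.
(* The summand 1 keeps [M] positive when [v] is 0. *)
pose M := `|v.1| + `|v.2| + 1.
have M0 : 0 < M by rewrite ltr_wpDl// addr_ge0.
have eM : 0 < e / M by rewrite divr_gt0.
have : \forall y \near x, [/\ D y, `|'D_(1, 0) u x - 'D_(1, 0) u y| <= e / M &
    `|'D_(0, 1) u x - 'D_(0, 1) u y| <= e / M].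
  apply: filterS3 (open_nbhs_nbhs (conj oD Dx)) (proj1 (cvgrPdist_le _ _) c1 _ eM)
    (proj1 (cvgrPdist_le _ _) c2 _ eM) => y p1 p2 p3.
  exact: And3 p1 p2 p3.
move=> /nbhs_ballP[d /= d0 hd].
exists (d / M) => /=; first by rewrite divr_gt0.
move=> h /=; rewrite sub0r normrN ltr_pdivlMr// => hM h0.
have hb (s t : R) : `|s| <= `|h * v.1| -> `|t| <= `|h * v.2| ->
   ball x d (x.1 + s, x.2 + t).
  move=> hs ht; have := normr_ge0 v.1; have := normr_ge0 v.2; have := normr_ge0 h.
  move: hs ht; rewrite !normrM => hs ht a1 a2 a3.
  by split; rewrite /ball /= opprD addNKr normrN; move: hM; rewrite /M; nra.
have sc (y w : R * R) (t : R) : y + t *: w = (y.1 + t * w.1, y.2 + t * w.2) by [].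
have [t1 ht1 E1] : exists2 t, `|t| <= `|h * v.1| &
    u (x.1 + h * v.1, x.2 + h * v.2) - u (x.1 + 0, x.2 + h * v.2) =
    (h * v.1) * 'D_(1, 0) u (x.1 + t, x.2 + h * v.2).
  apply: (@mean_value_norm _ (fun t => u (x.1 + t, x.2 + h * v.2))
    (fun t => 'D_(1, 0) u (x.1 + t, x.2 + h * v.2))) => t ht.
  have Dt : D (x.1 + t, x.2 + h * v.2) by case: (hd _ (hb t (h * v.2) ht (lexx _))).
  have E (s : R) : (x.1 + s, x.2 + h * v.2) = (x.1, x.2 + h * v.2) + s *: (1, 0).
    by rewrite sc /= mulr1 mulr0 addr0.
  have := @is_derive_line _ u (x.1, x.2 + h * v.2) (1, 0) t ('D_(1, 0) u (x.1 + t, x.2 + h * v.2)).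
  rewrite -E => -[_]; under eq_fun do rewrite -E.
  by apply; case: (C1 _ Dt) => d1 _ _ _; apply: DeriveDef.
have [t2 ht2 E2] : exists2 t, `|t| <= `|h * v.2| &
    u (x.1 + 0, x.2 + h * v.2) - u (x.1 + 0, x.2 + 0) =
    (h * v.2) * 'D_(0, 1) u (x.1 + 0, x.2 + t).
  apply: (@mean_value_norm _ (fun t => u (x.1 + 0, x.2 + t))
    (fun t => 'D_(0, 1) u (x.1 + 0, x.2 + t))) => t ht.
  have Dt : D (x.1 + 0, x.2 + t).
    by case: (hd _ (hb 0 t _ ht)); rewrite ?normr0.
  have E (s : R) : (x.1 + 0, x.2 + s) = (x.1 + 0, x.2) + s *: (0, 1).
    by rewrite sc /= mulr1 mulr0 !addr0.
  have := @is_derive_line _ u (x.1 + 0, x.2) (0, 1) t ('D_(0, 1) u (x.1 + 0, x.2 + t)).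
  rewrite -E => -[_]; under eq_fun do rewrite -E.
  by apply; case: (C1 _ Dt) => _ d2 _ _; apply: DeriveDef.
have xE : (x.1 + 0, x.2 + 0) = x by rewrite !addr0 -surjective_pairing.
have ux : u x = u (x.1 + 0, x.2 + 0) by rewrite xE.
rewrite sc ux.
have -> : h^-1 *: (u (x.1 + h * v.1, x.2 + h * v.2) - u (x.1 + 0, x.2 + 0)) =
   v.1 * 'D_(1, 0) u (x.1 + t1, x.2 + h * v.2) + v.2 * 'D_(0, 1) u (x.1 + 0, x.2 + t2).
  rewrite -[X in X - _](subrK (u (x.1 + 0, x.2 + h * v.2))) -addrA E1 E2 /GRing.scale /=.
  by field.
rewrite /l.
have [_ b1 _] := hd _ (hb t1 (h * v.2) ht1 (lexx _)).
have [_ _ b2] : [/\ D (x.1 + 0, x.2 + t2), `|'D_(1, 0) u x - 'D_(1, 0) u (x.1 + 0, x.2 + t2)| <= e / M &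
    `|'D_(0, 1) u x - 'D_(0, 1) u (x.1 + 0, x.2 + t2)| <= e / M].
  by apply: hd; apply: hb; rewrite ?normr0.
move: b1 b2.
set A1 := 'D_(1, 0) u x; set A2 := 'D_(0, 1) u x.
set B1 := 'D_(1, 0) u _; set B2 := 'D_(0, 1) u _ => b1 b2.
have -> : v.1 * A1 + v.2 * A2 - (v.1 * B1 + v.2 * B2) = v.1 * (A1 - B1) + v.2 * (A2 - B2) by ring.
apply: (le_trans (ler_normD _ _)); rewrite !normrM.
apply: (@le_trans _ _ ((`|v.1| + `|v.2|) * (e / M))).
  by rewrite mulrDl; apply: lerD; apply: ler_wpM2l.
rewrite mulrCA -[leRHS]mulr1 ler_pM2l// ler_pdivrMr// mul1r /M lerDl.
exact: ler01.
Unshelve. all: by end_near. Qed.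

(** If [l < 0], then [dF t / t < 0] near 0 and [F] decreases strictly to the right of its
    minimum. *)
Lemma derive2_at_min (R : realType) (F dF : R -> R) (l : R) :
  (\forall t \near (0 : R), is_derive (t : R) 1 F (dF t)) -> is_derive (0 : R) 1 dF l ->
  (\forall t \near (0 : R), F 0 <= F t) -> dF 0 = 0 /\ 0 <= l.
Proof.
move=> FD dFD Fmin.
have [d /= d0 hd] : \forall t \near (0 : R), is_derive (t : R) 1 F (dF t) /\ F 0 <= F t.
  by near=> t; split; near: t.
have hd' (t : R) : - d < t < d -> is_derive t 1 F (dF t) /\ F 0 <= F t.
  by move=> td; apply: hd; rewrite /= sub0r normrN ltr_norml.
have dF0 : dF 0 = 0.
  have h0 : is_derive (0 : R) 1 F (dF 0) by apply: (hd' 0 _).1; lra.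
  have h1 : is_derive (0 : R) 1 F 0.
    apply: (@derive1_at_min _ F (- d) d); first lra.
    - move=> t; rewrite in_itv /= => /hd'[h _]; exact: (@ex_derive _ _ _ _ _ _ _ h).
    - by rewrite in_itv /=; lra.
    - by move=> t; rewrite in_itv /= => /hd'[].
  by rewrite -(@derive_val _ _ _ _ _ _ _ h0) (@derive_val _ _ _ _ _ _ _ h1).
split=> //; rewrite leNgt; apply/negP => l0.
move/is_derive1_caratheodory: dFD => [k [kE kc k0]].
have [d' /= d'0 hd2] : \forall t \near (0 : R), k t < 0.
  by move: kc => /cvgr_lt; apply; rewrite k0.
pose m := Num.min d d' / 2.
have m0 : 0 < m by rewrite divr_gt0// lt_min d0 d'0.
have md : m < d by rewrite /m ltr_pdivrMr// (le_lt_trans (_ : _ <= d))// ?ge_min ?lexx//; lra.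
have md' : m < d' by rewrite /m ltr_pdivrMr// (le_lt_trans (_ : _ <= d'))// ?ge_min ?lexx ?orbT//; lra.
have : - F 0 < - F m.
  apply: (@gt0_derive_lt _ (fun t => - F t) (fun t => - dF t) _ _ m0).
  - move=> t /andP[t0 tm].
    have [h _] := hd' t ltac:(lra).
    exact: is_deriveN.
  - move=> t /andP[t0 tm]; have := kE t; rewrite dF0 !subr0 => ->.
    rewrite oppr_gt0 nmulr_rlt0//; apply: hd2; rewrite /= sub0r normrN gtr0_norm//.
    exact: lt_trans md'.
  - move=> t /andP[t0 tm]; apply: cvgN.
    have [h _] := hd' t ltac:(lra).
    exact: continuous_of_derive h.
have [_ h] := hd' m ltac:(lra).
by rewrite ltrN2 ltNge h.
Unshelve. all: by end_near. Qed.

(** The first and second order conditions hold along both axes; the radial derivatives agree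
    because, for C1 functions, they are linear in the gradient. *)
Lemma min_difference (R : realType) (D : set (R * R)) (u l : R * R -> R) (c : R * R) :
  open D -> C2_on D u -> C2_on D l -> D c ->
  (forall y, D y -> u c - l c <= u y - l y) ->
  radial_deriv u c = radial_deriv l c /\ laplacian l c <= laplacian u c.
Proof.
move=> oD [C1u C1u1 C1u2] [C1l C1l1 C1l2] dc cmin.
have nd (b : R * R) : \forall t \near (0 : R), D (c + t *: b).
  have h : (c + t *: b) @[t --> (0 : R)] --> c + (0 : R) *: b.
    by apply: cvgD; [exact: cvg_cst|exact: scalel_continuous].
  rewrite scale0r addr0 in h.
  by apply: h; apply: open_nbhs_nbhs; split.
have key (b : R * R) : (forall y, D y -> derivable u y b /\ derivable l y b) ->
   derivable ('D_b u) c b -> derivable ('D_b l) c b ->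
   'D_b u c = 'D_b l c /\ 'D_b ('D_b l) c <= 'D_b ('D_b u) c.
  move=> d1 du dl.
  have [] := @derive2_at_min _ (fun t => u (c + t *: b) - l (c + t *: b))
      (fun t => 'D_b u (c + t *: b) - 'D_b l (c + t *: b))
      ('D_b ('D_b u) c - 'D_b ('D_b l) c).
  - apply: filterS (nd b) => t dt.
    have [p1 p2] := d1 _ dt.
    apply/(is_derive_line (fun y => u y - l y)).
    exact: is_deriveB (derivableP p1) (derivableP p2).
  - apply/(is_derive_line0 (fun y => 'D_b u y - 'D_b l y)).
    exact: is_deriveB (derivableP du) (derivableP dl).
  - by apply: filterS (nd b) => t dt; rewrite scale0r addr0; exact: cmin.
  by rewrite scale0r addr0 subr_ge0 => /subr0_eq h1 h2.
have [e1 f1] : 'D_(1, 0) u c = 'D_(1, 0) l c /\ 'D_(1, 0) ('D_(1, 0) l) c <= 'D_(1, 0) ('D_(1, 0) u) c.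
  apply: key.
  - move=> y Dy; have [p1 _ _ _] := C1u y Dy; have [p2 _ _ _] := C1l y Dy.
    by split.
  - by have [p1 _ _ _] := C1u1 c dc.
  - by have [p1 _ _ _] := C1l1 c dc.
have [e2 f2] : 'D_(0, 1) u c = 'D_(0, 1) l c /\ 'D_(0, 1) ('D_(0, 1) l) c <= 'D_(0, 1) ('D_(0, 1) u) c.
  apply: key.
  - move=> y Dy; have [_ p1 _ _] := C1u y Dy; have [_ p2 _ _] := C1l y Dy.
    by split.
  - by have [_ p1 _ _] := C1u2 c dc.
  - by have [_ p1 _ _] := C1l2 c dc.
split; last by rewrite /laplacian; exact: (lerD f1 f2).
rewrite /radial_deriv.
have hu := @derive_val _ _ _ _ _ _ _ (is_derive_C1 ((enorm c)^-1 *: c) oD C1u dc).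
have hl := @derive_val _ _ _ _ _ _ _ (is_derive_C1 ((enorm c)^-1 *: c) oD C1l dc).
by rewrite hu hl e1 e2.
Qed.

Section Comparison.
Variables (R : realType) (al : R) (ph g : R -> R).
Hypothesis cph : continuous ph.
Hypothesis cg : continuous g.

(** At an interior minimum of the difference the radial derivatives agree and the Laplacians are
    ordered, which the strict inequality excludes at once. The minimum is therefore on the circle,
    where both functions vanish. [u] may be non-radial. *)
Lemma radial_le_strict (u : R * R -> R) :
  C2_on (@disk R) u -> {within @closed_disk R, continuous u} ->
  (forall x, circle x -> u x = 0) ->
  (forall x, disk x -> g (enorm x) <
     - laplacian u x - al * enorm x * ph (enorm x) * radial_deriv u x) ->
  forall x, disk x -> radial al ph g x <= u x.
Proof.
move=> C2u cu u0 ug x dx.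
have C2l := C2_radial al cph cg (@disk R).
have cl := continuous_radial (al := al) cph cg.
have leq y := equation_radial al cph cg y.
have l0 y : enorm y = 1 -> radial al ph g y = 0 by move=> c1; rewrite radialE c1 rsol1.
move: (radial al ph g) C2l cl leq l0 => l C2l cl leq l0.
have cz : {within @closed_disk R, continuous (fun y => u y - l y)}.
  move=> y; apply: cvgB; first exact: cu.
  by move: y; exact: continuous_subspaceT.
have [c /set_mem cd cmin] : exists2 c, c \in @closed_disk R &
    forall t, t \in @closed_disk R -> u c - l c <= u t - l t.
  apply: compact_EVT_min cz.
  - by exists 0; rewrite /closed_disk /= enorm0.
  - exact: compact_closed_disk.
rewrite -subr_ge0.
have xz : u c - l c <= u x - l x by apply: cmin; rewrite inE; exact: ltW.
apply: le_trans xz.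
have [c1|c1] := eqVneq (enorm c) 1; first by rewrite u0// l0// subrr.
have {c1 cd} dc : disk c by rewrite /disk /= lt_neqAle c1.
exfalso.
have [|er lap] := min_difference (@open_disk R) C2u C2l dc.
  by move=> y dy; apply: cmin; rewrite inE; exact: ltW.
have := ug c dc; rewrite er ltNge => /negP; apply.
move: lap (leq c).
move: (laplacian u c) (laplacian l c) (radial_deriv l c) => a b d ab <-.
by rewrite lerD2r lerN2.
Qed.

End Comparison.

(** * The convex nonlinearity *)

Section Nonlinearity.
Variables (R : realType) (f : R -> R).
Hypothesis f_C1 : C1_0y f.
Hypothesis f_pos : forall t : R, 0 <= t -> 0 < f t.
Hypothesis f_convex : convex_function (`[0, +oo[%classic : set R^o) f.
Hypothesis f_nondecr : forall s t : R, 0 <= s -> s <= t -> f s <= f t.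
Notation fp := (deriv0y f).

(** The values of [f] at negative reals are arbitrary; extending [f] by the constant [f 0] keeps it
    positive, nondecreasing and continuous on the whole line, as the integral operator requires. *)
Definition fext (u : R) : R := f (Num.max u 0).

Lemma diffquot_near (t e : R) : 0 <= t -> 0 < e ->
  exists2 d, 0 < d & forall s, 0 <= s -> s != t -> `|s - t| < d ->
    `|f s - f t - fp t * (s - t)| <= e * `|s - t|.
Proof.
move=> t0 e0; have c := (proj1 f_C1) t t0.
have : diffquot f t @ within `[0, +oo[ t^' --> fp t by exact: c.
move=> /cvgrPdist_le/(_ e e0)[d /= d0 hd].
exists d => // s s0 st std.
have := hd s; rewrite /= distrC => /(_ std st).
rewrite in_itv /= s0 /= => /(_ isT).
rewrite /diffquot => h.
have st0 : s - t != 0 by rewrite subr_eq0.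
have -> : f s - f t - fp t * (s - t) = ((f s - f t) / (s - t) - fp t) * (s - t) by field.
by rewrite normrM ler_wpM2r// distrC.
Qed.

(** Convexity is applied between [a] and [b] at a point so close to [a] that the difference quotient
    there equals [fp a] up to [e / |b - a|]. *)
Lemma convex_tangent (a b : R) : 0 <= a -> 0 <= b -> fp a * (b - a) <= f b - f a.
Proof.
move=> a0 b0; have [->|ab] := eqVneq b a; first by rewrite !subrr mulr0.
have ba0 : 0 < `|b - a| by rewrite normr_gt0 subr_eq0.
apply/ler_addgt0Pr => e e0.
have [d d0 hd] := diffquot_near a0 (divr_gt0 e0 ba0).
pose t := Num.min (2^-1) (d / (2 * `|b - a|)).
have t0 : 0 < t by rewrite lt_min invr_gt0 ltr0n /= divr_gt0// mulr_gt0.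
have t1 : t <= 2^-1 by rewrite ge_min lexx.
have td : t * `|b - a| < d.
  apply: (@le_lt_trans _ _ (d / 2)); last lra.
  have : t <= d / (2 * `|b - a|) by rewrite ge_min lexx orbT.
  by rewrite ler_pdivlMr ?mulr_gt0//; lra.
have ti : 0 <= t <= 1 by apply/andP; split; lra.
pose t' : {i01 R} := Itv01 (ltW t0) (proj2 (andP ti)).
pose s := a + t * (b - a).
have sE : s - a = t * (b - a) by rewrite /s; ring.
have s0 : 0 <= s by rewrite /s; nra.
have fs : f s <= t * f b + (1 - t) * f a.
  have := f_convex t' (x := b) (y := a).
  rewrite !inE /= !in_itv /= !andbT => /(_ b0 a0).
  have -> : s = t * b + (1 - t) * a by rewrite /s; ring.
  exact.
have := hd s s0; rewrite sE normrM (gtr0_norm t0) => /(_ _ td).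
have -> : s != a by rewrite -subr_eq0 sE mulf_eq0 negb_or (gt_eqF t0) /= subr_eq0.
move=> /(_ isT); rewrite ler_norml => /andP[h _].
have h2 : t * (fp a * (b - a)) <= t * (f b - f a + e).
  have E : e / `|b - a| * (t * `|b - a|) = t * e by field; rewrite gt_eqF.
  by move: h; rewrite E; nra.
by move: h2; rewrite ler_pM2l.
Qed.

Lemma fp_nondecr (a b : R) : 0 <= a -> a <= b -> fp a <= fp b.
Proof.
move=> a0; rewrite le_eqVlt => /orP[/eqP->//|ab].
have b0 : 0 <= b by lra.
have h1 := convex_tangent a0 b0; have h2 := convex_tangent b0 a0.
have : 0 <= (fp b - fp a) * (b - a) by nra.
by rewrite pmulr_lge0 ?subr_gt0// subr_ge0.
Qed.

Lemma fp_ge0 (a : R) : 0 <= a -> 0 <= fp a.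
Proof.
move=> a0; apply/ler_addgt0Pr => e e0; rewrite addrC -lerBlDl sub0r.
have [d d0 hd] := diffquot_near a0 e0.
pose s := a + d / 2; have sE : s - a = d / 2 by rewrite /s; ring.
have sa : s != a by rewrite -subr_eq0 sE gt_eqF//; lra.
have s0 : 0 <= s by rewrite /s; lra.
have := hd s s0 sa; rewrite sE gtr0_norm; last by lra.
have fle : f a <= f s by apply: f_nondecr => //; rewrite /s; lra.
move=> /(_ ltac:(lra)); rewrite ler_norml => /andP[_ h].
have : 0 <= (fp a + e) * (d / 2) by nra.
by rewrite pmulr_lge0; [lra|lra].
Qed.

Lemma is_derive_f (t : R) : 0 < t -> is_derive t 1 f (fp t).
Proof.
move=> t0.
suff H : h^-1 *: (f (t + h) - f t) @[h --> (0 : R)^'] --> fp t.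
  have E : (fun h : R => h^-1 *: ((f \o shift t) (h *: (1 : R)) - f t)) =
           (fun h : R => h^-1 *: (f (t + h) - f t)).
    by apply/funext => h /=; rewrite [h%:A]mulr1 [h + t]addrC.
  split; first by rewrite /derivable E; apply: cvgP H.
  by rewrite /derive E; exact: cvg_lim.
apply/cvgrPdist_le => e e0.
have [d d0 hd] := diffquot_near (ltW t0) e0.
exists (Num.min d t) => /=; first by rewrite lt_min d0 t0.
move=> h /=; rewrite sub0r normrN lt_min => /andP[hd1 ht] h0.
have th0 : 0 <= t + h by move: ht; rewrite ltr_norml; lra.
have thE : t + h - t = h by ring.
have tht : t + h != t by rewrite -subr_eq0 thE.
have := hd _ th0 tht; rewrite thE => /(_ hd1) H.
have -> : fp t - h^-1 *: (f (t + h) - f t) = - (f (t + h) - f t - fp t * h) / h.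
  by rewrite /GRing.scale /=; field.
by rewrite normrM normrN normfV ler_pdivrMr// normr_gt0.
Qed.

Lemma fext_id (u : R) : 0 <= u -> fext u = f u.
Proof. by move=> u0; rewrite /fext (max_idPl _). Qed.

Lemma fext_gt0 (u : R) : 0 < fext u.
Proof. by apply: f_pos; rewrite le_max lexx orbT. Qed.

Lemma fext_nondecr (u v : R) : u <= v -> fext u <= fext v.
Proof.
move=> uv; apply: f_nondecr; first by rewrite le_max lexx orbT.
by rewrite ge_max !le_max uv lexx !orbT.
Qed.

Lemma is_derive_fext (t : R) : 0 < t -> is_derive t 1 fext (fp t).
Proof.
move=> t0; apply: near_eq_is_derive (is_derive_f t0).
near=> u; rewrite fext_id// ltW//; near: u; exact: lt_nbhsr.
Unshelve. all: by end_near. Qed.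

Lemma continuous_fext : continuous fext.
Proof.
move=> t; have [t0|t0|->] := ltgtP t 0.
- apply: (@near_eq_continuous _ _ (cst (f 0))); last exact: cvg_cst.
  near=> u; rewrite /fext (max_idPr _)// ltW//; near: u; exact: lt_nbhsl.
- exact: continuous_of_derive (is_derive_fext t0).
- apply/cvgrPdist_le => e e0.
  have [d d0 hd] := diffquot_near (lexx 0) ltr01.
  have fp0 := fp_ge0 (lexx 0).
  exists (Num.min d (e / (fp 0 + 1))) => /=; first by rewrite lt_min d0 divr_gt0//; lra.
  move=> u /=; rewrite sub0r normrN lt_min ltr_pdivlMr; last lra.
  move=> /andP[ud ue].
  rewrite /fext (max_idPl (lexx 0)).
  have [u0|u0] := leP u 0; first by rewrite subrr normr0 ltW.
  have := hd u (ltW u0); rewrite subr0 gt_eqF// => /(_ isT ud).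
  have h2 : f 0 <= f u by apply: f_nondecr => //; exact: ltW.
  move: ue; rewrite gtr0_norm// => ue.
  move=> /(le_trans (ler_norm _)).
  rewrite distrC ger0_norm ?subr_ge0//; nra.
Unshelve. all: by end_near. Qed.

Lemma fext_tangent (a b : R) : 0 <= a -> 0 <= b -> fp a * (b - a) <= fext b - fext a.
Proof. by move=> a0 b0; rewrite !fext_id//; exact: convex_tangent. Qed.

End Nonlinearity.

(** * Order properties of the radial solution operator *)

(** [phi] and [psi] are controlled on [[0, 1]] only; composition with this projection makes them
    continuous on the whole line, as [prim] requires, without changing them on [[0, 1]]. *)
Definition clamp (R : realType) (s : R) : R := Num.max 0 (Num.min s 1).

Lemma clamp_id (R : realType) (s : R) : 0 <= s <= 1 -> clamp s = s.
Proof. by move=> /andP[s0 s1]; rewrite /clamp (min_idPl s1) (max_idPr s0). Qed.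

Lemma clamp_itv (R : realType) (s : R) : 0 <= clamp s <= 1.
Proof. by rewrite /clamp le_max lexx ge_max ler01 ge_min lexx orbT. Qed.

Lemma continuous_clamp (R : realType) : continuous (@clamp R).
Proof.
move=> s; apply: (@continuous_max _ _ (cst 0) (fun s : R => Num.min s 1)); first exact: cvg_cst.
by apply: (@continuous_min _ _ id (cst 1)); [exact: cvg_id|exact: cvg_cst].
Qed.

Section RadialOrder.
Variables (R : realType) (al : R) (ph : R -> R).
Hypothesis al0 : 0 <= al.
Hypothesis cph : continuous ph.
Hypothesis ph0 : forall s, 0 <= s <= 1 -> 0 <= ph s.

(** A constant source [e] has flux at most [e * w * r^2 / 2], because the derivative of this product
    is at least [r * w * e], the weight being nondecreasing. *)
Lemma flux_le (g1 g2 : R -> R) (e r : R) : continuous g1 -> continuous g2 -> 0 <= e ->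
  (forall t, 0 <= t <= 1 -> g1 t <= g2 t + e) -> 0 <= r <= 1 ->
  flux al ph g1 r <= flux al ph g2 r + e * (wt al ph r * (r ^+ 2 / 2)).
Proof.
move=> c1 c2 e0 g12 /andP[r0 r1].
pose D x := flux al ph g2 x + e * (wt al ph x * (x ^+ 2 / 2)) - flux al ph g1 x.
have dD (x : R) : 0 <= x -> is_derive x 1 D (x * wt al ph x * g2 x +
   e * (al * x * ph x * wt al ph x * (x ^+ 2 / 2) + wt al ph x * x) - x * wt al ph x * g1 x).
  move=> x0; have xN : - 2^-1 < x by lra.
  have h1 := is_derive_flux al cph c1 xN; have h2 := is_derive_flux al cph c2 xN.
  have h3 := is_derive_wt al cph xN.
  by apply: is_derive_eq; rewrite /GRing.scale /=; field.
suff : D 0 <= D r by rewrite /D !flux0 expr0n /= !mul0r !mulr0; lra.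
apply: (ge0_derive_le (dF := fun x => x * wt al ph x * g2 x +
   e * (al * x * ph x * wt al ph x * (x ^+ 2 / 2) + wt al ph x * x) - x * wt al ph x * g1 x)); [lra| | |].
- by move=> x /andP[x0 _]; apply: dD; exact: ltW.
- move=> x /andP[x0 xr]; have x01 : 0 <= x <= 1 by lra.
  have := g12 x x01; have := ph0 x01; have w0 := wt_gt0 al ph x.
  move=> p0 gg.
  have -> : x * wt al ph x * g2 x +
   e * (al * x * ph x * wt al ph x * (x ^+ 2 / 2) + wt al ph x * x) - x * wt al ph x * g1 x
   = x * wt al ph x * (g2 x + e - g1 x) + e * (al * x * ph x * wt al ph x * (x ^+ 2 / 2)) by ring.
  apply: addr_ge0.
    by apply: mulr_ge0; [apply: mulr_ge0; exact: ltW|rewrite subr_ge0].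
  do !apply: mulr_ge0 => //; try exact: ltW.
- by move=> x /andP[x0 _]; apply: continuous_of_derive (dD x x0).
Qed.

(** The error integrates to [e * (1 - r^2) / 4]. Room for an error is what the strict comparison
    with classical solutions and the passage to the limit in the iteration both call for. *)
Lemma rsol_le (g1 g2 : R -> R) (e r : R) : continuous g1 -> continuous g2 -> 0 <= e ->
  (forall t, 0 <= t <= 1 -> g1 t <= g2 t + e) -> 0 <= r <= 1 ->
  rsol al ph g1 r <= rsol al ph g2 r + e.
Proof.
move=> c1 c2 e0 g12 /andP[r0 r1].
pose E x := rsol al ph g1 x - rsol al ph g2 x + e / 4 * x ^+ 2.
have dE (x : R) : 0 <= x -> is_derive x 1 E
  (x * slope al ph g1 x - x * slope al ph g2 x + e / 2 * x).
  move=> x0; have h1 := is_derive_rsol al cph c1 x0; have h2 := is_derive_rsol al cph c2 x0.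
  by apply: is_derive_eq; rewrite /GRing.scale /=; field.
have : E r <= E 1.
  apply: (ge0_derive_le (dF := fun x => x * slope al ph g1 x - x * slope al ph g2 x + e / 2 * x)); [lra| | |].
  - by move=> x /andP[x0 _]; apply: dE; lra.
  - move=> x /andP[xr x1]; have x0 : 0 < x by lra.
    have x01 : 0 <= x <= 1 by lra.
    have := flux_le c1 c2 e0 g12 x01; rewrite !slopeE//.
    have w0 := wt_gt0 al ph x => h.
    have -> : x * (- flux al ph g1 x / (x ^+ 2 * wt al ph x)) -
       x * (- flux al ph g2 x / (x ^+ 2 * wt al ph x)) + e / 2 * x =
       (flux al ph g2 x + e * (wt al ph x * (x ^+ 2 / 2)) - flux al ph g1 x) / (x * wt al ph x).
      by field; rewrite !gt_eqF.
    by rewrite divr_ge0 ?subr_ge0// mulr_ge0// ltW.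
  - by move=> x /andP[xr _]; apply: continuous_of_derive (dE x _); lra.
rewrite /E !rsol1 expr1n; have := sqr_ge0 r; nra.
Qed.

Lemma flux_ge0 (g : R -> R) (r : R) : continuous g -> (forall t, 0 <= t <= 1 -> 0 <= g t) ->
  0 <= r <= 1 -> 0 <= flux al ph g r.
Proof.
move=> cg g0 r01.
have c0 : continuous (fun _ : R => 0 : R) by move=> x; exact: cvg_cst.
have : flux al ph (fun _ : R => 0) r <= flux al ph g r.
  by have := flux_le (e := 0) c0 cg (lexx 0) _ r01; rewrite mul0r addr0; apply => t /g0; rewrite addr0.
suff -> : flux al ph (fun _ : R => 0) r = 0 by [].
rewrite fluxE; under eq_fun do rewrite mulr0.
by rewrite prim_linear ?mul0r//; case/andP: r01.
Qed.

Lemma slope_le0 (g : R -> R) (r : R) : continuous g -> (forall t, 0 <= t <= 1 -> 0 <= g t) ->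
  0 <= r <= 1 -> slope al ph g r <= 0.
Proof.
move=> cg g0 /[dup] r01 /andP[r0 r1].
move: r0; rewrite le_eqVlt => /orP[/eqP <-|r0].
  by rewrite slope0 mulNr oppr_le0 divr_ge0// g0// lexx ler01.
rewrite slopeE// mulNr oppr_le0 divr_ge0 ?flux_ge0//.
by rewrite mulr_ge0 ?sqr_ge0// ltW// wt_gt0.
Qed.

Lemma rsol_nonincr (g : R -> R) (r s : R) : continuous g ->
  (forall t, 0 <= t <= 1 -> 0 <= g t) ->
  0 <= r -> r <= s -> s <= 1 -> rsol al ph g s <= rsol al ph g r.
Proof.
move=> cg g0 r0 rs s1; rewrite -lerN2.
have dd (x : R) : 0 <= x -> is_derive x 1 (fun x => - rsol al ph g x) (- (x * slope al ph g x)).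
  by move=> x0; have h := is_derive_rsol al cph cg x0; apply: is_derive_eq.
apply: (@ge0_derive_le _ (fun x => - rsol al ph g x) (fun x => - (x * slope al ph g x)) _ _ rs).
- by move=> x /andP[x0 _]; apply: dd; lra.
- move=> x /andP[x0 xs]; rewrite oppr_ge0 mulr_ge0_le0//; first lra.
  by apply: slope_le0 => //; lra.
- by move=> x /andP[x0 _]; apply: continuous_of_derive (dd x _); lra.
Qed.

(* Because the flux of a source bounded by [G] is at most [G w r^2 / 2]. *)
Lemma rsol_lipschitz (g : R -> R) (G r s : R) : continuous g -> 0 <= G ->
  (forall t, 0 <= t <= 1 -> g t <= G) ->
  0 <= r -> r <= s -> s <= 1 -> rsol al ph g r <= rsol al ph g s + G * (s - r).
Proof.
move=> cg G0 gG r0 rs s1.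
have dd (x : R) : 0 <= x -> is_derive x 1 (fun x => rsol al ph g x + G * x) (x * slope al ph g x + G).
  by move=> x0; have h := is_derive_rsol al cph cg x0; apply: is_derive_eq; rewrite /GRing.scale /=; ring.
suff : rsol al ph g r + G * r <= rsol al ph g s + G * s by lra.
apply: (@ge0_derive_le _ (fun x => rsol al ph g x + G * x) (fun x => x * slope al ph g x + G) _ _ rs).
- by move=> x /andP[x0 _]; apply: dd; lra.
- move=> x /andP[xr xs]; have x0 : 0 < x by lra.
  have x01 : 0 <= x <= 1 by lra.
  have c0 : continuous (fun _ : R => 0 : R) by move=> y; exact: cvg_cst.
  have gG' t : 0 <= t <= 1 -> g t <= 0 + G by move=> ht; rewrite add0r; exact: gG.
  have H := flux_le cg c0 G0 gG' x01; move: H.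
  have -> : flux al ph (fun _ : R => 0) x = 0.
    rewrite fluxE; under eq_fun do rewrite mulr0.
    by rewrite prim_linear ?mul0r//; case/andP: x01.
  rewrite add0r => H.
  rewrite slopeE//; have w0 := wt_gt0 al ph x.
  have -> : x * (- flux al ph g x / (x ^+ 2 * wt al ph x)) + G =
    (G * (wt al ph x * x) - flux al ph g x) / (x * wt al ph x).
    by field; rewrite !gt_eqF.
  rewrite divr_ge0//; last by rewrite mulr_ge0// ltW.
  rewrite subr_ge0; apply: le_trans H _.
  by apply: ler_wpM2l => //; apply: ler_wpM2l; [exact: ltW|nra].
- by move=> x /andP[x0 _]; apply: continuous_of_derive (dd x _); lra.
Qed.

End RadialOrder.

(** * Monotone iteration *)

Section FixedPoint.
Variables (R : realType) (al : R) (ph ps F : R -> R).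
Hypothesis al0 : 0 <= al.
Hypothesis cph : continuous ph.
Hypothesis ph0 : forall s, 0 <= s <= 1 -> 0 <= ph s.
Hypothesis cps : continuous ps.
Hypothesis ps01 : forall s, 0 <= s <= 1 -> 0 <= ps s <= 1.
Hypothesis cF : continuous F.
Hypothesis F0 : forall u, 0 < F u.
Hypothesis F_nondecr : forall u v, u <= v -> F u <= F v.
Implicit Types (V U : R -> R) (lam : R).

(** [V] enters through [clamp], so only its values on [[0, 1]] matter. *)
Definition source lam V (t : R) : R := lam * ps t * F (V (clamp t)).
Definition Tmap lam V : R -> R := rsol al ph (source lam V).
Definition Viter lam (n : nat) : R -> R := iter n (Tmap lam) (cst 0).

Lemma ViterS lam n : Viter lam n.+1 = Tmap lam (Viter lam n).
Proof. by []. Qed.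

Lemma continuous_source lam V : continuous V -> continuous (source lam V).
Proof.
move=> cV x; apply: cvgM; first by apply: cvgMr; exact: cps.
apply: (@continuous_comp _ _ _ (V \o @clamp R) F); last exact: cF.
apply: continuous_comp; first exact: continuous_clamp.
exact: cV.
Qed.

Lemma source_ge0 lam V t : 0 <= lam -> 0 <= t <= 1 -> 0 <= source lam V t.
Proof.
move=> l0 /ps01/andP[p0 _]; apply: mulr_ge0; last exact: ltW.
exact: mulr_ge0.
Qed.

Lemma continuous_Tmap lam V : continuous V -> continuous (Tmap lam V).
Proof. by move=> cV; apply: continuous_rsol => //; exact: continuous_source. Qed.

Lemma continuous_Viter lam n : continuous (Viter lam n).
Proof.
elim: n => [|n IH]; first by move=> x; exact: cvg_cst.
exact: continuous_Tmap.
Qed.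

Lemma Tmap_le lam lam' V U r : 0 <= lam -> lam <= lam' -> continuous V -> continuous U ->
  (forall t, 0 <= t <= 1 -> V t <= U t) -> 0 <= r <= 1 ->
  Tmap lam V r <= Tmap lam' U r.
Proof.
move=> l0 ll cV cU VU r01; rewrite -[leRHS]addr0.
apply: rsol_le => //; [exact: continuous_source..|].
move=> t /[dup] t01 /ps01/andP[p0 _]; rewrite addr0 /source clamp_id//.
apply: ler_pM; [exact: mulr_ge0|exact: ltW|exact: ler_wpM2r|].
by apply: F_nondecr; exact: VU.
Qed.

Lemma Tmap_ge0 lam V r : 0 <= lam -> continuous V -> 0 <= r <= 1 -> 0 <= Tmap lam V r.
Proof.
move=> l0 cV /andP[r0 r1]; rewrite -(rsol1 al ph (source lam V)).
apply: rsol_nonincr => //; first exact: continuous_source.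
by move=> t t01; exact: source_ge0.
Qed.

Lemma Tmap_nonincr lam V r s : 0 <= lam -> continuous V ->
  0 <= r -> r <= s -> s <= 1 -> Tmap lam V s <= Tmap lam V r.
Proof.
move=> l0 cV r0 rs s1; apply: rsol_nonincr => //; first exact: continuous_source.
by move=> t t01; exact: source_ge0.
Qed.

Lemma Viter_ge0 lam n r : 0 <= lam -> 0 <= r <= 1 -> 0 <= Viter lam n r.
Proof.
move=> l0 r01; case: n => [|n]; first exact: lexx.
by apply: Tmap_ge0 => //; exact: continuous_Viter.
Qed.

Lemma Viter_leS lam n r : 0 <= lam -> 0 <= r <= 1 -> Viter lam n r <= Viter lam n.+1 r.
Proof.
move=> l0; elim: n r => [|n IH] r r01; first exact: Viter_ge0.
rewrite (ViterS _ n) (ViterS _ n.+1).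
apply: Tmap_le => //; try exact: continuous_Viter; exact: IH.
Qed.

Lemma Viter_le lam m n r : 0 <= lam -> 0 <= r <= 1 -> (m <= n)%N -> Viter lam m r <= Viter lam n r.
Proof.
move=> l0 r01 /subnK <-; elim: (n - m)%N => [|k IH] //.
by apply: le_trans IH _; exact: Viter_leS.
Qed.

Lemma Viter_lam lam lam' n r : 0 <= lam -> lam <= lam' -> 0 <= r <= 1 ->
  Viter lam n r <= Viter lam' n r.
Proof.
move=> l0 ll; elim: n r => [|n IH] r r01; first exact: lexx.
rewrite !ViterS.
apply: Tmap_le => //; try exact: continuous_Viter; exact: IH.
Qed.

Lemma Viter_nonincr lam n r s : 0 <= lam -> 0 <= r -> r <= s -> s <= 1 ->
  Viter lam n s <= Viter lam n r.
Proof.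
move=> l0 r0 rs s1; case: n => [|n]; first exact: lexx.
by apply: Tmap_nonincr => //; exact: continuous_Viter.
Qed.

Lemma Viter_supersolution lam U n r : 0 <= lam -> continuous U ->
  (forall t, 0 <= t <= 1 -> 0 <= U t) -> (forall t, 0 <= t <= 1 -> Tmap lam U t <= U t) ->
  0 <= r <= 1 -> Viter lam n r <= U r.
Proof.
move=> l0 cU U0 TU; elim: n r => [|n IH] r r01; first exact: U0.
rewrite ViterS; apply: le_trans (TU r r01); apply: Tmap_le => //; try exact: continuous_Viter; exact: IH.
Qed.

(** The monotone limit of the iterates. It is finite as soon as they are bounded at 0, where each of
    them is largest. *)
Definition Vsol lam (r : R) : R := sup [set Viter lam n (clamp r) | n in [set: nat]].

Section Bounded.
Variables (lam B : R).
Hypothesis lam0 : 0 <= lam.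
Hypothesis VB : forall n, Viter lam n 0 <= B.

Let VnB n r : 0 <= r <= 1 -> Viter lam n r <= B.
Proof. by move=> /andP[r0 r1]; apply: le_trans (VB n); exact: Viter_nonincr. Qed.

Let has_supV r : has_sup [set Viter lam n (clamp r) | n in [set: nat]].
Proof.
split; first by exists (Viter lam 0 (clamp r)), 0%N.
by exists B => _ [n _ <-]; apply: VnB; exact: clamp_itv.
Qed.

Lemma Vsol_ge n r : 0 <= r <= 1 -> Viter lam n r <= Vsol lam r.
Proof.
move=> r01; apply: ub_le_sup; first by case: (has_supV r).
by exists n => //; rewrite clamp_id.
Qed.

Lemma Vsol_le r b : 0 <= r <= 1 -> (forall n, Viter lam n r <= b) -> Vsol lam r <= b.
Proof.
move=> r01 h; apply: ge_sup; first by case: (has_supV r).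
by move=> _ [n _ <-]; rewrite clamp_id.
Qed.

Lemma Vsol_ge0 r : 0 <= r <= 1 -> 0 <= Vsol lam r.
Proof. by move=> r01; apply: le_trans (Vsol_ge 0 r01); exact: Viter_ge0. Qed.

Let Vsol_clamp r : Vsol lam (clamp r) = Vsol lam r.
Proof. by rewrite /Vsol (clamp_id (clamp_itv r)). Qed.

(** All iterates are Lipschitz with the constant [lam * F B], and this passes to their supremum.
    Continuity of the limit is thus available before uniform convergence, which relies on it. *)
Let Vsol_lip r s : 0 <= r -> r <= s -> s <= 1 ->
  Vsol lam s <= Vsol lam r <= Vsol lam s + lam * F B * (s - r).
Proof.
move=> r0 rs s1.
have r01 : 0 <= r <= 1 by lra.
have s01 : 0 <= s <= 1 by lra.
apply/andP; split.
  apply: Vsol_le => // n; apply: le_trans (Vsol_ge n r01).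
  exact: Viter_nonincr.
have G0 : 0 <= lam * F B by rewrite mulr_ge0// ltW.
apply: Vsol_le => // n.
apply: (@le_trans _ _ (Viter lam n s + lam * F B * (s - r))); last first.
  by rewrite lerD2r; exact: Vsol_ge.
case: n => [|n]; first by rewrite /= add0r mulr_ge0// subr_ge0.
apply: rsol_lipschitz => //; first by apply: continuous_source; exact: continuous_Viter.
move=> t t01; rewrite /source clamp_id//.
have /andP[p0 p1] := ps01 t01.
apply: ler_pM; [exact: mulr_ge0|exact: ltW|exact: ler_piMr|].
by apply: F_nondecr; exact: VnB.
Qed.

Lemma continuous_Vsol : continuous (Vsol lam).
Proof.
pose G := lam * F B.
have G0 : 0 <= G by rewrite mulr_ge0// ltW.
have lip r s : 0 <= r <= 1 -> 0 <= s <= 1 -> `|Vsol lam r - Vsol lam s| <= G * `|r - s|.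
  move=> r01 s01; have [rs|sr] := leP r s.
    have := @Vsol_lip r s; rewrite -/G.
    rewrite (distrC r) (ger0_norm (_ : 0 <= s - r)); last lra.
    rewrite ler_norml; lra.
  have := @Vsol_lip s r; rewrite -/G.
  rewrite (ger0_norm (_ : 0 <= r - s)); last lra.
  rewrite ler_norml; lra.
move=> r; apply/cvgrPdist_le => e e0.
have : \forall s \near r, `|clamp r - clamp s| <= e / (G + 1).
  move: (@continuous_clamp R r) => /cvgrPdist_le; apply.
  by rewrite divr_gt0// ltr_wpDl.
apply: filterS => s; rewrite ler_pdivlMr ?ltr_wpDl// => h.
rewrite -(Vsol_clamp r) -(Vsol_clamp s).
apply: (le_trans (lip _ _ (clamp_itv r) (clamp_itv s))).
have := normr_ge0 (clamp r - clamp s); nra.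
Qed.

(* Dini's theorem. *)
Let Vsol_uniform e : 0 < e ->
  exists n, forall r, 0 <= r <= 1 -> F (Vsol lam r) <= F (Viter lam n r) + e.
Proof.
move=> e0.
have e2 : 0 < e / 2 by rewrite divr_gt0.
have cFV (W : R -> R) : continuous W -> continuous (fun r => F (W r)).
  by move=> cW x; apply: (@continuous_comp _ _ _ W F); [exact: cW|exact: cF].
have nc := (compact_near_coveringP _).1 (@segment_compact R 0 1).
(* Near each [r] a single index [n] is good up to [e / 2], continuity of both sides costs [e / 4]
   each, and monotonicity in [n] takes care of the later indices; compactness then makes the index
   uniform. *)
have := nc nat \oo (fun n r => 0 <= r <= 1 -> F (Vsol lam r) <= F (Viter lam n r) + e) _ _.
case.
  move=> r; rewrite /= in_itv /= => r01.
  have [n hn] : exists n, F (Vsol lam r) <= F (Viter lam n r) + e / 2.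
    have /cvgrPdist_le/(_ _ e2)[d /= d0 hd] : {for Vsol lam r, continuous F} by exact: cF.
    have [_ [n _ <-] hn] := sup_adherent d0 (has_supV r).
    have {}hn : Vsol lam r - d < Viter lam n r by rewrite -{2}(clamp_id r01).
    exists n.
    have hle := Vsol_ge n r01.
    have := hd (Viter lam n r); rewrite /= ger0_norm ?subr_ge0//.
    have : Vsol lam r - Viter lam n r < d by lra.
    by move=> h /(_ h); rewrite ler_norml => /andP[]; lra.
  have e8 : 0 < e / 4 by rewrite divr_gt0.
  have /cvgrPdist_le/(_ _ e8) n1 : {for r, continuous (fun r => F (Vsol lam r))}.
    by apply: cFV; exact: continuous_Vsol.
  have /cvgrPdist_le/(_ _ e8) n2 : {for r, continuous (fun r => F (Viter lam n r))}.
    by apply: cFV; exact: continuous_Viter.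
  exists ([set s | `|F (Vsol lam r) - F (Vsol lam s)| <= e / 4 /\
              `|F (Viter lam n r) - F (Viter lam n s)| <= e / 4], [set m | (n <= m)%N]).
    split; first exact: filterI.
    by exists n.
  move=> [s m] /= [[h1 h2] nm] s01.
  have := F_nondecr (Viter_le lam0 s01 nm).
  move: h1 h2; rewrite !ler_norml; lra.
move=> n _ /(_ n (leqnn n)) h; exists n => r r01; apply: h => //.
Qed.

(** One inequality is the monotonicity of [Tmap]. The other exchanges [Tmap] with a supremum and
    rests on the uniform approximation. *)
Lemma Vsol_fix r : 0 <= r <= 1 -> Tmap lam (Vsol lam) r = Vsol lam r.
Proof.
move=> r01; apply/le_anti/andP; split; last first.
  apply: Vsol_le => // -[|n].
    by apply: Tmap_ge0 => //; exact: continuous_Vsol.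
  rewrite ViterS; apply: Tmap_le => //; [exact: continuous_Viter|exact: continuous_Vsol|].
  by move=> t t01; exact: Vsol_ge.
apply/ler_addgt0Pr => e e0.
have el : 0 < e / (lam + 1) by rewrite divr_gt0// ltr_wpDl.
have [n hn] := Vsol_uniform el.
apply: (@le_trans _ _ (Viter lam n.+1 r + e)); last by rewrite lerD2r; exact: Vsol_ge.
apply: rsol_le => //.
- by apply: continuous_source; exact: continuous_Vsol.
- by apply: continuous_source; exact: continuous_Viter.
- exact: ltW.
move=> t t01; rewrite /source clamp_id//.
have /andP[p0 p1] := ps01 t01.
have h := hn t t01.
have lp : 0 <= lam * ps t by exact: mulr_ge0.
have h2 : lam * ps t * F (Vsol lam t) <= lam * ps t * (F (Viter lam n t) + e / (lam + 1)).
  exact: ler_wpM2l.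
apply: le_trans h2 _; rewrite mulrDr lerD2l.
rewrite mulrA ler_pdivrMr ?ltr_wpDl// mulrC ler_pM2l//.
apply: (@le_trans _ _ lam); last by rewrite lerDl.
exact: ler_piMr.
Qed.

End Bounded.
End FixedPoint.

(** * Iterates and classical solutions *)

Lemma lipschitz_const (R : realType) (h : R -> R) :
  [lipschitz h r | r in `[0, 1]%classic] ->
  exists2 L : R, 0 < L & forall r s, 0 <= r <= 1 -> 0 <= s <= 1 ->
    `|h r - h s| <= L * `|r - s|.
Proof.
move=> [M [_ hM]].
exists (Num.max M 0 + 1); first by rewrite ltr_wpDl// le_max lexx orbT.
move=> r s r01 s01.
have := hM (Num.max M 0 + 1); rewrite ltr_pwDr// ?le_max ?lexx// => /(_ isT (r, s)).
by apply; split; rewrite /= in_itv.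
Qed.

Lemma continuous_lipschitz_clamp (R : realType) (h : R -> R) :
  [lipschitz h r | r in `[0, 1]%classic] -> continuous (h \o @clamp R).
Proof.
move=> /lipschitz_const[L L0 hL] r; apply/cvgrPdist_le => e e0.
have /cvgrPdist_le/(_ _ (divr_gt0 e0 L0)) : {for r, continuous (@clamp R)}.
  exact: continuous_clamp.
apply: filterS => s; rewrite ler_pdivlMr// => h1.
apply: (le_trans (hL _ _ (clamp_itv r) (clamp_itv s))); by rewrite mulrC.
Qed.

Section StrictPositivity.
Variables (R : realType) (al : R) (ph g : R -> R).
Hypothesis cph : continuous ph.
Hypothesis cg : continuous g.
Hypothesis g0 : forall t, 0 <= t <= 1 -> 0 <= g t.

Lemma flux_nondecr (r s : R) : 0 <= r -> r <= s -> s <= 1 -> flux al ph g r <= flux al ph g s.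
Proof.
move=> r0 rs s1.
have dd (x : R) : 0 <= x -> is_derive x 1 (flux al ph g) (x * wt al ph x * g x).
  by move=> x0; apply: is_derive_flux => //; lra.
apply: (@ge0_derive_le _ (flux al ph g) (fun x => x * wt al ph x * g x) _ _ rs).
- by move=> x /andP[x0 _]; apply: dd; lra.
- move=> x /andP[x0 xs]; rewrite mulr_ge0//; last by apply: g0; lra.
  by rewrite mulr_ge0 ?(ltW (wt_gt0 _ _ _))//; lra.
- by move=> x /andP[x0 _]; apply: continuous_of_derive (dd x _); lra.
Qed.

Hypothesis g00 : 0 < g 0.

(** [psi] may vanish away from the origin; a source that is positive near 0 already makes the flux
    positive on all of []0, 1]]. *)
Lemma flux_gt0 (r : R) : 0 < r -> r <= 1 -> 0 < flux al ph g r.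
Proof.
move=> r0 r1.
have [d /= d0 hd] : \forall t \near (0 : R), 0 < g t.
  have /cvgr_gt : {for (0 : R), continuous g} by exact: cg.
  exact.
pose m := Num.min r d.
have m0 : 0 < m by rewrite lt_min r0 d0.
have mr : m <= r by rewrite ge_min lexx.
have md : m <= d by rewrite ge_min lexx orbT.
apply: (@lt_le_trans _ _ (flux al ph g m)); last by apply: flux_nondecr => //; lra.
rewrite -(flux0 al ph g).
have dd (x : R) : 0 <= x -> is_derive x 1 (flux al ph g) (x * wt al ph x * g x).
  by move=> x0; apply: is_derive_flux => //; lra.
apply: (@gt0_derive_lt _ (flux al ph g) (fun x => x * wt al ph x * g x) _ _ m0).
- by move=> x /andP[x0 _]; apply: dd; lra.
- move=> x /andP[x0 xm]; rewrite mulr_gt0//; last first.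
    by apply: hd; rewrite /= sub0r normrN gtr0_norm//; lra.
  by rewrite mulr_gt0// wt_gt0.
- by move=> x /andP[x0 _]; apply: continuous_of_derive (dd x _); lra.
Qed.

Lemma rsol_decr (r s : R) : 0 <= r -> r < s -> s <= 1 -> rsol al ph g s < rsol al ph g r.
Proof.
move=> r0 rs s1; rewrite -ltrN2.
have dd (x : R) : 0 <= x -> is_derive x 1 (fun x => - rsol al ph g x) (- (x * slope al ph g x)).
  by move=> x0; have h := is_derive_rsol al cph cg x0; apply: is_derive_eq.
apply: (@gt0_derive_lt _ (fun x => - rsol al ph g x) (fun x => - (x * slope al ph g x)) _ _ rs).
- by move=> x /andP[x0 _]; apply: dd; lra.
- move=> x /andP[rx xs]; have x0 : 0 < x by lra.
  rewrite slopeE// -mulrN mulNr opprK mulr_gt0// divr_gt0//; last first.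
    by rewrite mulr_gt0 ?exprn_gt0// wt_gt0.
  by apply: flux_gt0 => //; lra.
- by move=> x /andP[x0 _]; apply: continuous_of_derive (dd x _); lra.
Qed.

End StrictPositivity.

Section Problem.
Variables (R : realType) (f phi psi : R -> R) (al : R).
Hypothesis al0 : 0 < al.
Hypothesis f_C1 : C1_0y f.
Hypothesis f_pos : forall t : R, 0 <= t -> 0 < f t.
Hypothesis f_nondecr : forall s t : R, 0 <= s -> s <= t -> f s <= f t.
Hypothesis phi_ge0 : forall r : R, 0 <= r <= 1 -> 0 <= phi r.
Hypothesis psi_ge0 : forall r : R, 0 <= r <= 1 -> 0 <= psi r.
Hypothesis psi_noninc : forall r s : R, 0 <= r -> r <= s -> s <= 1 -> psi s <= psi r.
Hypothesis phi_lip : [lipschitz phi r | r in `[0, 1]%classic].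
Hypothesis psi_lip : [lipschitz psi r | r in `[0, 1]%classic].
Hypothesis psi0 : psi 0 = 1.

Notation ph := (phi \o @clamp R).
Notation ps := (psi \o @clamp R).
Notation F := (fext f).
Notation Viter := (Viter al ph ps F).
Notation Vsol := (Vsol al ph ps F).
Notation src := (source ps F).

Let cph : continuous ph. Proof. exact: continuous_lipschitz_clamp. Qed.
Let cps : continuous ps. Proof. exact: continuous_lipschitz_clamp. Qed.
Let cF : continuous F. Proof. exact: continuous_fext. Qed.
Let F0 u : 0 < F u. Proof. exact: fext_gt0. Qed.
Let F_nondecr u v : u <= v -> F u <= F v. Proof. exact: fext_nondecr. Qed.

Lemma ph_ge0 s : 0 <= s <= 1 -> 0 <= ph s.
Proof. by move=> s01; apply: phi_ge0; exact: clamp_itv. Qed.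

Lemma ps_itv s : 0 <= s <= 1 -> 0 <= ps s <= 1.
Proof.
move=> s01; have /andP[c0 c1] := clamp_itv s.
by rewrite /= psi_ge0 ?c0//= -psi0 psi_noninc.
Qed.

(** Induction on [n]. The strict comparison becomes applicable once the source is lowered by [e],
    which changes the radial solution by at most [e]. *)
Lemma Viter_le_classical lam u n x : 0 <= lam ->
  classical_solution f phi psi lam al u -> disk x -> Viter lam n (enorm x) <= u x.
Proof.
move=> l0 [[C2u cu] eu u0 ub].
elim: n x => [|n IH] x dx; first exact: ltW (u0 x dx).
have en (y : R * R) : disk y -> 0 <= enorm y <= 1.
  by move=> dy; rewrite enorm_ge0; exact: ltW dy.
have cV : continuous (Viter lam n) by exact: continuous_Viter.
have cs : continuous (src lam (Viter lam n)) by exact: continuous_source.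
rewrite ViterS.
apply/ler_addgt0Pr => e e0.
pose g t := src lam (Viter lam n) t - e.
have cg : continuous g by move=> t; apply: cvgB; [exact: cs|exact: cvg_cst].
apply: (@le_trans _ _ (rsol al ph g (enorm x) + e)).
  apply: rsol_le => //; [exact: ltW|exact: ph_ge0|exact: ltW| |exact: en].
  by move=> t _; rewrite /g subrK.
rewrite lerD2r -radialE.
apply: (radial_le_strict cph cg C2u cu ub) => // y dy.
have E : ph (enorm y) = phi (enorm y) by rewrite /= clamp_id// en.
rewrite E eu// /g /source /= !clamp_id ?en//.
rewrite ltrBlDr; apply: (@le_lt_trans _ _ (lam * psi (enorm y) * f (u y))); last first.
  by rewrite ltrDl.
apply: ler_wpM2l; first by rewrite mulr_ge0// psi_ge0// en.
rewrite -(fext_id f (ltW (u0 y dy))); apply: F_nondecr.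
exact: IH.
Qed.

Lemma Viter0_le_classical lam u n : 0 <= lam ->
  classical_solution f phi psi lam al u -> Viter lam n 0 <= u (0, 0).
Proof.
move=> l0 hu; have := @Viter_le_classical lam u n (0, 0) l0 hu.
have -> : enorm ((0, 0) : R * R) = 0 by exact: enorm0.
by apply; rewrite /disk /= (_ : enorm _ = 0) ?ltr01//; exact: enorm0.
Qed.

Section FixedLambda.
Variables (lam B : R).
Hypothesis lam0 : 0 < lam.
Hypothesis VB : forall n, Viter lam n 0 <= B.

Let cV : continuous (Vsol lam).
Proof. by apply: continuous_Vsol VB => //; [exact: ltW|exact: ph_ge0|exact: ps_itv|exact: ltW]. Qed.

Lemma continuous_gsol : continuous (src lam (Vsol lam)).
Proof. exact: continuous_source. Qed.

Lemma gsol_ge0 t : 0 <= t <= 1 -> 0 <= src lam (Vsol lam) t.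
Proof. by move=> t01; apply: source_ge0 t01 => //; [exact: ps_itv|exact: ltW]. Qed.

Lemma gsol_gt0 : 0 < src lam (Vsol lam) 0.
Proof.
rewrite /source /= clamp_id ?lexx ?ler01// psi0 mulr1.
exact: mulr_gt0.
Qed.

Lemma Vsol_rsol r : 0 <= r <= 1 -> Vsol lam r = rsol al ph (src lam (Vsol lam)) r.
Proof.
move=> r01; symmetry.
by apply: Vsol_fix VB r r01 => //; [exact: ltW|exact: ph_ge0|exact: ps_itv|exact: ltW].
Qed.

Lemma Vsol1 : Vsol lam 1 = 0.
Proof. by rewrite Vsol_rsol ?rsol1// ler01 lexx. Qed.

Lemma Vsol_decr r s : 0 <= r -> r < s -> s <= 1 -> Vsol lam s < Vsol lam r.
Proof.
move=> r0 rs s1; rewrite !Vsol_rsol; [|lra|lra].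
exact: (rsol_decr al cph continuous_gsol gsol_ge0 gsol_gt0 r0 rs s1).
Qed.

Lemma Vsol_gt0 r : 0 <= r -> r < 1 -> 0 < Vsol lam r.
Proof. by move=> r0 r1; rewrite -Vsol1; exact: Vsol_decr. Qed.

Lemma classical_Vsol :
  classical_solution f phi psi lam al (radial al ph (src lam (Vsol lam))).
Proof.
have en (y : R * R) : disk y -> 0 <= enorm y <= 1.
  by move=> dy; rewrite enorm_ge0; exact: ltW dy.
have cg := continuous_gsol.
have rE y : disk y -> radial al ph (src lam (Vsol lam)) y = Vsol lam (enorm y).
  by move=> dy; rewrite radialE -Vsol_rsol// en.
split.
- split; first exact: C2_radial.
  by apply: continuous_subspaceT; exact: continuous_radial.
- move=> x dx; have V0 : 0 < Vsol lam (enorm x) by apply: Vsol_gt0 => //; exact: enorm_ge0.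
  have e1 : src lam (Vsol lam) (enorm x) = lam * psi (enorm x) * f (Vsol lam (enorm x)).
    by rewrite /source /= !(clamp_id (en x dx)) fext_id// ltW.
  have e2 : ph (enorm x) = phi (enorm x) by rewrite /= (clamp_id (en x dx)).
  by rewrite (rE x dx) -e1 -e2; exact: equation_radial.
- by move=> x dx; rewrite rE// Vsol_gt0// enorm_ge0.
- by move=> x cx; rewrite radialE cx rsol1.
Qed.

End FixedLambda.
End Problem.

(** * Stability estimate at the scale [alpha^(-1/2)] *)

Section WeightBounds.
Variables (R : realType) (al : R) (ph : R -> R).
Hypothesis al0 : 0 <= al.
Hypothesis cph : continuous ph.
Hypothesis ph01 : forall s, 0 <= s <= 1 -> 0 <= ph s <= 1.

Lemma wt_nondecr (r s : R) : 0 <= r -> r <= s -> s <= 1 -> wt al ph r <= wt al ph s.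
Proof.
move=> r0 rs s1.
have dd (x : R) : 0 <= x -> is_derive x 1 (wt al ph) (al * x * ph x * wt al ph x).
  by move=> x0; apply: is_derive_wt => //; lra.
apply: (@ge0_derive_le _ (wt al ph) (fun x => al * x * ph x * wt al ph x) _ _ rs).
- by move=> x /andP[x0 _]; apply: dd; lra.
- move=> x /andP[x0 xs]; have /andP[p0 _] : 0 <= ph x <= 1 by apply: ph01; lra.
  apply: mulr_ge0; last exact: ltW (wt_gt0 _ _ _).
  by rewrite mulr_ge0// mulr_ge0//; lra.
- by move=> x /andP[x0 _]; apply: continuous_of_derive (dd x _); lra.
Qed.

Lemma wt_ge1 (s : R) : 0 <= s -> s <= 1 -> 1 <= wt al ph s.
Proof. by move=> s0 s1; rewrite -(wt0 al ph); exact: wt_nondecr. Qed.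

Lemma wt_le_expR (s : R) : 0 <= s -> s <= 1 -> wt al ph s <= expR (al * (s ^+ 2 / 2)).
Proof.
move=> s0 s1; rewrite wtE ler_expR; apply: ler_wpM2l => //.
have := @prim_le _ (fun t : R => t * ph t) (fun t : R => t * 1) 0 s.
rewrite !prim0 !subr0 prim_linear// mul1r; apply => //.
- exact: continuous_idM.
- by move=> x; apply: cvgMl; exact: cvg_id.
- move=> x /andP[x0 xs]; apply: ler_wpM2l; first exact: ltW.
  by have /andP[] : 0 <= ph x <= 1 by apply: ph01; lra.
Qed.

Lemma expR_half_le2 : expR (2^-1 : R) <= 2.
Proof.
have h := expR_ge1Dx (- 2^-1 : R).
have e0 := expR_gt0 (2^-1 : R).
have : expR (- 2^-1 : R) * expR 2^-1 = 1 by rewrite -expRD addNr expR0.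
nra.
Qed.

(** This fixes the length scale of the estimates near the origin: up to [al^(-1/2)] the drift
    changes the weight by a factor of at most 2. *)
Lemma wt_le2 (s : R) : 0 <= s -> s <= 1 -> al * s ^+ 2 <= 1 -> wt al ph s <= 2.
Proof.
move=> s0 s1 h; apply: le_trans (wt_le_expR s0 s1) _.
apply: le_trans expR_half_le2; rewrite ler_expR; lra.
Qed.

(* If [Z' = - X / (s w)] with [X] nondecreasing, then [Z] drops on [rho, 2 rho]
   by at least [X rho / (2 w)]. *)
Lemma flux_le_value (Z X : R -> R) (rho : R) : 0 < rho -> 2 * rho < 1 ->
  al * (2 * rho) ^+ 2 <= 1 ->
  (forall s : R, 0 < s < 1 -> is_derive s 1 Z (- (X s / (s * wt al ph s)))) ->
  (forall s, rho <= s < 1 -> X rho <= X s) -> 0 <= X rho -> 0 <= Z (2 * rho) ->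
  X rho <= 4 * Z rho.
Proof.
move=> r0 r1 alr dZ Xm X0 Z2.
pose c := X rho / (4 * rho).
have c0 : 0 <= c by rewrite divr_ge0// mulr_ge0// ltW.
have h : - (Z rho + c * rho) <= - (Z (2 * rho) + c * (2 * rho)).
  have dd (x : R) : rho <= x <= 2 * rho ->
     is_derive x 1 (fun x => - (Z x + c * x)) (X x / (x * wt al ph x) - c).
    move=> hx; have x01 : 0 < x < 1 by lra.
    by have h1 := dZ x x01; apply: is_derive_eq; rewrite /GRing.scale /=; ring.
  apply: (@ge0_derive_le _ (fun x => - (Z x + c * x)) (fun x => X x / (x * wt al ph x) - c)).
  - lra.
  - by move=> x hx; apply: dd; lra.
  - move=> x /andP[x0 x2]; rewrite subr_ge0.
    have w0 := wt_gt0 al ph x.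
    have w2 : wt al ph x <= 2.
      apply: (@le_trans _ _ (wt al ph (2 * rho))); first by apply: wt_nondecr; lra.
      by apply: wt_le2; lra.
    have xx : 0 < x by lra.
    rewrite ler_pdivlMr ?mulr_gt0//.
    apply: (@le_trans _ _ (X rho)); last by apply: Xm; lra.
    rewrite /c mulrAC ler_pdivrMr; last by lra.
    by apply: ler_wpM2l => //; nra.
  - by move=> x hx; apply: continuous_of_derive (dd x _); lra.
have E : c * (2 * rho) = X rho / 4 + c * rho by rewrite /c; field; rewrite gt_eqF.
by move: h; rewrite lerN2 E; lra.
Qed.

End WeightBounds.

(* The derivative at [s] of the energy with the coefficients of the drift and
   of the reaction frozen at [s]; [q] stands for [psi s - L (x - s)]. *)
Lemma is_derive_energy (R : realType) (al lam L t s a p : R) (w v Fw X Z W : R -> R)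
  (f1 gd : R) :
  0 < s -> 0 < t -> 0 < w s -> 0 < Z s ->
  is_derive s 1 w (al * s * a * w s) ->
  is_derive s 1 v (lam * p * Fw s - v s / s - al * s * a * v s) ->
  is_derive s 1 Fw (- (f1 * v s)) ->
  is_derive s 1 X (s * w s * gd) ->
  is_derive s 1 Z (- (X s / (s * w s))) ->
  is_derive s 1 W (- v s) ->
  is_derive s 1 (fun x => W x + t * (- (w x * v x ^+ 2) - al * x ^+ 2 * w x * a * v x ^+ 2
     + x * w x * (lam * (p - L * (x - s)) * Fw x) * v x + v x ^+ 2 * X x * (Z x)^-1)
     + x ^+ 2 / (4 * t))
  (- v s + t * (s * w s * (lam * p * Fw s - v s / s - al * s * a * v s + v s * X s / (s * w s * Z s)) ^+ 2
     + w s * v s ^+ 2 / s - al * a * s * w s * v s ^+ 2 - lam * p * s * w s * f1 * v s ^+ 2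
     - lam * L * s * w s * Fw s * v s + v s ^+ 2 * s * w s * gd / Z s) + s / (2 * t)).
Proof.
move=> s0 t0 w0 Z0 dw dv dF dX dZ dW.
have dZi := is_deriveV (lt0r_neq0 Z0) dZ.
apply: is_derive_eq; rewrite /GRing.scale /=; field.
by rewrite !gt_eqF.
Qed.

Section Core.
Variables (R : realType) (al lam L : R) (ph ps F fp g g' : R -> R).
Hypothesis al0 : 0 < al.
Hypothesis lam0 : 0 < lam.
Hypothesis L0 : 0 <= L.
Hypothesis cph : continuous ph.
Hypothesis ph01 : forall s, 0 <= s <= 1 -> 0 <= ph s <= 1.
Hypothesis ph_noninc : forall r s, 0 <= r -> r <= s -> s <= 1 -> ph s <= ph r.
Hypothesis ps01 : forall s, 0 <= s <= 1 -> 0 <= ps s <= 1.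
Hypothesis ps_noninc : forall r s, 0 <= r -> r <= s -> s <= 1 -> ps s <= ps r.
Hypothesis ps_lip : forall r s, 0 <= r -> r <= s -> s <= 1 -> ps r - L * (s - r) <= ps s.
Hypothesis F0 : forall u, 0 < F u.
Hypothesis F_nondecr : forall u v, u <= v -> F u <= F v.
Hypothesis dF : forall u : R, 0 < u -> is_derive u 1 F (fp u).
Hypothesis F_tangent : forall u v, 0 <= u -> 0 <= v -> fp u * (v - u) <= F v - F u.
Hypothesis fp_mono : forall u v, 0 <= u -> u <= v -> fp u <= fp v.
Hypothesis fp0 : forall u, 0 <= u -> 0 <= fp u.
Hypothesis cg : continuous g.
Hypothesis cg' : continuous g'.

Notation w := (wt al ph).
Notation W := (rsol al ph g).
Notation W' := (rsol al ph g').
Notation Q := (flux al ph g).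
Notation X := (fun s : R => flux al ph g' s - flux al ph g s).
Notation Z := (fun s : R => W' s - W s).

Hypothesis gE : forall s, 0 <= s <= 1 -> g s = lam * ps s * F (W s).
Hypothesis g_ge0 : forall s, 0 <= s <= 1 -> 0 <= g s.
Hypothesis W_gt0 : forall s, 0 <= s -> s < 1 -> 0 < W s.
Hypothesis W_decr : forall r s, 0 <= r -> r <= s -> s <= 1 -> W s <= W r.
Hypothesis Z_ge0 : forall s, 0 <= s <= 1 -> W s <= W' s.
Hypothesis gg : forall s, 0 <= s <= 1 -> lam * ps s * (F (W' s) - F (W s)) <= g' s - g s.
Hypothesis gg0 : 0 < g' 0 - g 0.

Let dQ (s : R) : 0 <= s -> is_derive s 1 Q (s * w s * g s).
Proof. by move=> s0; apply: is_derive_flux => //; lra. Qed.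

Let dX (s : R) : 0 <= s -> is_derive s 1 X (s * w s * (g' s - g s)).
Proof.
move=> s0; have h1 := dQ s0.
have h2 : is_derive s 1 (flux al ph g') (s * w s * g' s) by apply: is_derive_flux => //; lra.
by apply: is_derive_eq; ring.
Qed.

Let dW (s : R) : 0 < s -> is_derive s 1 W (- (Q s / (s * w s))).
Proof.
move=> s0; have h := is_derive_rsol al cph cg (ltW s0).
apply: is_derive_eq h _; rewrite slopeE//; field.
by rewrite !gt_eqF ?wt_gt0.
Qed.

Let dZ (s : R) : 0 < s -> is_derive s 1 Z (- (X s / (s * w s))).
Proof.
move=> s0; have h := is_derive_rsol al cph cg' (ltW s0); have h1 := dW s0.
have w0 := wt_gt0 al ph s.
apply: is_derive_eq; rewrite slopeE//; field.
by rewrite !gt_eqF.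
Qed.

Let Zp_ge0 s : 0 <= s <= 1 -> 0 <= Z s.
Proof. by move=> s01; rewrite subr_ge0; exact: Z_ge0. Qed.

(** The tangent inequality for the convex [F]: [Z] is a supersolution of the equation linearized at
    [W]. *)
Let gg_ge s : 0 <= s -> s < 1 -> lam * ps s * fp (W s) * Z s <= g' s - g s.
Proof.
move=> s0 s1; have s01 : 0 <= s <= 1 by lra.
apply: le_trans (gg s01); rewrite -mulrA; apply: ler_wpM2l.
  by rewrite mulr_ge0 ?(ltW lam0)//; case/andP: (ps01 s01).
by apply: F_tangent; [exact: ltW (W_gt0 s0 s1)|apply: le_trans (Z_ge0 s01); exact: ltW (W_gt0 s0 s1)].
Qed.

Let gg_ge0 s : 0 <= s <= 1 -> 0 <= g' s - g s.
Proof.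
move=> s01; apply: le_trans (gg s01); rewrite mulr_ge0//.
  by rewrite mulr_ge0 ?(ltW lam0)//; case/andP: (ps01 s01).
by rewrite subr_ge0; apply: F_nondecr; exact: Z_ge0.
Qed.

Let X_mono r s : 0 <= r -> r <= s -> s <= 1 -> X r <= X s.
Proof.
move=> r0 rs s1.
apply: (@ge0_derive_le _ X (fun s => s * w s * (g' s - g s)) _ _ rs).
- by move=> x /andP[x0 _]; apply: dX; lra.
- move=> x /andP[x0 xs]; rewrite mulr_ge0//; last by apply: gg_ge0; lra.
  by rewrite mulr_ge0 ?(ltW (wt_gt0 _ _ _))//; lra.
- by move=> x /andP[x0 _]; apply: continuous_of_derive (dX _); lra.
Qed.

Let X_ge0 s : 0 <= s -> s <= 1 -> 0 <= X s.
Proof. by move=> s0 s1; have := X_mono (lexx 0) s0 s1; rewrite !flux0 subrr. Qed.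

Let X_gt0 s : 0 < s -> s <= 1 -> 0 < X s.
Proof.
move=> s0 s1.
have cgg : continuous (fun t => g' t - g t) by move=> x; apply: cvgB; [exact: cg'|exact: cg].
have [d /= d0 hd] : \forall t \near (0 : R), 0 < g' t - g t.
  have /cvgr_gt : {for (0 : R), continuous (fun t => g' t - g t)} by exact: cgg.
  exact.
pose m := Num.min s d.
have m0 : 0 < m by rewrite lt_min s0 d0.
have ms : m <= s by rewrite ge_min lexx.
have md : m <= d by rewrite ge_min lexx orbT.
apply: (@lt_le_trans _ _ (X m)); last by apply: X_mono => //; lra.
have -> : 0 = X 0 by rewrite !flux0 subrr.
apply: (@gt0_derive_lt _ X (fun s => s * w s * (g' s - g s)) _ _ m0).
- by move=> x /andP[x0 _]; apply: dX; lra.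
- move=> x /andP[x0 xm]; rewrite mulr_gt0//; last first.
    by apply: hd; rewrite /= sub0r normrN gtr0_norm//; lra.
  by rewrite mulr_gt0// wt_gt0.
- by move=> x /andP[x0 _]; apply: continuous_of_derive (dX _); lra.
Qed.

Let Z_decr r s : 0 < r -> r < s -> s <= 1 -> Z s < Z r.
Proof.
move=> r0 rs s1; rewrite -ltrN2.
have dd (x : R) : 0 < x -> is_derive x 1 (fun x => - Z x) (X x / (x * w x)).
  by move=> x0; have h := dZ x0; apply: is_derive_eq; rewrite opprK.
apply: (@gt0_derive_lt _ (fun x => - Z x) (fun x => X x / (x * w x)) _ _ rs).
- by move=> x /andP[x0 _]; apply: dd; lra.
- move=> x /andP[rx xs]; have x0 : 0 < x by lra.
  by rewrite divr_gt0//; [apply: X_gt0 => //; lra|rewrite mulr_gt0// wt_gt0].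
- by move=> x /andP[x0 _]; apply: continuous_of_derive (dd x _); lra.
Qed.

Let Z_gt0 s : 0 < s -> s < 1 -> 0 < Z s.
Proof. by move=> s0 s1; apply: le_lt_trans (Z_decr s0 s1 _) => //; apply: Zp_ge0; rewrite ler01 lexx. Qed.

Variable rho : R.
Hypothesis rho0 : 0 < rho.
Hypothesis rho1 : 2 * rho < 1.
Hypothesis alr : al * (2 * rho) ^+ 2 <= 1.
Hypothesis psr : 2^-1 <= ps rho.

Let rho_lt1 : rho < 1. Proof. by move: rho0 rho1; lra. Qed.

Let XZ : X rho <= 4 * Z rho.
Proof.
have r0 := rho0; have r1 := rho1; have rl := rho_lt1.
apply: (@flux_le_value _ al ph (ltW al0) cph ph01 Z X) => //.
- by move=> s /andP[s0 _]; exact: dZ.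
- by move=> s /andP[rs s1]; exact: (X_mono (ltW rho0) rs (ltW s1)).
- exact: (X_ge0 (ltW rho0) (ltW rho_lt1)).
- by apply: Zp_ge0; lra.
Qed.

(** On []0, rho]] both [W] and [Z] are at least their values at [rho], so [X' >= c r] with
    [c = lam fp (W rho) Z rho / 2]. Integration gives [c rho^2 / 2 <= X rho <= 4 Z rho], and [Z rho]
    cancels. *)
Lemma stable_bound : lam * fp (W rho) * rho ^+ 2 <= 16.
Proof.
have r0 := rho0; have r1 := rho1; have rl := rho_lt1.
have Z0 : 0 < Z rho by apply: Z_gt0 => //; lra.
have f0 : 0 <= fp (W rho) by apply: fp0; apply: ltW; apply: W_gt0; lra.
pose c := lam * 2^-1 * fp (W rho) * Z rho.
have c0 : 0 <= c.
  by rewrite /c !mulr_ge0 ?(ltW lam0) ?(ltW Z0)// invr_ge0.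
pose D (x : R) := X x - c * (x ^+ 2 / 2).
have h : D 0 <= D rho.
  have dd (x : R) : 0 <= x -> is_derive x 1 D
      (x * w x * (g' x - g x) - c * x).
    by move=> x0; have h1 := dX x0; apply: is_derive_eq; rewrite /GRing.scale /=; field.
  apply: (@ge0_derive_le _ D (fun x => x * w x * (g' x - g x) - c * x) 0 rho).
  - exact: ltW.
  - by move=> x /andP[x0 _]; apply: dd; lra.
  - move=> x /andP[x0 xr]; rewrite subr_ge0.
    have x1 : x < 1 by lra.
    have w1 : 1 <= w x by exact: (wt_ge1 (ltW al0) cph ph01 (ltW x0) (ltW x1)).
    have psx : 2^-1 <= ps x by apply: le_trans psr _; exact: (ps_noninc (ltW x0) (ltW xr) (ltW rl)).
    have fx : fp (W rho) <= fp (W x).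
      by apply: fp_mono; [exact: (ltW (W_gt0 (ltW r0) rl))|exact: (W_decr (ltW x0) (ltW xr) (ltW rl))].
    have zx : Z rho <= Z x by exact: (ltW (Z_decr x0 xr (ltW rl))).
    have G : c <= g' x - g x.
      apply: le_trans (gg_ge (ltW x0) x1); rewrite /c.
      apply: ler_pM => //; [|exact: ltW|].
        by rewrite !mulr_ge0 ?(ltW lam0)// invr_ge0.
      apply: ler_pM => //; first by rewrite mulr_ge0 ?(ltW lam0)// invr_ge0.
      by apply: ler_wpM2l => //; exact: ltW.
    have xw : x <= x * w x by rewrite ler_peMr// ltW.
    rewrite mulrC; apply: ler_pM => //; exact: ltW.
  - by move=> x /andP[x0 _]; apply: continuous_of_derive (dd x _); lra.
have X00 : flux al ph g' 0 - flux al ph g 0 = 0 by rewrite !flux0 subrr.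
have := XZ; move: h; rewrite /D /= X00 expr0n mul0r mulr0 subr0 subr_ge0 => h1 h2.
have h3 : c * (rho ^+ 2 / 2) <= 4 * Z rho by exact: le_trans h2.
have h4 : Z rho * (lam * fp (W rho) * rho ^+ 2) <= Z rho * 16.
  have -> : Z rho * (lam * fp (W rho) * rho ^+ 2) = 4 * (c * (rho ^+ 2 / 2)).
    by rewrite /c; field.
  by lra.
by move: h4; rewrite ler_pM2l.
Qed.

Let Q_mono r s : 0 <= r -> r <= s -> s <= 1 -> Q r <= Q s.
Proof. by apply: flux_nondecr => //. Qed.

Lemma flux_rho_bound : Q rho <= 4 * W rho.
Proof.
have r0 := rho0; have r1 := rho1; have rl := rho_lt1.
apply: (@flux_le_value _ al ph (ltW al0) cph ph01 W Q) => //.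
- by move=> s /andP[s0 _]; exact: dW.
- by move=> s /andP[rs s1]; exact: (Q_mono (ltW rho0) rs (ltW s1)).
- by rewrite -(flux0 al ph g); apply: Q_mono; lra.
- by apply: ltW; apply: W_gt0; lra.
Qed.

Hypothesis Lr : 32 * L * rho <= 1.

Let v s := Q s / (s * w s).

(** The source is nonincreasing and [w >= 1], hence [Q s >= g s * s^2 / 2]. *)
Let g_le_v s : 0 < s -> s <= rho -> g s * s <= 2 * w s * v s.
Proof.
move=> s0 sr; have rl := rho_lt1; have s1 : s <= 1 by lra.
have gs0 : 0 <= g s by apply: g_ge0; lra.
have h : Q 0 - g s * (0 ^+ 2 / 2) <= Q s - g s * (s ^+ 2 / 2).
  have dd (x : R) : 0 <= x -> is_derive x 1 (fun x => Q x - g s * (x ^+ 2 / 2))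
      (x * w x * g x - g s * x).
    by move=> x0; have h1 := dQ x0; apply: is_derive_eq; rewrite /GRing.scale /=; field.
  apply: (@ge0_derive_le _ (fun x => Q x - g s * (x ^+ 2 / 2)) (fun x => x * w x * g x - g s * x)).
  - exact: ltW.
  - by move=> x /andP[x0 _]; apply: dd; lra.
  - move=> x /andP[x0 xs]; rewrite subr_ge0 mulrC.
    have x1 : x < 1 by lra.
    have x01 : 0 <= x <= 1 by lra.
    have s01 : 0 <= s <= 1 by lra.
    have w1 : 1 <= w x by exact: (wt_ge1 (ltW al0) cph ph01 (ltW x0) (ltW x1)).
    apply: ler_pM; [exact: ltW|exact: gs0|by rewrite ler_peMr// ltW|].
    rewrite !gE//; have /andP[p0 _] := ps01 s01.
    apply: ler_pM; [by rewrite mulr_ge0// ltW|exact: ltW|..].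
      by apply: ler_wpM2l; [exact: ltW|exact: ps_noninc (ltW x0) (ltW xs) s1].
    by apply: F_nondecr; exact: W_decr (ltW x0) (ltW xs) s1.
  - by move=> x /andP[x0 _]; apply: continuous_of_derive (dd x _); lra.
move: h; rewrite flux0 expr0n mul0r mulr0 subrr subr_ge0 => h.
have w0 := wt_gt0 al ph s.
have -> : 2 * w s * v s = 2 * Q s / s by rewrite /v; field; rewrite !gt_eqF.
rewrite ler_pdivlMr// -mulrA -expr2; lra.
Qed.

Let v_gt0 s : 0 < s -> s <= rho -> 0 <= v s.
Proof.
move=> s0 sr; rewrite divr_ge0//; last by rewrite mulr_ge0// ltW// wt_gt0.
by rewrite -(flux0 al ph g); apply: Q_mono => //; [exact: ltW|exact: le_trans sr (ltW rho_lt1)].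
Qed.

Let dv s : 0 < s -> s <= rho -> is_derive s 1 v (g s - v s / s - al * s * ph s * v s).
Proof.
move=> s0 sr; have w0 := wt_gt0 al ph s.
have h1 := dQ (ltW s0).
have h2 : is_derive s 1 w (al * s * ph s * w s) by apply: is_derive_wt => //; lra.
have h3 : is_derive s 1 (fun s => s * w s) (w s + s * (al * s * ph s * w s)).
  by apply: is_derive_eq; rewrite /GRing.scale /=; ring.
have h4 := @is_deriveV R (fun s => s * w s) s _ 1 (lt0r_neq0 (mulr_gt0 s0 w0)) h3.
have h5 : is_derive s 1 (fun s => Q s * (s * w s)^-1) (g s - v s / s - al * s * ph s * v s).
  apply: is_derive_eq; rewrite /v /GRing.scale /=; field.
  by rewrite !gt_eqF.
exact: h5.
Qed.

(* [Energy' >= w v^2 / (2 s)] in the sense of lower Dini derivatives ([ph] and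
   [ps] are only Lipschitz, hence the frozen coefficients): this is the gain
   [1 / s^2] in the equation satisfied by [v = - W']. *)
Let Energy s := - (w s * v s ^+ 2) - al * s ^+ 2 * w s * ph s * v s ^+ 2
     + s * w s * g s * v s + v s ^+ 2 * X s * (Z s)^-1.

(** [Energy] gains only the square [w v^2 / (2 s)], while [W' = - v] is linear in [v]. The term
    [s^2 / (4 t)] completes the square, so that [Psi t] is nondecreasing for every [t > 0]. *)
Let Psi t s := W s + t * Energy s + s ^+ 2 / (4 * t).

(** A minorant of [Psi t] to the right of [s], with equality at [s], because [ph x <= ph s] and
    [ps x >= ps s - L (x - s)] for [x >= s]. *)
Let frozen t s x := W x + t * (- (w x * v x ^+ 2) - al * x ^+ 2 * w x * ph s * v x ^+ 2
     + x * w x * (lam * (ps s - L * (x - s)) * F (W x)) * v x + v x ^+ 2 * X x * (Z x)^-1)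
     + x ^+ 2 / (4 * t).

(** With [e = w v^2 / s], the drift and the Lipschitz error of [ps] cost at most [e / 4] each; the
    remaining [e / 2] pays for [W' = - v] by Young's inequality. *)
Let dfrozen t s : 0 < t -> 0 < s -> s <= rho -> exists2 d, 0 <= d & is_derive s 1 (frozen t s) d.
Proof.
move=> t0 s0 sr; have rl := rho_lt1; have s1 : s < 1 by lra.
have s01 : 0 <= s <= 1 by lra.
have w0 := wt_gt0 al ph s; have Z0 := Z_gt0 s0 s1.
have Ws0 := W_gt0 (ltW s0) s1.
have dw : is_derive s 1 w (al * s * ph s * w s) by apply: is_derive_wt => //; lra.
have dFW : is_derive s 1 (fun x => F (W x)) (- (fp (W s) * v s)).
  apply: is_derive_eq (@is_derive1_comp _ F W s _ _ (dF Ws0) (dW s0)) _.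
  by rewrite mulrN.
have dvs := dv s0 sr; rewrite gE// in dvs.
have H := @is_derive_energy _ al lam L t s (ph s) (ps s) w v (fun x => F (W x)) X Z W
  (fp (W s)) (g' s - g s) s0 t0 w0 Z0 dw dvs dFW (dX (ltW s0)) (dZ s0) (dW s0).
set d := (X in is_derive _ _ _ X) in H.
exists d => //.
have v0 := v_gt0 s0 sr.
have w1 : 1 <= w s by exact: (wt_ge1 (ltW al0) cph ph01 (ltW s0) (ltW s1)).
have als : al * s ^+ 2 <= 4^-1.
  have := alr; rewrite exprMn mulrCA => h.
  have : al * s ^+ 2 <= al * rho ^+ 2.
    by apply: ler_wpM2l; [exact: ltW|rewrite lerXn2r ?nnegrE//; lra].
  lra.
have w2 : w s <= 2.
  by apply: (wt_le2 (ltW al0) cph ph01 (ltW s0) (ltW s1)); lra.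
have /andP[ph0s ph1s] := ph01 s01.
have ps2 : 2^-1 <= ps s.
  by apply: le_trans psr _; exact: ps_noninc (ltW s0) sr (ltW rl).
have gv := g_le_v s0 sr; rewrite gE// in gv.
have gz := gg_ge (ltW s0) s1.
have F0s := F0 (W s).
have L0' := L0; have lam0' := lam0; have al0' := al0.
have Lr' : 32 * L * s <= 1.
  apply: le_trans Lr; rewrite -!mulrA; apply: ler_wpM2l => //; exact: ler_wpM2l.
rewrite /d.
move: (fp (W s)) (F (W s)) (v s) (w s) (ph s) (ps s) (g' s - g s) (X s) (Z s) Z0 F0s gv gz w0 w1 w2 v0 ph0s ph1s ps2.
move=> f1 Fw vs ws a p gd Xs Zs Z0 F0s gv gz w0 w1 w2 v0 a0 a1 p2.
(* The square of Picone's identity, [s w (v' - v Z'/Z)^2] with [v'] eliminated. *)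
have B1 : 0 <= s * ws * (lam * p * Fw - vs / s - al * s * a * vs + vs * Xs / (s * ws * Zs)) ^+ 2.
  by rewrite mulr_ge0 ?sqr_ge0// mulr_ge0// ltW.
(* The supersolution property of [Z] absorbs the linearized reaction term. *)
have B2 : lam * p * s * ws * f1 * vs ^+ 2 <= vs ^+ 2 * s * ws * gd / Zs.
  rewrite ler_pdivlMr//.
  have -> : lam * p * s * ws * f1 * vs ^+ 2 * Zs = (vs ^+ 2 * s * ws) * (lam * p * f1 * Zs) by ring.
  by apply: ler_wpM2l => //; rewrite !mulr_ge0 ?sqr_ge0// ltW.
pose e := ws * vs ^+ 2 / s.
have e0 : 0 <= e by rewrite divr_ge0 ?mulr_ge0 ?sqr_ge0// ltW.
have B3 : al * a * s * ws * vs ^+ 2 <= 4^-1 * e.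
  have -> : al * a * s * ws * vs ^+ 2 = (al * s ^+ 2 * a) * e by rewrite /e; field; rewrite gt_eqF.
  apply: ler_wpM2r => //.
  apply: le_trans als; rewrite ler_piMr// mulr_ge0 ?sqr_ge0//; exact: ltW.
have B4 : lam * L * s * ws * Fw * vs <= 4^-1 * e.
  (* This is [g_le_v], with [ps s >= 1/2] and [w s <= 2]. *)
  have h1 : lam * Fw * s <= 8 * vs.
    have h0 : lam * Fw * s <= 2 * (lam * p * Fw * s).
      have -> : 2 * (lam * p * Fw * s) = (2 * p) * (lam * Fw * s) by ring.
      by rewrite ler_peMl ?mulr_ge0 ?(ltW F0s) ?(ltW lam0') ?(ltW s0)//; lra.
    have h3 : ws * vs <= 2 * vs by apply: ler_wpM2r.
    lra.
  have -> : lam * L * s * ws * Fw * vs = (L * ws * vs) * (lam * Fw * s) by ring.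
  apply: (@le_trans _ _ (L * ws * vs * (8 * vs))).
    by apply: ler_wpM2l => //; rewrite !mulr_ge0// ltW.
  have -> : L * ws * vs * (8 * vs) = (8 * L * s) * e by rewrite /e; field; rewrite gt_eqF.
  by apply: ler_wpM2r => //; lra.
have B5 : vs <= t * (2^-1 * e) + s / (2 * t).
  apply: (@le_trans _ _ (t * (2^-1 * (vs ^+ 2 / s)) + s / (2 * t))); last first.
    rewrite lerD2r; apply: ler_wpM2l; first exact: ltW.
    apply: ler_wpM2l => //; rewrite /e -mulrA ler_peMl//.
    by rewrite divr_ge0 ?sqr_ge0// ltW.
  rewrite -subr_ge0.
  have -> : t * (2^-1 * (vs ^+ 2 / s)) + s / (2 * t) - vs = (t * vs - s) ^+ 2 / (2 * t * s).
    by field; rewrite !gt_eqF.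
  by rewrite divr_ge0 ?sqr_ge0// !mulr_ge0// ltW.
rewrite -/e.
have B6 : t * (2^-1 * e) <= t * (s * ws * (lam * p * Fw - vs / s - al * s * a * vs + vs * Xs / (s * ws * Zs)) ^+ 2
     + e - al * a * s * ws * vs ^+ 2 - lam * p * s * ws * f1 * vs ^+ 2
     - lam * L * s * ws * Fw * vs + vs ^+ 2 * s * ws * gd / Zs).
  by apply: ler_wpM2l; [exact: ltW|lra].
lra.
Qed.

Let cPsi t s : 0 < s -> s <= rho -> {for s, continuous (Psi t)}.
Proof.
move=> s0 sr; have s1 : s < 1 by exact: le_lt_trans sr rho_lt1.
have cv : {for s, continuous v} by apply: continuous_of_derive (dv s0 sr).
have cw : {for s, continuous w} by exact: continuous_wt.
have cid : {for s, continuous (@id R)} by exact: cvg_id.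
have cv2 : {for s, continuous (fun x => v x ^+ 2)} by apply: cvgM.
have cid2 : {for s, continuous (fun x : R => x ^+ 2)} by exact: exprn_continuous.
apply: cvgD; first apply: cvgD.
- exact: continuous_rsol.
- apply: cvgMr; apply: cvgD; first apply: cvgD; first apply: cvgB.
  + by apply: cvgN; apply: cvgM.
  + apply: cvgM; last exact: cv2.
    apply: cvgM; last exact: cph.
    by apply: cvgM; [apply: cvgMr|exact: cw].
  + apply: cvgM; last exact: cv.
    apply: cvgM; last exact: cg.
    by apply: cvgM.
  + apply: cvgM; first apply: cvgM; first exact: cv2.
      apply: continuous_of_derive (dX (ltW s0)).
    apply: cvgV; first by rewrite gt_eqF// Z_gt0.
    exact: continuous_of_derive (dZ s0).
- by apply: cvgMl.
Qed.

Let frozen_le t s x : 0 < t -> 0 < s -> s <= x -> x <= rho -> frozen t s x <= Psi t x.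
Proof.
move=> t0 s0 sx xr; have rl := rho_lt1.
have x0 : 0 < x by exact: lt_le_trans sx.
have x1 : x <= 1 by exact: le_trans xr (ltW rl).
have w0 := wt_gt0 al ph x; have v0 := v_gt0 x0 xr.
rewrite /frozen /Psi /Energy lerD2r lerD2l ler_pM2l// lerD2r.
apply: lerD.
  apply: lerB => //; apply: ler_wpM2r; first exact: sqr_ge0.
  apply: ler_wpM2l; first by rewrite mulr_ge0 ?(ltW w0)// mulr_ge0 ?sqr_ge0// ltW.
  exact: ph_noninc (ltW s0) sx x1.
apply: ler_wpM2r => //; apply: ler_wpM2l; first by rewrite mulr_ge0// ltW.
rewrite gE ?x1 ?(ltW x0)//; apply: ler_wpM2r; first exact: ltW (F0 _).
apply: ler_wpM2l; first exact: ltW.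
exact: ps_lip (ltW s0) sx x1.
Qed.

Let Psi_mono t a : 0 < t -> 0 < a -> a <= rho -> Psi t a <= Psi t rho.
Proof.
move=> t0 a0 ar; apply: (dini_nondecreasing ar).
  by move=> x /andP[ax xr]; apply: cPsi => //; exact: lt_le_trans ax.
move=> s /andP[as_ sr].
have s0 : 0 < s by exact: lt_le_trans as_.
have [d d0 dd] := dfrozen t0 s0 (ltW sr).
exists (frozen t s), d; split => //.
  by rewrite /frozen /Psi /Energy subrr mulr0 subr0 gE// (ltW s0)/= (le_trans (ltW sr) (ltW rho_lt1)).
by move=> x /andP[sx xr]; exact: frozen_le.
Qed.

Lemma stable_sup_bound : W 0 <= 194 * W rho.
Proof.
have r0 := rho0; have rl := rho_lt1.
have Wr : 0 < W rho by exact: W_gt0 (ltW r0) rl.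
(* Both terms at [rho] become multiples of [W rho]. As [v rho <= 4 W rho / rho] and
   [Energy rho <= (8 + 4) v^2], from the reaction term and from [X <= 4 Z], one gets
   [t * Energy rho <= 192 W rho]; moreover [rho^2 / (4 t) = W rho / 4], and
   [1 + 192 + 1/4 <= 194]. *)
pose t := rho ^+ 2 / W rho.
have t0 : 0 < t by rewrite divr_gt0// exprn_gt0.
have w1 : 1 <= w rho by exact: (wt_ge1 (ltW al0) cph ph01 (ltW r0) (ltW rl)).
have alr' : al * rho ^+ 2 <= 1.
  have := alr; have : 0 <= al * rho ^+ 2 by rewrite mulr_ge0 ?sqr_ge0// ltW.
  by rewrite exprMn; lra.
have w2 : w rho <= 2 by exact: (wt_le2 (ltW al0) cph ph01 (ltW r0) (ltW rl) alr').
have v0 := v_gt0 r0 (lexx rho).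
have vW : v rho <= 4 * W rho / rho.
  rewrite ler_pdivlMr// /v.
  have Q0 : 0 <= Q rho by rewrite -(flux0 al ph g); exact: Q_mono (lexx 0) (ltW r0) (ltW rl).
  apply: le_trans flux_rho_bound.
  have -> : Q rho / (rho * w rho) * rho = Q rho / w rho by field; rewrite !gt_eqF// wt_gt0.
  by rewrite ler_pdivrMr ?wt_gt0// ler_peMr.
have Zr : 0 < Z rho by exact: Z_gt0.
have EnB : Energy rho <= 12 * v rho ^+ 2.
  rewrite /Energy.
  have rr : 0 <= rho <= 1 by rewrite (ltW r0) (ltW rl).
  have a1 : 0 <= w rho * v rho ^+ 2 by rewrite mulr_ge0 ?sqr_ge0// ltW// wt_gt0.
  have a2 : 0 <= al * rho ^+ 2 * w rho * ph rho * v rho ^+ 2.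
    rewrite mulr_ge0 ?sqr_ge0// mulr_ge0//; last by case/andP: (ph01 rr).
    by rewrite mulr_ge0 ?(ltW (wt_gt0 _ _ _))// mulr_ge0 ?sqr_ge0// ltW.
  have a3 : rho * w rho * g rho * v rho <= 8 * v rho ^+ 2.
    have h := g_le_v r0 (lexx rho).
    have -> : rho * w rho * g rho * v rho = (w rho * v rho) * (g rho * rho) by ring.
    apply: (@le_trans _ _ (w rho * v rho * (2 * w rho * v rho))).
      by apply: ler_wpM2l => //; rewrite mulr_ge0// ltW// wt_gt0.
    have -> : w rho * v rho * (2 * w rho * v rho) = (2 * (w rho * w rho)) * v rho ^+ 2 by ring.
    apply: ler_wpM2r; first exact: sqr_ge0.
    nra.
  have a4 : v rho ^+ 2 * X rho * (Z rho)^-1 <= 4 * v rho ^+ 2.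
    rewrite ler_pdivrMr//.
    have -> : 4 * v rho ^+ 2 * Z rho = v rho ^+ 2 * (4 * Z rho) by ring.
    by apply: ler_wpM2l; [exact: sqr_ge0|exact: XZ].
  by move: a1 a2 a3 a4; lra.
have PB : Psi t rho <= 194 * W rho.
  rewrite /Psi.
  have b1 : t * Energy rho <= 192 * W rho.
    apply: (@le_trans _ _ (t * (12 * (4 * W rho / rho) ^+ 2))).
      apply: ler_wpM2l; first exact: ltW.
      apply: le_trans EnB _; apply: ler_wpM2l => //.
      by rewrite lerXn2r ?nnegrE// (le_trans v0).
    by rewrite le_eqVlt /t; apply/orP; left; apply/eqP; field; rewrite !gt_eqF.
  have b2 : rho ^+ 2 / (4 * t) = W rho / 4 by rewrite /t; field; rewrite !gt_eqF.
  rewrite b2; lra.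
(* [Psi t] contains quotients by [s] and by [Z], awkward at 0. Dropping its nonnegative terms and
   writing [v] through [slope] leaves a function continuous at 0, with value [W 0]. *)
pose K (s : R) := W s - t * (w s * (1 + al * s ^+ 2 * ph s) * (s * slope al ph g s) ^+ 2).
have KP a : 0 < a -> a <= rho -> K a <= 194 * W rho.
  move=> a0 ar; apply: le_trans PB; apply: le_trans (Psi_mono t0 a0 ar).
  rewrite /K /Psi /Energy.
  have a1 : a <= 1 by exact: le_trans ar (ltW rl).
  have va : v a = - (a * slope al ph g a).
    rewrite /v slopeE//; field; rewrite !gt_eqF// wt_gt0//.
  have -> : (a * slope al ph g a) ^+ 2 = v a ^+ 2 by rewrite va sqrrN.
  have q0 : 0 <= a ^+ 2 / (4 * t) by rewrite divr_ge0 ?sqr_ge0// mulr_ge0// ltW.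
  have q1 : 0 <= a * w a * g a * v a.
    rewrite mulr_ge0 ?v_gt0// mulr_ge0//; last by apply: g_ge0; rewrite (ltW a0).
    by rewrite mulr_ge0// ltW// wt_gt0.
  have q2 : 0 <= v a ^+ 2 * X a / Z a.
    rewrite divr_ge0//; last by apply: Zp_ge0; rewrite (ltW a0).
    by rewrite mulr_ge0 ?sqr_ge0// X_ge0// ltW.
  have q3 : - (w a * (1 + al * a ^+ 2 * ph a) * v a ^+ 2) <=
    - (w a * v a ^+ 2) - al * a ^+ 2 * w a * ph a * v a ^+ 2 +
     a * w a * g a * v a + v a ^+ 2 * X a / Z a.
    have -> : w a * (1 + al * a ^+ 2 * ph a) * v a ^+ 2 = w a * v a ^+ 2 + al * a ^+ 2 * w a * ph a * v a ^+ 2 by ring.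
    by move: q1 q2; lra.
  have q4 := ler_wpM2l (ltW t0) q3.
  by move: q0 q4; rewrite mulrN; lra.
have cK : {for (0 : R), continuous K}.
  apply: cvgB; first exact: continuous_rsol.
  apply: cvgMr; apply: cvgM.
    apply: cvgM; first exact: continuous_wt.
    apply: cvgD; first exact: cvg_cst.
    apply: cvgM; last exact: cph.
    by apply: cvgMr; exact: exprn_continuous.
  have c1 : {for (0 : R), continuous (fun s : R => s * slope al ph g s)}.
    by apply: cvgM; [exact: cvg_id|exact: continuous_slope].
  exact: (cvgM c1 c1).
have -> : W 0 = K 0 by rewrite /K mul0r expr0n mulr0 mulr0 subr0.
rewrite leNgt; apply/negP => h.
have [d /= d0 hd] : \forall s \near (0 : R), 194 * W rho < K s.
  by move: cK => /cvgr_gt; apply.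
pose m := Num.min rho (d / 2).
have m0 : 0 < m by rewrite lt_min r0 divr_gt0.
have mr : m <= rho by rewrite ge_min lexx.
have md : m <= d / 2 by rewrite ge_min lexx orbT.
have := KP m m0 mr; rewrite leNgt => /negP; apply; apply: hd.
by rewrite /= sub0r normrN gtr0_norm//; lra.
Qed.

End Core.

(** * Integral bounds and the lower bound for the extremal value *)

Section IntegralMonotone.
Import HBNNSimple.

(* No measurability is needed: the integral of a nonnegative function is the
   supremum of the integrals of the simple functions below it. *)
Lemma ge0_le_integral_subset d (T : measurableType d) (R : realType)
    (mu : {measure set T -> \bar R}) (D1 D2 : set T) (f1 f2 : T -> \bar R) :
  (forall x, D1 x -> (0 <= f1 x)%E) -> (forall x, D2 x -> (0 <= f2 x)%E) ->
  D1 `<=` D2 -> (forall x, D1 x -> (f1 x <= f2 x)%E) ->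
  (\int[mu]_(x in D1) f1 x <= \int[mu]_(x in D2) f2 x)%E.
Proof.
move=> f10 f20 D12 f12; rewrite (integral_mkcond D1) (integral_mkcond D2).
have h10 x : (0 <= (f1 \_ D1) x)%E by apply: erestrict_ge0.
have h20 x : (0 <= (f2 \_ D2) x)%E by apply: erestrict_ge0.
rewrite !ge0_integralTE//; apply: le_ereal_sup => _ [h hf <-].
exists h => // x; apply: le_trans (hf x) _.
rewrite /patch; case: ifPn => [/set_mem D1x|_].
  by rewrite mem_set ?f12//; exact: D12.
by have := h20 x; rewrite /patch.
Qed.

End IntegralMonotone.

Section IntegralBounds.
Variable R : realType.

Lemma prim_le_integral (D : set R) (h k : R -> R) (a b : R) :
  continuous k -> 0 <= a -> a < b -> `[a, b]%classic `<=` D ->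
  (forall x, a <= x <= b -> 0 <= k x) ->
  (forall x, D x -> 0 <= h x) -> (forall x, a <= x <= b -> k x <= h x) ->
  ((\int[lebesgue_measure]_(x in D) (h x)%:E < +oo)%E) ->
  prim k b - prim k a <= fine (\int[lebesgue_measure]_(x in D) (h x)%:E)%E.
Proof.
move=> ck a0 ab abD k0 h0 kh hfin.
have itvP x : `[a, b]%classic x -> a <= x <= b by rewrite /= in_itv.
have I0 : (0 <= \int[lebesgue_measure]_(x in D) (h x)%:E)%E.
  by apply: integral_ge0 => x Dx; rewrite lee_fin; exact: h0.
rewrite -lee_fin fineK; last by rewrite ge0_fin_numE.
rewrite -integral_prim//; apply: ge0_le_integral_subset => //.
Qed.

End IntegralBounds.

Section Supersolution.
Variables (R : realType) (al lam e s0 U0 N : R) (ph ps F fp : R -> R).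
Hypothesis al0 : 0 < al.
Hypothesis lam0 : 0 < lam.
Hypothesis e0 : 0 < e.
Hypothesis e1 : e <= 1.
Hypothesis s00 : 0 < s0.
Hypothesis s01 : s0 < 1.
Hypothesis U00 : 0 < U0.
Hypothesis N0 : 0 <= N.
Hypothesis cph : continuous ph.
Hypothesis ph0 : forall s, 0 <= s <= 1 -> 0 <= ph s.
Hypothesis cps : continuous ps.
Hypothesis ps01 : forall s, 0 <= s <= 1 -> 0 <= ps s <= 1.
Hypothesis ps0 : ps 0 = 1.
Hypothesis cF : continuous F.
Hypothesis F0 : forall u, 0 < F u.
Hypothesis F_nondecr : forall u v, u <= v -> F u <= F v.
Hypothesis dF : forall u : R, 0 < u -> is_derive u 1 F (fp u).

Notation w := (wt al ph).
Notation P := (rsol al ph ps).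
Notation Q := (flux al ph ps).
Notation Fi := (prim (fun u => (F u)^-1)).
Notation k := (fun s => Q s / (s * w s)).
Notation c := ((1 + e) * lam).

Hypothesis cP0 : c * P 0 < Fi U0.
Hypothesis hN : forall u, 0 < u -> u < U0 -> fp u <= N.
Hypothesis hk : forall s, 0 < s -> s <= s0 -> N * c * k s ^+ 2 <= e / 4 * ps s.
Hypothesis hP : expR (N * (c * P s0)) <= 1 + e / 2.

Let cFi : continuous (fun u => (F u)^-1).
Proof. by move=> u; apply: cvgV; [rewrite gt_eqF|exact: cF]. Qed.

Let dFi (u : R) : 0 <= u -> is_derive u 1 Fi (F u)^-1.
Proof. by move=> u0; apply: is_derive_prim => //; lra. Qed.

(** [Fi] has slope at least [1 / F U0] up to [U0], so its inverse is Lipschitz with constant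
    [F U0]. *)
Let Fi_gap u v : 0 <= u -> u <= v -> v <= U0 -> (v - u) / F U0 <= Fi v - Fi u.
Proof.
move=> u0 uv vU.
suff : Fi u - u / F U0 <= Fi v - v / F U0 by rewrite mulrBl; lra.
have dd (x : R) : 0 <= x -> is_derive x 1 (fun x => Fi x - x / F U0) ((F x)^-1 - (F U0)^-1).
  by move=> x0; have h := dFi x0; apply: is_derive_eq; rewrite /GRing.scale /=; ring.
apply: (@ge0_derive_le _ (fun x => Fi x - x / F U0) (fun x => (F x)^-1 - (F U0)^-1) _ _ uv).
- by move=> x /andP[x0 _]; apply: dd; lra.
- move=> x /andP[ux xv]; rewrite subr_ge0 lef_pV2 ?posrE//.
  by apply: F_nondecr; lra.
- by move=> x /andP[x0 _]; apply: continuous_of_derive (dd x _); lra.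
Qed.

Let Fi_lt u v : 0 <= u -> u < v -> v <= U0 -> Fi u < Fi v.
Proof.
move=> u0 uv vU; rewrite -subr_gt0; apply: lt_le_trans (Fi_gap u0 (ltW uv) vU).
by rewrite divr_gt0// subr_gt0.
Qed.

Let ex_inv : exists G : R -> R, forall y, 0 <= y <= Fi U0 -> 0 <= G y <= U0 /\ Fi (G y) = y.
Proof.
suff : forall y, exists u, 0 <= y <= Fi U0 -> 0 <= u <= U0 /\ Fi u = y.
  by move=> /choice[G hG]; exists G.
move=> y; have [hy|hy] := boolP (0 <= y <= Fi U0); last by exists 0.
have cc : {within `[0, U0], continuous Fi}.
  by apply: continuous_subspaceT; exact: continuous_prim.
have F00 : Fi 0 = 0 by exact: prim0.
have [|u hu uy] := IVT (ltW U00) cc (v := y).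
  have /andP[y0 yU] := hy.
  have h : 0 <= Fi U0 by exact: le_trans yU.
  by rewrite F00 (min_idPl h) (max_idPr h).
by exists u => _; split; [move: hu; rewrite in_itv|].
Qed.

Let P_decr r s : 0 <= r -> r < s -> s <= 1 -> P s < P r.
Proof.
move=> r0 rs s1; apply: (@rsol_decr _ al ph ps) => //.
  by move=> t /ps01/andP[].
by rewrite ps0.
Qed.

Let P1 : P 1 = 0. Proof. exact: rsol1. Qed.

Let c0 : 0 < c. Proof. by rewrite mulr_gt0// addr_gt0. Qed.

Let Q_ge0 s : 0 <= s -> s <= 1 -> 0 <= Q s.
Proof.
move=> s0' s1; rewrite -(flux0 al ph ps); apply: flux_nondecr => //.
by move=> t /ps01/andP[].
Qed.

Let cP_itv s : 0 <= s <= 1 -> 0 <= c * P s <= Fi U0.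
Proof.
have c0' := c0; have h := cP0.
move=> /andP[s0' s1]; apply/andP; split.
  rewrite mulr_ge0 ?(ltW c0')// -P1; move: s1; rewrite le_eqVlt => /orP[/eqP->//|s1].
  by apply: ltW; exact: P_decr.
apply: le_trans (ltW h); apply: ler_wpM2l; first exact: ltW.
move: s0'; rewrite le_eqVlt => /orP[/eqP<-//|s0'].
by apply: ltW; exact: P_decr.
Qed.

(* The supersolution is [r |-> Fi^-1 (c * P r)]. *)
Lemma supersolution_bound n : Viter al ph ps F lam n 0 <= U0.
Proof.
have [G hG] := ex_inv.
have c0' := c0; have e0' := e0; have e1' := e1; have s00' := s00; have s01' := s01.
have lam0' := lam0.
have GFi u : 0 <= u <= U0 -> G (Fi u) = u.
  move=> /andP[u0 uU].
  have hF : 0 <= Fi u <= Fi U0.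
    apply/andP; split.
      rewrite -(prim0 (fun u => (F u)^-1)); move: u0; rewrite le_eqVlt => /orP[/eqP<-//|u0].
      by apply: ltW; exact: Fi_lt.
    move: uU; rewrite le_eqVlt => /orP[/eqP->//|uU].
    by apply: ltW; exact: Fi_lt.
  have [/andP[g0 gU] gE] := hG _ hF.
  have [h|h|//] := ltgtP (G (Fi u)) u.
    by have := Fi_lt g0 h uU; rewrite gE ltxx.
  by have := Fi_lt u0 h gU; rewrite gE ltxx.
have Glip y1 y2 : 0 <= y1 -> y1 <= y2 -> y2 <= Fi U0 -> `|G y2 - G y1| <= F U0 * (y2 - y1).
  move=> y10 y12 y2U.
  have [] := hG y1; first by rewrite y10 (le_trans y12).
  move=> /andP[a0 aU] aE.
  have [] := hG y2; first by rewrite y2U (le_trans y10).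
  move=> /andP[b0 bU] bE.
  have ab : G y1 <= G y2.
    rewrite leNgt; apply/negP => h; have := Fi_lt b0 h aU.
    by rewrite aE bE ltNge y12.
  rewrite ger0_norm ?subr_ge0//.
  have := Fi_gap a0 ab bU; rewrite aE bE ler_pdivrMr//; lra.
have dG (u : R) : 0 < u -> u < U0 -> is_derive (Fi u) 1 G (F u).
  move=> u0 uU; rewrite -[F u]invrK; apply: is_derive_inverse.
  - near=> x; apply: GFi; apply/andP; split; apply: ltW; near: x.
      exact: lt_nbhsr.
    exact: lt_nbhsl.
  - by near=> x; exact: continuous_prim.
  - by apply: dFi; exact: ltW.
  - by rewrite gt_eqF// invr_gt0.
pose U s := G (c * P (clamp s)).
have cU : continuous U.
  have cY : continuous (fun s => c * P (clamp s)).
    move=> s; apply: cvgMr; apply: (@continuous_comp _ _ _ (@clamp R) P).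
      exact: continuous_clamp.
    exact: continuous_rsol.
  move=> s; apply/cvgrPdist_le => d d0.
  have /cvgrPdist_le/(_ _ (divr_gt0 d0 (F0 U0))) : {for s, continuous (fun s => c * P (clamp s))}.
    exact: cY.
  apply: filterS => x; rewrite ler_pdivlMr//.
  have /andP[a0 a1] := cP_itv (clamp_itv s).
  have /andP[b0 b1] := cP_itv (clamp_itv x).
  rewrite /U; move: (c * P (clamp s)) (c * P (clamp x)) a0 a1 b0 b1 => a b a0 a1 b0 b1.
  have [ab|ba] := leP a b.
    rewrite (distrC a) (ger0_norm (_ : 0 <= b - a)) ?subr_ge0// => h.
    by rewrite distrC; apply: le_trans (Glip _ _ a0 ab b1) _; rewrite mulrC.
  rewrite (ger0_norm (_ : 0 <= a - b)) ?subr_ge0 ?(ltW ba)// => h.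
  by apply: le_trans (Glip _ _ b0 (ltW ba) a1) _; rewrite mulrC.
have UE s : 0 <= s <= 1 -> U s = G (c * P s) by move=> hs; rewrite /U clamp_id.
have U_in s : 0 < s -> s < 1 -> 0 < U s /\ U s < U0.
  move=> s0' s1; have hs : 0 <= s <= 1 by lra.
  rewrite UE//; have [/andP[g0 gU] gE] := hG _ (cP_itv hs).
  split.
    rewrite lt_neqAle g0 andbT; apply/eqP => h.
    have : Fi (G (c * P s)) = 0 by rewrite -h; exact: prim0.
    rewrite gE => /eqP; rewrite mulf_eq0 gt_eqF//= gt_eqF//.
    by rewrite -P1; apply: P_decr => //; lra.
  rewrite lt_neqAle gU andbT; apply/eqP => h.
  have := cP0; rewrite -h gE ltr_pM2l// ltNge => /negP; apply; apply: ltW.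
  by apply: P_decr => //; lra.
have dU (s : R) : 0 < s -> s < 1 -> is_derive s 1 U (- (F (U s) * c * k s)).
  move=> s0' s1; have hs : 0 <= s <= 1 by lra.
  have [u0 uU] := U_in s s0' s1.
  have [_ gE] := hG _ (cP_itv hs).
  have h1 : is_derive s 1 P (s * slope al ph ps s) by apply: is_derive_rsol => //; lra.
  have h2 : is_derive s 1 (fun s => c * P s) (c * (s * slope al ph ps s)).
    by apply: is_derive_eq; rewrite /GRing.scale /=; ring.
  have h3 : is_derive (c * P s) 1 G (F (U s)).
    rewrite -gE UE//; apply: dG; rewrite -UE//.
  have h4 := @is_derive1_comp _ G (fun s => c * P s) s _ _ h3 h2.
  have w0 := wt_gt0 al ph s.
  have h5 : is_derive s 1 (G \o (fun s => c * P s)) (- (F (U s) * c * k s)).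
    apply: is_derive_eq h4 _; rewrite slopeE//; field.
    by rewrite !gt_eqF.
  apply: near_eq_is_derive h5; near=> x; rewrite UE//; apply/andP; split; apply: ltW; near: x.
    exact: lt_nbhsr.
  exact: lt_nbhsl.
pose src := source ps F lam U.
have csrc : continuous src by exact: continuous_source.
have srcE s : 0 <= s <= 1 -> src s = lam * ps s * F (U s).
  by move=> hs; rewrite /src /source clamp_id.
pose I := flux al ph src.
have dI (s : R) : 0 <= s -> is_derive s 1 I (s * w s * src s).
  by move=> s0'; apply: is_derive_flux => //; lra.
have dQ (s : R) : 0 <= s -> is_derive s 1 Q (s * w s * ps s).
  by move=> s0'; apply: is_derive_flux => //; lra.
have dFU (s : R) : 0 < s -> s < 1 -> is_derive s 1 (fun x => F (U x)) (fp (U s) * - (F (U s) * c * k s)).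
  move=> s0' s1; have [u0 uU] := U_in s s0' s1.
  exact: (@is_derive1_comp _ F U s _ _ (dF u0) (dU s s0' s1)).
have cFU : continuous (fun x => F (U x)).
  by move=> x; apply: (@continuous_comp _ _ _ U F); [exact: cU|exact: cF].
have cQ : continuous Q by exact: continuous_flux.
have cI : continuous I by exact: continuous_flux.
(* Near the origin [F (U s)] varies slowly: by [hk] the loss [fp (U s) * c * k^2] stays below the
   fraction [e / 4] of [ps]. *)
have stepA s : 0 <= s -> s <= s0 -> (1 - e / 4) * I s <= lam * F (U s) * Q s.
  move=> s0' ss0.
  pose D x := lam * F (U x) * Q x - (1 - e / 4) * I x.
  suff : D 0 <= D s by rewrite /D /I !flux0 !mulr0 subrr subr_ge0.
  apply: (@ge0_derive_le _ D (fun x => lam * (fp (U x) * - (F (U x) * c * k x)) * Q x +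
     lam * F (U x) * (x * w x * ps x) - (1 - e / 4) * (x * w x * src x)) _ _ s0').
  - move=> x /andP[x0 xs]; have x1 : x < 1 by lra.
    have h1 := dFU x x0 x1; have h2 := dQ x (ltW x0); have h3 := dI x (ltW x0).
    by apply: is_derive_eq; rewrite /GRing.scale /=; ring.
  - move=> x /andP[x0 xs]; have x1 : x < 1 by lra.
    have w0 := wt_gt0 al ph x.
    rewrite srcE; last by lra.
    have -> : lam * (fp (U x) * - (F (U x) * c * k x)) * Q x +
     lam * F (U x) * (x * w x * ps x) - (1 - e / 4) * (x * w x * (lam * ps x * F (U x))) =
     lam * F (U x) * (x * w x) * (e / 4 * ps x - fp (U x) * c * k x ^+ 2).
      by field; rewrite !gt_eqF.
    apply: mulr_ge0; first by rewrite !mulr_ge0// ltW.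
    have [u0 uU] := U_in x x0 x1.
    rewrite subr_ge0; apply: le_trans (hk x0 (ltW (lt_le_trans xs ss0))).
    apply: ler_wpM2r; first exact: sqr_ge0.
    apply: ler_wpM2r; first exact: ltW.
    exact: hN.
  - move=> x _; apply: cvgB; last by apply: cvgMr; exact: cI.
    apply: cvgM; last exact: cQ.
    by apply: cvgMr; exact: cFU.
(* Past [s0] the source [ps] may vanish and cannot absorb the loss. [E] is an integrating factor
   that compensates the logarithmic derivative [- fp (U s) * c * k] of [F (U s)]; [hP] keeps it
   below [1 + e / 2]. *)
pose E s := expR (N * (c * (P s0 - P s))).
have E1 s : s0 <= s -> s <= 1 -> 1 <= E s.
  move=> ss s1; rewrite -expR0 ler_expR mulr_ge0// mulr_ge0 ?(ltW c0')// subr_ge0.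
  move: ss; rewrite le_eqVlt => /orP[/eqP<-//|ss].
  by apply: ltW; apply: P_decr => //; exact: ltW.
have stepB s : s0 <= s -> s < 1 -> (1 - e / 4) * I s <= E s * (lam * F (U s) * Q s).
  move=> ss0 s1.
  pose D x := E x * (lam * F (U x) * Q x) - (1 - e / 4) * I x.
  have D0 : 0 <= D s0.
    rewrite /D subr_ge0; apply: le_trans (stepA s0 (ltW s00) (lexx _)) _.
    by rewrite /E subrr !mulr0 expR0 mul1r.
  have dE (x : R) : 0 < x -> is_derive x 1 E (N * (c * k x) * E x).
    move=> x0; have w0 := wt_gt0 al ph x.
    have h1 : is_derive x 1 P (x * slope al ph ps x) by apply: is_derive_rsol => //; lra.
    have h2 : is_derive x 1 (fun x => N * (c * (P s0 - P x))) (N * (c * k x)).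
      apply: is_derive_eq; rewrite slopeE// /GRing.scale /=; field.
      by rewrite !gt_eqF.
    have h3 := @is_derive1_comp _ expR _ _ _ _ (is_derive_expR _) h2.
    by apply: is_derive_eq h3 _; rewrite mulrC.
  suff : D s0 <= D s by move=> /(le_trans D0); rewrite subr_ge0.
  have dD (x : R) : 0 < x -> x < 1 -> is_derive x 1 D
     (N * (c * k x) * E x * (lam * F (U x) * Q x) + E x * (lam * (fp (U x) * - (F (U x) * c * k x)) * Q x +
     lam * F (U x) * (x * w x * ps x)) - (1 - e / 4) * (x * w x * src x)).
    move=> x0 x1.
    have h1 := dFU x x0 x1; have h2 := dQ x (ltW x0); have h3 := dI x (ltW x0); have h4 := dE x x0.
    by apply: is_derive_eq; rewrite /GRing.scale /=; ring.
  apply: (@ge0_derive_le _ D (fun x =>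
    (N * (c * k x) * E x * (lam * F (U x) * Q x) + E x * (lam * (fp (U x) * - (F (U x) * c * k x)) * Q x +
     lam * F (U x) * (x * w x * ps x)) - (1 - e / 4) * (x * w x * src x))) _ _ ss0).
  - by move=> x /andP[x0 xs]; apply: dD; lra.
  - move=> x /andP[x0 xs]; have x1 : x < 1 by lra.
    have xx : 0 < x by lra.
    have w0 := wt_gt0 al ph x.
    have hx : 0 <= x <= 1 by lra.
    rewrite srcE//.
    have -> : N * (c * k x) * E x * (lam * F (U x) * Q x) + E x * (lam * (fp (U x) * - (F (U x) * c * k x)) * Q x +
     lam * F (U x) * (x * w x * ps x)) - (1 - e / 4) * (x * w x * (lam * ps x * F (U x))) =
     E x * (c * k x) * (lam * F (U x) * Q x) * (N - fp (U x)) +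
     (x * w x * ps x) * (lam * F (U x)) * (E x - (1 - e / 4)).
      by ring.
    have [u0 uU] := U_in x xx x1.
    have Q0 : 0 <= Q x by apply: Q_ge0; lra.
    have k0 : 0 <= k x by rewrite divr_ge0// mulr_ge0// ltW.
    have Ex := E1 x (ltW x0) (ltW x1).
    have /andP[psx _] := ps01 hx.
    apply: addr_ge0; apply: mulr_ge0.
    + apply: mulr_ge0; last by rewrite !mulr_ge0// ltW.
      by apply: mulr_ge0; [lra|apply: mulr_ge0; [exact: ltW|exact: k0]].
    + by rewrite subr_ge0; exact: hN.
    + apply: mulr_ge0; last by rewrite mulr_ge0// ltW.
      by rewrite mulr_ge0// mulr_ge0// ltW.
    + by lra.
  - by move=> x /andP[x0 xs]; apply: continuous_of_derive (dD x _ _); lra.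
(* The supersolution inequality in terms of fluxes: the right-hand side is [- s w U']. It uses
   [1 + e/2 <= (1 - e/4) (1 + e)], which holds for [0 <= e <= 1]. *)
have IB s : 0 < s -> s < 1 -> I s <= (1 + e) * (lam * F (U s) * Q s).
  move=> s0' s1; have Q0 : 0 <= Q s by apply: Q_ge0; lra.
  have q0 : 0 <= lam * F (U s) * Q s by rewrite mulr_ge0// mulr_ge0// ltW.
  have e4 : 0 < 1 - e / 4 by lra.
  rewrite -(ler_pM2l e4).
  have ee : (1 + e / 2) * (lam * F (U s) * Q s) <= (1 - e / 4) * ((1 + e) * (lam * F (U s) * Q s)).
    by rewrite [leRHS]mulrA; apply: ler_wpM2r => //; nra.
  apply: le_trans ee.
  have [ss0|s0s] := leP s s0.
    apply: le_trans (stepA s (ltW s0') ss0) _.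
    by rewrite ler_peMl//; lra.
  apply: le_trans (stepB s (ltW s0s) s1) _.
  apply: ler_wpM2r => //; apply: le_trans hP.
  rewrite ler_expR; apply: ler_wpM2l => //; apply: ler_wpM2l; first exact: ltW.
  by rewrite gerBl -P1; apply: ltW; apply: P_decr => //; lra.
have U_ge0 s : 0 <= s <= 1 -> 0 <= U s.
  by move=> hs; rewrite UE//; have [/andP[]] := hG _ (cP_itv hs).
have U1 : U 1 = 0.
  have h01 : 0 <= (1 : R) <= 1 by rewrite ler01 lexx.
  rewrite UE// P1 mulr0.
  have F00 : 0 = Fi 0 by rewrite prim0.
  by rewrite {1}F00 GFi// lexx ltW.
have h00 : 0 <= (0 : R) <= 1 by rewrite ler01 lexx.
apply: (@le_trans _ _ (U 0)); last first.
  by rewrite UE//; have [/andP[]] := hG _ (cP_itv h00).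
apply: (@Viter_supersolution _ al ph ps F) => //; [exact: ltW|exact: ltW|].
move=> r hr; rewrite /Tmap -/src.
have /andP[r0 r1] := hr.
rewrite -subr_ge0.
have -> : 0 = U 1 - rsol al ph src 1 by rewrite U1 rsol1 subrr.
rewrite -lerN2.
have cW : continuous (rsol al ph src) by exact: continuous_rsol.
apply: (@ge0_derive_le _ (fun x => - (U x - rsol al ph src x))
  (fun x => F (U x) * c * k x - I x / (x * w x)) _ _ r1).
- move=> x /andP[rx x1]; have x0 : 0 < x by lra.
  have h1 := dU x x0 x1.
  have h2 : is_derive x 1 (rsol al ph src) (x * slope al ph src x).
    by apply: is_derive_rsol => //; lra.
  have w0 := wt_gt0 al ph x.
  apply: is_derive_eq; rewrite slopeE// /I; field.
  by rewrite !gt_eqF.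
- move=> x /andP[rx x1]; have x0 : 0 < x by lra.
  have w0 := wt_gt0 al ph x.
  have -> : F (U x) * c * k x - I x / (x * w x) =
    ((1 + e) * (lam * F (U x) * Q x) - I x) / (x * w x).
    by field; rewrite !gt_eqF.
  by rewrite divr_ge0 ?subr_ge0 ?IB// mulr_ge0// ltW.
- move=> x _; apply: cvgN; apply: cvgB; [exact: cU|exact: cW].
Unshelve. all: by end_near. Qed.

End Supersolution.

Section SlopeBounds.
Variables (R : realType) (al : R) (ph ps : R -> R).
Hypothesis al0 : 0 < al.
Hypothesis cph : continuous ph.
Hypothesis ph0 : forall s, 0 <= s <= 1 -> 0 <= ph s.
Hypothesis cps : continuous ps.
Hypothesis ps01 : forall s, 0 <= s <= 1 -> 0 <= ps s <= 1.

Notation w := (wt al ph).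
Notation P := (rsol al ph ps).
Notation Q := (flux al ph ps).
Notation k := (fun s => Q s / (s * w s)).

Let dP (s : R) : 0 < s -> is_derive s 1 P (- k s).
Proof.
move=> s0; have h := is_derive_rsol al cph cps (ltW s0).
apply: is_derive_eq h _; rewrite slopeE//; field.
by rewrite !gt_eqF ?wt_gt0.
Qed.

Let cP : continuous P. Proof. exact: continuous_rsol. Qed.

Lemma flux_k_ge0 s : 0 < s -> s <= 1 -> 0 <= k s.
Proof.
move=> s0 s1; rewrite divr_ge0//; last by rewrite mulr_ge0 ?(ltW s0)// ltW// wt_gt0.
rewrite -(flux0 al ph ps); apply: flux_nondecr => //; last exact: ltW.
by move=> t /ps01/andP[].
Qed.

Lemma flux_k_le_half s : 0 < s -> s <= 1 -> k s <= s / 2.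
Proof.
move=> s0 s1; have w0 := wt_gt0 al ph s.
have c0 : continuous (fun _ : R => 0 : R) by move=> x; exact: cvg_cst.
have s01 : 0 <= s <= 1 by rewrite (ltW s0).
have H : Q s <= flux al ph (fun _ : R => 0) s + 1 * (w s * (s ^+ 2 / 2)).
  apply: flux_le => //; first exact: ltW.
  by move=> t /ps01/andP[_ h]; rewrite add0r.
have E : flux al ph (fun _ : R => 0) s = 0.
  rewrite fluxE; under eq_fun do rewrite mulr0.
  by rewrite prim_linear ?mul0r// ltW.
rewrite E add0r mul1r in H.
rewrite ler_pdivrMr ?mulr_gt0//; apply: le_trans H _.
by rewrite le_eqVlt; apply/orP; left; apply/eqP; ring.
Qed.

(** Since [r w ph = w' / al], a source below [m * ph] has flux at most [m (w - 1) / al]. *)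
Lemma flux_k_le_ratio m s : 0 < s -> s <= 1 -> 0 <= m ->
  (forall t, 0 < t -> t < s -> ps t <= m * ph t) -> k s <= m / (al * s).
Proof.
move=> s0 s1 m0 hm; have al0' := al0.
have dQ (x : R) : 0 <= x -> is_derive x 1 Q (x * w x * ps x).
  by move=> x0; apply: is_derive_flux => //; lra.
have dw (x : R) : 0 <= x -> is_derive x 1 w (al * x * ph x * w x).
  by move=> x0; apply: is_derive_wt => //; lra.
pose D x := m / al * w x - Q x.
have dD (x : R) : 0 <= x -> is_derive x 1 D (x * w x * (m * ph x - ps x)).
  move=> x0; have h1 := dQ x x0; have h2 := dw x x0.
  by apply: is_derive_eq; rewrite /GRing.scale /=; field; rewrite gt_eqF.
have : D 0 <= D s.
  apply: (@ge0_derive_le _ D (fun x => x * w x * (m * ph x - ps x)) _ _ (ltW s0)).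
  - by move=> x /andP[x0 _]; apply: dD; exact: ltW.
  - move=> x /andP[x0 xs]; rewrite mulr_ge0 ?subr_ge0 ?hm//.
    by rewrite mulr_ge0 ?(ltW x0)// ltW// wt_gt0.
  - by move=> x /andP[x0 _]; apply: continuous_of_derive (dD x x0).
rewrite /D flux0 wt0 mulr1 subr0 => h.
have ma : 0 <= m / al by rewrite divr_ge0// ltW.
have h2 : Q s <= m / al * w s by lra.
have w0 := wt_gt0 al ph s.
rewrite ler_pdivrMr ?mulr_gt0//; apply: le_trans h2 _.
by rewrite le_eqVlt; apply/orP; left; apply/eqP; field; rewrite !gt_eqF.
Qed.

Lemma rsol0_le a : 0 < a -> a <= 1 -> P 0 <= P a + a ^+ 2 / 4.
Proof.
move=> a0 a1.
suff : P 0 + 0 ^+ 2 / 4 <= P a + a ^+ 2 / 4 by rewrite expr0n mul0r addr0.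
have dd (x : R) : 0 < x -> is_derive x 1 (fun x => P x + x ^+ 2 / 4) (x / 2 - k x).
  by move=> x0; have h := dP x0; apply: is_derive_eq; rewrite /GRing.scale /=; field; rewrite !gt_eqF ?wt_gt0.
apply: (@ge0_derive_le _ (fun x => P x + x ^+ 2 / 4) (fun x => x / 2 - k x) _ _ (ltW a0)).
- by move=> x /andP[x0 _]; exact: dd.
- move=> x /andP[x0 xa]; rewrite subr_ge0; apply: flux_k_le_half => //.
  exact: le_trans (ltW xa) a1.
- move=> x _; apply: cvgD; first exact: cP.
  by apply: cvgMl; exact: exprn_continuous.
Qed.

(** The bound [m / (al x)] for [- P'] integrates to a logarithm; for [a = al^(-1/2)] this produces
    the factor [ln al / 2]. *)
Lemma rsol_le_log m a s : 0 < a -> a <= s -> s <= 1 -> 0 <= m ->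
  (forall t, 0 < t -> t < s -> ps t <= m * ph t) ->
  P a <= P s + m / al * (ln s - ln a).
Proof.
move=> a0 as_ s1 m0 hm.
suff : P a + m / al * ln a <= P s + m / al * ln s by lra.
have dd (x : R) : 0 < x -> is_derive x 1 (fun x => P x + m / al * ln x) (m / (al * x) - k x).
  move=> x0; have h := dP x0; have h2 := is_derive1_ln x0.
  have al0' := al0.
  by apply: is_derive_eq; rewrite /GRing.scale /=; field; rewrite !gt_eqF ?wt_gt0.
apply: (@ge0_derive_le _ (fun x => P x + m / al * ln x) (fun x => m / (al * x) - k x) _ _ as_).
- by move=> x /andP[x0 _]; apply: dd; exact: lt_trans x0.
- move=> x /andP[ax xs]; rewrite subr_ge0; apply: flux_k_le_ratio => //.
  + exact: lt_trans ax.
  + exact: le_trans (ltW xs) s1.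
  + by move=> t t0 tx; apply: hm => //; exact: lt_trans xs.
- by move=> x /andP[ax _]; apply: continuous_of_derive (dd x _); exact: lt_le_trans ax.
Qed.

(** Here [- P' <= M x / (al x)]. As [phi] may vanish at 1, this is integrated up to some [b < 1]
    only; [P] is continuous with [P 1 = 0], and [b] tends to 1. *)
Lemma rsol_le_integral (M : R -> R) s0 : 0 < s0 -> s0 < 1 ->
  (forall s, 0 <= s < 1 -> 0 <= M s) ->
  (forall s t, 0 < t -> t < s -> s < 1 -> ps t <= M s * ph t) ->
  (\int[lebesgue_measure]_(s in `[0%R, 1%R[) (M s)%:E < +oo)%E ->
  P s0 <= fine (\int[lebesgue_measure]_(s in `[0%R, 1%R[) (M s)%:E)%E / (al * s0).
Proof.
move=> s00 s01 M0 hM Mfin; have al0' := al0.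
set CM := fine _.
(* For [s > 0] this is [al s0 k s], at most [M s] on [[s0, 1[]; expressed through [slope] it is
   continuous on the whole line. *)
pose k1 s := al * s0 * (- (s * slope al ph ps s)).
have ck1 : continuous k1.
  move=> x; apply: cvgMr; apply: cvgN; apply: cvgM; first exact: cvg_id.
  exact: continuous_slope.
have k1E s : 0 < s -> k1 s = al * s0 * k s.
  move=> sp; rewrite /k1 slopeE//; field.
  by rewrite !gt_eqF ?wt_gt0.
have step b : s0 < b -> b < 1 -> P s0 <= P b + CM / (al * s0).
  move=> sb b1.
  have I1 : prim k1 b - prim k1 s0 <= CM.
    apply: (@prim_le_integral _ `[0, 1[%classic M k1) => //.
    - exact: ltW.
    - by move=> x /=; rewrite !in_itv /=; lra.
    - move=> x /andP[sx xb]; have x0 : 0 < x by lra.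
      rewrite k1E// mulr_ge0//; first by rewrite mulr_ge0// ltW.
      by apply: flux_k_ge0 => //; lra.
    - move=> x /andP[sx xb]; have x0 : 0 < x by lra.
      have Mx : 0 <= M x by apply: M0; lra.
      have kx : k x <= M x / (al * x).
        apply: flux_k_le_ratio => //; first lra.
        by move=> t t0 tx; apply: hM => //; lra.
      rewrite k1E//; apply: (@le_trans _ _ (al * s0 * (M x / (al * x)))).
        by apply: ler_wpM2l => //; rewrite mulr_ge0// ltW.
      have -> : al * s0 * (M x / (al * x)) = M x * (s0 / x) by field; rewrite !gt_eqF.
      by rewrite ler_piMr// ler_pdivrMr// mul1r.
  have h : P s0 + prim k1 s0 / (al * s0) <= P b + prim k1 b / (al * s0).
    have dd (x : R) : 0 < x -> is_derive x 1 (fun x => P x + prim k1 x / (al * s0)) 0.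
      move=> x0; have h1 := dP x0.
      have h2 : is_derive x 1 (prim k1) (al * s0 * k x).
        by rewrite -k1E//; apply: is_derive_prim => //; lra.
      apply: is_derive_eq; rewrite /GRing.scale /=; field.
      by rewrite !gt_eqF ?wt_gt0.
    apply: (@ge0_derive_le _ (fun x => P x + prim k1 x / (al * s0)) (fun=> 0) _ _ (ltW sb)) => //.
    - by move=> x /andP[sx _]; apply: dd; lra.
    - by move=> x /andP[sx _]; apply: continuous_of_derive (dd x _); lra.
  have h2 : (prim k1 b - prim k1 s0) / (al * s0) <= CM / (al * s0).
    by rewrite ler_pM2r// invr_gt0 mulr_gt0.
  by rewrite mulrBl in h2; lra.
rewrite leNgt; apply/negP => h.
have [d /= d0 hd] : \forall b \near (1 : R), P b < P s0 - CM / (al * s0).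
  have /cvgr_lt : {for (1 : R), continuous P} by exact: cP.
  by apply; rewrite rsol1 subr_gt0.
pose b := Num.max ((s0 + 1) / 2) (1 - d / 2).
have b1 : b < 1 by rewrite gt_max; apply/andP; split; lra.
have b2 : (s0 + 1) / 2 <= b by rewrite le_max lexx.
have b3 : 1 - d / 2 <= b by rewrite le_max lexx orbT.
have := step b ltac:(lra) b1.
have := hd b; rewrite /= gtr0_norm ?subr_gt0// => /(_ ltac:(lra)); lra.
Qed.

End SlopeBounds.

Section Mratio.
Variables (R : realType) (phi psi : R -> R).
Hypothesis psi_ge0 : forall r : R, 0 <= r <= 1 -> 0 <= psi r.
Hypothesis phi_noninc : forall r s : R, 0 <= r -> r <= s -> s <= 1 -> phi s <= phi r.
Hypothesis psi_noninc : forall r s : R, 0 <= r -> r <= s -> s <= 1 -> psi s <= psi r.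
Hypothesis phi_pos : forall r : R, 0 <= r < 1 -> 0 < phi r.
Hypothesis psi0 : psi 0 = 1.

(** The ratios on [[0, s]] are bounded by [1 / phi s], so [sup] is a genuine supremum and not a
    default value. *)
Lemma Mratio_ge r s : 0 <= r -> r <= s -> s < 1 -> psi r <= Mratio phi psi s * phi r.
Proof.
move=> r0 rs s1; have pr : 0 < phi r by apply: phi_pos; lra.
rewrite -ler_pdivrMr//; apply: ub_le_sup; last by exists r; rewrite //= in_itv /= r0.
have ps' : 0 < phi s by apply: phi_pos; lra.
exists (phi s)^-1 => y [t /=]; rewrite in_itv /= => /andP[t0 ts] <- {y}.
have pt : phi s <= phi t by apply: phi_noninc => //; lra.
have pt1 : psi t <= 1 by rewrite -psi0; apply: psi_noninc => //; lra.
have pt2 : 0 < phi t by exact: lt_le_trans pt.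
rewrite ler_pdivrMr//; apply: le_trans pt1 _.
by rewrite mulrC ler_pdivlMr// mul1r.
Qed.

Lemma Mratio_ge0 s : 0 <= s < 1 -> 0 <= Mratio phi psi s.
Proof.
move=> /andP[s0 s1]; have ps' : 0 < phi s by apply: phi_pos; rewrite s0.
have h := Mratio_ge s0 (lexx s) s1.
have p0 : 0 <= psi s by apply: psi_ge0; rewrite s0 ltW.
by have := le_trans p0 h; rewrite pmulr_lge0.
Qed.

End Mratio.

Section LowerBound.
Variables (R : realType) (f phi psi : R -> R).
Hypothesis f_C1 : C1_0y f.
Hypothesis f_pos : forall t : R, 0 <= t -> 0 < f t.
Hypothesis f_nondecr : forall s t : R, 0 <= s -> s <= t -> f s <= f t.
Hypothesis f_convex : convex_function (`[0, +oo[%classic : set R^o) f.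
Hypothesis phi_ge0 : forall r : R, 0 <= r <= 1 -> 0 <= phi r.
Hypothesis psi_ge0 : forall r : R, 0 <= r <= 1 -> 0 <= psi r.
Hypothesis phi_noninc : forall r s : R, 0 <= r -> r <= s -> s <= 1 -> phi s <= phi r.
Hypothesis psi_noninc : forall r s : R, 0 <= r -> r <= s -> s <= 1 -> psi s <= psi r.
Hypothesis phi_lip : [lipschitz phi r | r in `[0, 1]%classic].
Hypothesis psi_lip : [lipschitz psi r | r in `[0, 1]%classic].
Hypothesis phi0 : phi 0 = 1.
Hypothesis psi0 : psi 0 = 1.
Hypothesis phi_pos : forall r : R, 0 <= r < 1 -> 0 < phi r.
Hypothesis M_int : (\int[lebesgue_measure]_(s in `[0%R, 1%R[) (Mratio phi psi s)%:E < +oo)%E.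

Notation ph := (phi \o @clamp R).
Notation ps := (psi \o @clamp R).
Notation F := (fext f).
Notation Fi := (prim (fun u => (fext f u)^-1)).

Lemma near_ln_gt (B : R) : \forall al \near +oo, B < ln al.
Proof.
near=> al; rewrite -[B]expRK ltr_ln ?posrE ?expR_gt0//; near: al;
  exact: nbhs_pinfty_gt.
Unshelve. all: by end_near. Qed.

(** The radial solution with source [psi] is at most about [ln al / (2 al)] at 0, so for
    [lam = kappa al / ln al] the supersolution needs little more than [kappa / 2] of [Fi U0]
    there. *)
Lemma Viter_bounded (kappa U0 : R) : 0 < kappa -> 0 < U0 -> kappa / 2 < Fi U0 ->
  \forall al \near +oo, forall n, Viter al ph ps F (kappa * al / ln al) n 0 <= U0.
Proof.
move=> k0 U00 kY.
have cph : continuous ph by exact: continuous_lipschitz_clamp.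
have cps : continuous ps by exact: continuous_lipschitz_clamp.
have ph_0 s : 0 <= s <= 1 -> 0 <= ph s by move=> hs; apply: phi_ge0; exact: clamp_itv.
have ps_01 s : 0 <= s <= 1 -> 0 <= ps s <= 1 by move=> hs; exact: ps_itv.
have h01 : 0 <= (0 : R) <= 1 by rewrite lexx ler01.
have ps_0 : ps 0 = 1 by rewrite /= clamp_id.
have ph_00 : ph 0 = 1 by rewrite /= clamp_id.
pose Y := Fi U0.
(* The factor [(1 + e)^2] adds at most [3 e kappa / 2] to [kappa / 2], that is at most half of the
   gap to [Y]. *)
pose e := Num.min 1 ((Y - kappa / 2) / (3 * kappa)).
have e0 : 0 < e by rewrite lt_min ltr01 divr_gt0 ?subr_gt0// mulr_gt0.
have e1 : e <= 1 by rewrite ge_min lexx.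
have eY : (1 + e) ^+ 2 * kappa / 2 < Y.
  have h : e <= (Y - kappa / 2) / (3 * kappa) by rewrite ge_min lexx orbT.
  rewrite ler_pdivlMr ?mulr_gt0// in h.
  have h2 : e ^+ 2 * kappa <= e * kappa by apply: ler_wpM2r; [exact: ltW|rewrite expr2 ler_piMr// ltW].
  have : kappa / 2 < Y by [].
  by rewrite sqrrD expr1n mul1r; move: h h2; lra.
have [s0 [s00 s01 hs0]] : exists s0 : R, [/\ 0 < s0, s0 < 1 & forall s, 0 <= s <= s0 ->
    2^-1 <= ps s /\ ps s <= (1 + e) * ph s].
  have c1 : \forall s \near (0 : R), 2^-1 < ps s.
    have /cvgr_gt : {for (0 : R), continuous ps} by exact: cps.
    by apply; rewrite ps_0; lra.
  have c2 : \forall s \near (0 : R), ps s - (1 + e) * ph s < 0.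
    have /cvgr_lt : {for (0 : R), continuous (fun s => ps s - (1 + e) * ph s)}.
      by apply: cvgB; [exact: cps|apply: cvgMr; exact: cph].
    by apply; rewrite ps_0 ph_00; lra.
  have [d /= d0 hd] : \forall s \near (0 : R), 2^-1 < ps s /\ ps s - (1 + e) * ph s < 0.
    by apply: filterS2 c1 c2.
  exists (Num.min (2^-1) (d / 2)); split.
  - by rewrite lt_min invr_gt0 ltr0n divr_gt0.
  - by rewrite gt_min; apply/orP; left; lra.
  - move=> s /andP[sp]; rewrite le_min => /andP[sh sd].
    have [] := hd s; first by rewrite /= sub0r normrN ger0_norm//; lra.
    by move=> a b; split; lra.
set CM := fine (\int[lebesgue_measure]_(s in `[0%R, 1%R[) (Mratio phi psi s)%:E)%E.
have CM0 : 0 <= CM.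
  apply: fine_ge0; apply: integral_ge0 => x /=; rewrite in_itv /= => hx.
  by rewrite lee_fin; apply: Mratio_ge0.
pose N := deriv0y f U0.
have N0 : 0 <= N by apply: fp_ge0 => //; exact: ltW.
(* Three thresholds for [ln al], one for each quantitative hypothesis on the supersolution: its
   value at 0, the slope on []0, s0]], and the exponential factor beyond [s0]. *)
pose B1 := (1 + e) * kappa * (4^-1 + CM / s0) / (Y - (1 + e) ^+ 2 * kappa / 2).
pose B2 := 4 * N * (1 + e) ^+ 2 * kappa / e.
pose B3 := N * ((1 + e) * kappa * CM / s0) / ln (1 + e / 2).
near=> al => n.
have l1 : 1 < ln al by near: al; exact: near_ln_gt.
have lB1 : B1 < ln al by near: al; exact: near_ln_gt.
have lB2 : B2 < ln al by near: al; exact: near_ln_gt.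
have lB3 : B3 < ln al by near: al; exact: near_ln_gt.
have alS : s0 ^- 2 < al by near: al; apply: nbhs_pinfty_gt; exact: num_real.
have al0 : 0 < al by apply: lt_trans alS; rewrite invr_gt0 exprn_gt0.
have l0 : 0 < ln al by exact: lt_trans l1.
set l := ln al in l1 lB1 lB2 lB3 l0 *.
pose lam := kappa * al / l.
have lam0 : 0 < lam by rewrite divr_gt0// mulr_gt0.
pose a := (Num.sqrt al)^-1.
have sq0 : 0 < Num.sqrt al by rewrite sqrtr_gt0.
have a0 : 0 < a by rewrite invr_gt0.
have a2 : a ^+ 2 = al^-1 by rewrite exprVn sqr_sqrtr// ltW.
have as0 : a <= s0.
  rewrite -ler_sqr ?nnegrE ?(ltW a0) ?(ltW s00)// a2.
  have h : 1 < al * s0 ^+ 2 by rewrite -ltr_pdivrMr ?exprn_gt0// mul1r.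
  by rewrite -(ler_pM2l al0) divff ?gt_eqF// ltW.
have lna : ln a = - (l / 2).
  have : ln (a ^+ 2) = - l by rewrite a2 lnV ?posrE.
  by rewrite lnXn// mulr2n; lra_after k0.
have lns0 : ln s0 <= 0 by rewrite ln_le0// ltW.
have m0 : 0 <= 1 + e by move: e0; lra_after k0.
have hm t : 0 < t -> t < s0 -> ps t <= (1 + e) * ph t.
  by move=> t0 ts; have [] := hs0 t; rewrite ?(ltW t0) ?(ltW ts).
have PS : rsol al ph ps s0 <= CM / (al * s0).
  apply: (@rsol_le_integral _ al ph ps al0 cph cps ps_01 (Mratio phi psi)) => //.
    by move=> s hs; apply: Mratio_ge0.
  move=> s t t0 ts s1; rewrite /= clamp_id ?(ltW t0) ?(le_trans (ltW ts) (ltW s1))//.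
  exact: (Mratio_ge phi_noninc psi_noninc phi_pos psi0 (ltW t0) (ltW ts)).
have P0 : rsol al ph ps 0 <= CM / (al * s0) + (1 + e) / al * (l / 2) + (al^-1) / 4.
  have a1 : a <= 1 by exact: le_trans as0 (ltW s01).
  have H0 : rsol al ph ps 0 <= rsol al ph ps a + a ^+ 2 / 4 by apply: rsol0_le.
  apply: le_trans H0 _.
  rewrite a2 lerD2r.
  have H1 : rsol al ph ps a <= rsol al ph ps s0 + (1 + e) / al * (ln s0 - ln a).
    by apply: rsol_le_log => //; exact: ltW.
  apply: le_trans H1 _.
  apply: lerD => //; apply: ler_wpM2l; first by rewrite divr_ge0// ltW.
  by rewrite lna; move: lns0; lra_after k0.
apply: (@supersolution_bound _ al lam e s0 U0 N ph ps F (deriv0y f)) => //.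
- exact: continuous_fext.
- by move=> u; exact: fext_gt0.
- by move=> u v; exact: fext_nondecr.
- by move=> u u0; exact: is_derive_fext.
- apply: (@le_lt_trans _ _ ((1 + e) * lam * (CM / (al * s0) + (1 + e) / al * (l / 2) + al^-1 / 4))).
    by apply: ler_wpM2l => //; rewrite mulr_ge0// ltW.
  have -> : (1 + e) * lam * (CM / (al * s0) + (1 + e) / al * (l / 2) + al^-1 / 4) =
     (1 + e) ^+ 2 * kappa / 2 + (1 + e) * kappa * (4^-1 + CM / s0) / l.
    by rewrite /lam; field; rewrite !gt_eqF.
  move: lB1; rewrite /B1 ltr_pdivrMr ?subr_gt0// => h.
  have h2 : (1 + e) * kappa * (4^-1 + CM / s0) / l < Y - (1 + e) ^+ 2 * kappa / 2.
    by rewrite ltr_pdivrMr// [ltRHS]mulrC.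
  by rewrite -/Y; move: h2; lra_after k0.
- by move=> u u0 uU; apply: fp_nondecr => //; exact: ltW.
- move=> s sp ss0; have s1 : s <= 1 by exact: le_trans ss0 (ltW s01).
  have [p1 p2] := hs0 s ltac:(by rewrite (ltW sp) ss0).
  have k1 : flux al ph ps s / (s * wt al ph s) <= s / 2 by apply: flux_k_le_half.
  have k2 : flux al ph ps s / (s * wt al ph s) <= (1 + e) / (al * s).
    apply: flux_k_le_ratio => // t t0 ts; apply: hm => //; exact: lt_le_trans ss0.
  have kk0 : 0 <= flux al ph ps s / (s * wt al ph s) by apply: flux_k_ge0.
  set kk := flux al ph ps s / (s * wt al ph s) in k1 k2 kk0 *.
  (* The product of the slope bounds [s / 2] and [(1 + e) / (al s)], in which [s] cancels. *)
  have ksq : kk ^+ 2 <= (1 + e) / (2 * al).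
    have -> : (1 + e) / (2 * al) = (s / 2) * ((1 + e) / (al * s)) by field; rewrite !gt_eqF.
    by rewrite expr2; apply: ler_pM.
  apply: (@le_trans _ _ (N * ((1 + e) * lam) * ((1 + e) / (2 * al)))).
    apply: ler_wpM2l; last exact: ksq.
    by apply: mulr_ge0 => //; apply: mulr_ge0 => //; exact: ltW.
  apply: (@le_trans _ _ (e / 8)).
    have -> : N * ((1 + e) * lam) * ((1 + e) / (2 * al)) = 8^-1 * (4 * N * (1 + e) ^+ 2 * kappa / l).
      by rewrite /lam; field; rewrite !gt_eqF.
    have h : 4 * N * (1 + e) ^+ 2 * kappa / l <= e.
      rewrite ler_pdivrMr//; move: lB2; rewrite /B2 ltr_pdivrMr//; lra_after k0.
    by move: h; lra_after k0.
  have : e * 2^-1 <= e * ps s by apply: ler_wpM2l => //; exact: ltW.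
  by lra_after k0.
- have ln0 : 0 < ln (1 + e / 2) by rewrite ln_gt0//; move: e0; lra_after k0.
  have -> : 1 + e / 2 = expR (ln (1 + e / 2)) by rewrite lnK// posrE; move: e0; lra_after k0.
  rewrite ler_expR.
  apply: (@le_trans _ _ (N * ((1 + e) * lam * (CM / (al * s0))))).
    apply: ler_wpM2l => //; apply: ler_wpM2l => //; rewrite mulr_ge0// ltW//.
  have -> : N * ((1 + e) * lam * (CM / (al * s0))) = N * ((1 + e) * kappa * CM / s0) / l.
    by rewrite /lam; field; rewrite !gt_eqF.
  move: lB3; rewrite /B3 ltr_pdivrMr// => h.
  by rewrite ler_pdivrMr// [leRHS]mulrC ltW.
Unshelve. all: by end_near. Qed.

End LowerBound.

(** * Decay away from the origin *)

Section Outer.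
Variables (R : realType) (al lam : R) (ph ps F g : R -> R).
Hypothesis al0 : 0 < al.
Hypothesis lam0 : 0 < lam.
Hypothesis cph : continuous ph.
Hypothesis ph01 : forall s, 0 <= s <= 1 -> 0 <= ph s <= 1.
Hypothesis ps0 : forall s, 0 <= s <= 1 -> 0 <= ps s.
Hypothesis ps_noninc : forall r s, 0 <= r -> r <= s -> s <= 1 -> ps s <= ps r.
Hypothesis cF : continuous F.
Hypothesis F0 : forall u, 0 < F u.
Hypothesis F_nondecr : forall u v, u <= v -> F u <= F v.
Hypothesis cg : continuous g.

Notation w := (wt al ph).
Notation W := (rsol al ph g).
Notation Q := (flux al ph g).
Notation Fi := (prim (fun u => (F u)^-1)).

Hypothesis gE : forall s, 0 <= s <= 1 -> g s = lam * ps s * F (W s).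
Hypothesis W_ge0 : forall s, 0 <= s <= 1 -> 0 <= W s.
Hypothesis W_decr : forall r s, 0 <= r -> r <= s -> s <= 1 -> W s <= W r.

(** On [[0, s]] the source is at least its value at [s], hence at least that value times [ph]; and
    [r w ph = w' / al]. *)
Lemma flux_ge_drift s : 0 < s -> s <= 1 -> lam * ps s * F (W s) * (w s - 1) / al <= Q s.
Proof.
move=> s0 s1; have al0' := al0; have s01 : 0 <= s <= 1 by lra.
pose c := lam * ps s * F (W s).
have c0 : 0 <= c by rewrite /c mulr_ge0 ?(ltW (F0 _))// mulr_ge0 ?ps0// ltW.
pose D x := Q x - c / al * w x.
have dD (x : R) : 0 <= x -> is_derive x 1 D (x * w x * (g x - c * ph x)).
  move=> x0.
  have h1 : is_derive x 1 Q (x * w x * g x) by apply: is_derive_flux => //; lra.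
  have h2 : is_derive x 1 w (al * x * ph x * w x) by apply: is_derive_wt => //; lra.
  by apply: is_derive_eq; rewrite /GRing.scale /=; field; rewrite gt_eqF.
have : D 0 <= D s.
  apply: (@ge0_derive_le _ D (fun x => x * w x * (g x - c * ph x)) _ _ (ltW s0)).
  - by move=> x /andP[x0 _]; apply: dD; exact: ltW.
  - move=> x /andP[x0 xs]; have x01 : 0 <= x <= 1 by lra.
    have /andP[p0 p1] := ph01 x01.
    rewrite mulr_ge0//; first by rewrite mulr_ge0 ?(ltW x0)// ltW// wt_gt0.
    rewrite subr_ge0; apply: (@le_trans _ _ c); first by rewrite ler_piMr.
    rewrite gE// /c; apply: ler_pM.
    + by rewrite mulr_ge0 ?ps0// ltW.
    + exact: ltW.
    + by apply: ler_wpM2l; [exact: ltW|apply: ps_noninc => //; exact: ltW].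
    + by apply: F_nondecr; apply: W_decr => //; exact: ltW.
  - by move=> x /andP[x0 _]; apply: continuous_of_derive (dD x x0).
rewrite /D flux0 wt0 mulr1 sub0r -/c => h.
have -> : c * (w s - 1) / al = c / al * w s - c / al by field; rewrite gt_eqF.
lra.
Qed.

(** In [(Fi o W)' = - Q / (r w F(W))] the factor [F(W)] cancels against the one in the flux bound,
    so the decay of [Fi o W] does not depend on the size of the solution. *)
Lemma outer_decay theta b r : 0 < b -> b <= r -> r <= 1 -> 0 <= theta ->
  (forall s, b < s -> s < r -> theta <= ps s * (1 - (w s)^-1)) ->
  Fi (W r) + lam / al * theta * (ln r - ln b) <= Fi (W b).
Proof.
move=> b0 br r1 t0 hth; have al0' := al0.
suff : - (Fi (W b) + lam / al * theta * ln b) <= - (Fi (W r) + lam / al * theta * ln r) by lra.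
have cFi : continuous (fun u => (F u)^-1).
  by move=> u; apply: cvgV; [rewrite gt_eqF|exact: cF].
have dd (x : R) : 0 < x -> x <= 1 -> is_derive x 1
    (fun x => - (Fi (W x) + lam / al * theta * ln x))
    (Q x / (x * w x) / F (W x) - lam / al * theta / x).
  move=> x0 x1; have w0 := wt_gt0 al ph x.
  have Wx : 0 <= W x by apply: W_ge0; lra.
  have h1 : is_derive x 1 W (x * slope al ph g x) by apply: is_derive_rsol => //; exact: ltW.
  have h2 : is_derive (W x) 1 Fi (F (W x))^-1 by apply: is_derive_prim => //; lra.
  have h3 := @is_derive1_comp _ Fi W x _ _ h2 h1.
  have h4 := is_derive1_ln x0.
  have h5 : is_derive x 1 (fun x => - ((Fi \o W) x + lam / al * theta * ln x))
    (Q x / (x * w x) / F (W x) - lam / al * theta / x).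
    have F0x := F0 (W x).
    by apply: is_derive_eq; rewrite slopeE// /GRing.scale /=; field; rewrite !gt_eqF.
  exact: h5.
apply: (@ge0_derive_le _ (fun x => - (Fi (W x) + lam / al * theta * ln x))
  (fun x => Q x / (x * w x) / F (W x) - lam / al * theta / x) _ _ br).
- by move=> x /andP[bx xr]; apply: dd; lra.
- move=> x /andP[bx xr]; have x0 : 0 < x by lra.
  have x1 : x <= 1 by lra.
  have w0 := wt_gt0 al ph x; have F0x := F0 (W x).
  rewrite subr_ge0.
  have h := flux_ge_drift x0 x1.
  have h2 := hth x bx xr.
  apply: (@le_trans _ _ (lam / al / x * (ps x * (1 - (w x)^-1)))).
    have -> : lam / al * theta / x = lam / al / x * theta by field; rewrite !gt_eqF.
    by apply: ler_wpM2l => //; rewrite !divr_ge0// ltW.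
  have -> : lam / al / x * (ps x * (1 - (w x)^-1)) =
     (lam * ps x * F (W x) * (w x - 1) / al) / (x * w x) / F (W x).
    by field; rewrite !gt_eqF.
  by rewrite !ler_pM2r ?invr_gt0// mulr_gt0.
- by move=> x /andP[bx xr]; apply: continuous_of_derive (dd x _ _); lra.
Qed.

Lemma wt_ge_expR s m : 0 <= s -> s <= 1 -> 0 <= m -> (forall t, 0 < t -> t < s -> m <= ph t) ->
  expR (al * (m * (s ^+ 2 / 2))) <= w s.
Proof.
move=> s0 s1 m0 hm; rewrite wtE ler_expR; apply: ler_wpM2l; first exact: ltW.
have := @prim_le _ (fun t : R => t * m) (fun t : R => t * ph t) 0 s.
rewrite !prim0 !subr0 prim_linear//; apply => //.
- by move=> x; apply: cvgMl; exact: cvg_id.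
- exact: continuous_idM.
- by move=> x /andP[x0 xs]; apply: ler_wpM2l; [exact: ltW|exact: hm].
Qed.

End Outer.

(** * Growth of the derivative of [f] *)

Section Growth.
Variables (R : realType) (f : R -> R).
Hypothesis f_C1 : C1_0y f.
Hypothesis f_pos : forall t : R, 0 <= t -> 0 < f t.
Hypothesis f_nondecr : forall s t : R, 0 <= s -> s <= t -> f s <= f t.
Hypothesis f_convex : convex_function (`[0, +oo[%classic : set R^o) f.
Hypothesis f_int : (\int[lebesgue_measure]_(s in `[0%R, +oo[) ((f s)^-1)%:E < +oo)%E.
Notation F := (fext f).
Notation Fi := (prim (fun u => (fext f u)^-1)).
Notation fp := (deriv0y f).

Let F0 u : 0 < F u. Proof. exact: fext_gt0. Qed.

Lemma continuous_fextV : continuous (fun u => (F u)^-1).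
Proof. by move=> u; apply: cvgV; [rewrite gt_eqF|exact: continuous_fext]. Qed.

Lemma is_derive_Fi (u : R) : 0 <= u -> is_derive u 1 Fi (F u)^-1.
Proof. by move=> u0; apply: is_derive_prim; [exact: continuous_fextV|lra]. Qed.

Lemma Fi_lt (u v : R) : 0 <= u -> u < v -> Fi u < Fi v.
Proof.
move=> u0 uv; apply: (@gt0_derive_lt _ Fi (fun u => (F u)^-1) _ _ uv).
- by move=> x /andP[x0 _]; apply: is_derive_Fi; lra.
- by move=> x _; rewrite invr_gt0.
- by move=> x /andP[x0 _]; apply: continuous_of_derive (is_derive_Fi _); lra.
Qed.

Lemma Fi_le_inv (u v : R) : 0 <= v -> Fi u <= Fi v -> u <= v.
Proof. by move=> v0 h; rewrite leNgt; apply/negP => /(Fi_lt v0); rewrite ltNge h. Qed.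

Lemma Fi_gt0 (u : R) : 0 < u -> 0 < Fi u.
Proof. by move=> u0; rewrite -(prim0 (fun u => (fext f u)^-1)); exact: Fi_lt. Qed.

(* [int_0^oo ds / f s] *)
Definition Ktot : R := sup [set Fi u | u in [set u | 0 <= u]].

Let has_sup_Fi : has_sup [set Fi u | u in [set u | 0 <= u]].
Proof.
split; first by exists (Fi 0), 0 => //=.
exists (fine (\int[lebesgue_measure]_(s in `[0%R, +oo[) ((f s)^-1)%:E)%E).
move=> y [u /= u0 <- {y}].
have I0 : (0 <= \int[lebesgue_measure]_(s in `[0%R, +oo[) ((f s)^-1)%:E)%E.
  apply: integral_ge0 => x /=; rewrite in_itv /= andbT => x0.
  by rewrite lee_fin invr_ge0 ltW// f_pos.
have [->|un0] := eqVneq u 0; first by rewrite prim0 fine_ge0.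
have {un0}u0 : 0 < u by rewrite lt_neqAle eq_sym un0.
have -> : Fi u = Fi u - Fi 0 by rewrite prim0 subr0.
apply: (@prim_le_integral _ `[0, +oo[%classic (fun s => (f s)^-1)) => //.
- exact: continuous_fextV.
- by move=> x /=; rewrite !in_itv /=; lra.
- by move=> x _; rewrite invr_ge0 ltW.
- by move=> x /=; rewrite in_itv /= andbT => x0; rewrite invr_ge0 ltW// f_pos.
- by move=> x /andP[x0 _]; rewrite fext_id.
Qed.

Lemma Fi_le_Ktot (u : R) : 0 <= u -> Fi u <= Ktot.
Proof. by move=> u0; apply: ub_le_sup; [case: has_sup_Fi|exists u]. Qed.

Lemma Ktot_gt0 : 0 < Ktot.
Proof. exact: lt_le_trans (Fi_gt0 ltr01) (Fi_le_Ktot ler01). Qed.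

Lemma Ktot_approx (y : R) : y < Ktot -> exists2 u, 0 < u & y < Fi u.
Proof.
move=> yK; have e0 : 0 < Ktot - y by rewrite subr_gt0.
have [_ [u /= u0 <-] h] := sup_adherent e0 has_sup_Fi.
exists (u + 1); first lra.
have h2 : Fi u < Fi (u + 1) by apply: Fi_lt => //; lra.
by move: h; rewrite -/Ktot; lra.
Qed.

(* Convexity gives [f s <= (f 0 + f' A) s] for [1 <= s <= A]. *)
Lemma log_growth (e : R) : 0 < e -> exists2 s0, 1 <= s0 &
  forall A, 0 <= A -> Num.max A s0 <= s0 * expR (e * (f 0 + fp A)).
Proof.
move=> e0.
(* Past [u] the integral of [1 / f] is below [e], whereas over [[s0, A]] it is at least
   [(ln A - ln s0) / (f 0 + fp A)]. *)
have [u u0 hu] : exists2 u, 0 < u & Ktot - e < Fi u by apply: Ktot_approx; lra.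
pose s0 := Num.max 1 u.
have s01 : 1 <= s0 by rewrite le_max lexx.
have us : u <= s0 by rewrite le_max lexx orbT.
have f00 : 0 < f 0 by exact: f_pos.
exists s0 => // A A0.
have fA : 0 <= fp A by exact: fp_ge0.
have E1 : 1 <= expR (e * (f 0 + fp A)) by rewrite -expR0 ler_expR mulr_ge0 ?(ltW e0)//; lra.
have [As|sA] := leP A s0; first by rewrite ler_peMr//; lra.
have c0 : 0 < f 0 + fp A by lra.
have hFi : Fi A - Fi s0 <= e.
  have := Fi_le_Ktot A0.
  have : Fi u <= Fi s0.
    move: us; rewrite le_eqVlt => /orP[/eqP <-//|us].
    by apply: ltW; apply: Fi_lt => //; exact: ltW.
  lra.
have h : (ln A - ln s0) / (f 0 + fp A) <= Fi A - Fi s0.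
  suff : Fi s0 - ln s0 / (f 0 + fp A) <= Fi A - ln A / (f 0 + fp A) by rewrite mulrBl; lra.
  have dd (x : R) : 0 < x -> is_derive x 1 (fun x => Fi x - ln x / (f 0 + fp A))
      ((F x)^-1 - (x * (f 0 + fp A))^-1).
    move=> x0; have h1 := is_derive_Fi (ltW x0); have h2 := is_derive1_ln x0.
    have Fx := F0 x.
    by apply: is_derive_eq; rewrite /GRing.scale /=; field; rewrite !gt_eqF.
  apply: (@ge0_derive_le _ (fun x => Fi x - ln x / (f 0 + fp A))
     (fun x => (F x)^-1 - (x * (f 0 + fp A))^-1) _ _ (ltW sA)).
  - by move=> x /andP[x0 _]; apply: dd; lra.
  - move=> x /andP[sx xA]; have x0 : 0 < x by lra.
    rewrite subr_ge0 lef_pV2 ?posrE ?mulr_gt0//.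
    rewrite fext_id ?(ltW x0)//.
    have t := convex_tangent f_C1 f_convex (ltW x0) (lexx 0).
    have fm : fp x <= fp A by apply: fp_nondecr => //; exact: ltW.
    have h1 : fp x * x <= fp A * x by apply: ler_wpM2r => //; exact: ltW.
    have h2 : f 0 <= f 0 * x by rewrite ler_peMr ?(ltW f00)//; lra.
    lra.
  - by move=> x /andP[sx _]; apply: continuous_of_derive (dd x _); lra.
have h2 : ln A - ln s0 <= e * (f 0 + fp A).
  by rewrite -ler_pdivrMr//; exact: le_trans hFi.
have Ap : 0 < A by lra.
have sp : 0 < s0 by lra.
apply: (@le_trans _ _ (expR (ln s0 + e * (f 0 + fp A)))); last by rewrite expRD lnK.
have AE : expR (ln A) = A by rewrite lnK.
by rewrite -{1}AE ler_expR; lra.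
Qed.

(** [log_growth] prevents [fp] from being bounded: [T] lies just above the bound that [fp T < y]
    would impose on it. The intermediate value theorem does the rest. *)
Lemma fp_onto (y : R) : fp 0 <= y -> exists A, 0 <= A /\ fp A = y.
Proof.
move=> fy.
have [s0 s01 hs] := log_growth ltr01.
have f00 : 0 < f 0 by exact: f_pos.
have y0 : 0 <= y by apply: le_trans fy; exact: fp_ge0.
pose T := s0 * expR (f 0 + y) + 1.
have T0 : 0 < T by rewrite /T ltr_wpDl// mulr_ge0 ?expR_ge0//; lra.
have fT : y <= fp T.
  rewrite leNgt; apply/negP => h.
  have h1 := hs T (ltW T0).
  have h2 : T <= s0 * expR (1 * (f 0 + fp T)).
    by apply: le_trans h1; rewrite le_max lexx.
  have h3 : s0 * expR (1 * (f 0 + fp T)) <= s0 * expR (f 0 + y).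
    by apply: ler_wpM2l; [lra|rewrite ler_expR; lra].
  by have := le_trans h2 h3; rewrite /T; lra.
have cc : {within `[0, T], continuous fp}.
  apply: continuous_subspaceW (proj2 f_C1) => x /=.
  by rewrite !in_itv /= => /andP[-> _].
have [|A hA fA] := IVT (ltW T0) cc (v := y).
  have h : fp 0 <= fp T by exact: le_trans fT.
  by rewrite (min_idPl h) (max_idPr h) fy fT.
by exists A; split => //; move: hA; rewrite in_itv /= => /andP[].
Qed.

End Growth.

(** * Integrals over the disk *)

Section LpBound.
Variable R : realType.
Notation mu2 := (@lebesgue_measure R \x @lebesgue_measure R)%E.

(** Squares replace disks because their product measure is immediate; having 4 in place of pi is
    harmless. *)
Definition square (r : R) : set (R * R) := `[- r, r] `*` `[- r, r].

Lemma measurable_square r : measurable (square r).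
Proof. by apply: measurableX; exact: measurable_itv. Qed.

Lemma measure_square r : 0 < r -> mu2 (square r) = (4 * r ^+ 2)%:E.
Proof.
move=> r0; pose I : set R := `[- r, r]%classic.
have E : lebesgue_measure I = (2 * r)%:E.
  rewrite lebesgue_measure_itv /= lte_fin ifT; last lra.
  by rewrite -EFinB; congr EFin; ring.
transitivity (lebesgue_measure I * lebesgue_measure I)%E.
  by apply: product_measure1E; exact: measurable_itv.
by rewrite E -EFinM; congr EFin; ring.
Qed.

Lemma enorm_square (x : R * R) r : enorm x <= r -> square r x.
Proof.
move=> h; have r0 : 0 <= r := le_trans (enorm_ge0 x) h.
have h2 : x.1 ^+ 2 + x.2 ^+ 2 <= r ^+ 2.
  by rewrite -enorm_sqr lerXn2r ?nnegrE ?enorm_ge0.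
have := sqr_ge0 x.1; have := sqr_ge0 x.2 => a1 a2.
by split; rewrite /= in_itv /= -ler_norml -ler_sqr ?nnegrE// real_normK ?num_real//; lra.
Qed.

Lemma integral_indic_square (a r : R) : 0 <= a -> 0 < r ->
  (\int[mu2]_x (a%:E * (\1_(square r) x)%:E) = (a * (4 * r ^+ 2))%:E)%E.
Proof.
move=> a0 r0; rewrite ge0_integralZl_EFin//.
- rewrite integral_indic//; last exact: measurable_square.
  by rewrite setIT EFinM; congr (_ * _)%E; exact: measure_square.
- by apply/measurable_EFinP; apply: measurable_indic; exact: measurable_square.
Qed.

(** [h] is dominated pointwise by a sum of indicators of three squares, which is measurable and
    whose integral is explicit. *)
Lemma integral_disk_le (h : R * R -> R) (a b d r1 r2 : R) :
  0 <= a -> 0 <= b -> 0 <= d -> 0 < r1 -> 0 < r2 ->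
  (forall x, disk x -> 0 <= h x) ->
  (forall x, disk x -> enorm x <= r1 -> h x <= a) ->
  (forall x, disk x -> r1 <= enorm x -> enorm x <= r2 -> h x <= b) ->
  (forall x, disk x -> r1 <= enorm x -> r2 <= enorm x -> h x <= d) ->
  (\int[mu2]_(x in @disk R) (h x)%:E <=
    (a * (4 * r1 ^+ 2) + b * (4 * r2 ^+ 2) + d * (4 * 1 ^+ 2))%:E)%E.
Proof.
move=> a0 b0 d0 r10 r20 h0 h1 h2 h3.
have mI (r : R) : measurable_fun setT (fun x : R * R => (\1_(square r) x : R)%:E).
  by apply/measurable_EFinP; apply: measurable_indic; exact: measurable_square.
have mZ (c r : R) : measurable_fun setT (fun x : R * R => (c%:E * (\1_(square r) x)%:E)%E).
  exact: measurable_funeM.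
have pos (c r : R) x : 0 <= c -> (0 <= c%:E * (\1_(square r) x : R)%:E)%E.
  by move=> c0; rewrite -EFinM lee_fin mulr_ge0.
have I0 (r : R) x : 0 <= (\1_(square r) x : R) by [].
apply: (@le_trans _ _ (\int[mu2]_x (a%:E * (\1_(square r1) x)%:E +
    b%:E * (\1_(square r2) x)%:E + d%:E * (\1_(square 1) x)%:E))%E); last first.
  rewrite ge0_integralD//.
  - rewrite ge0_integralD//.
    + by rewrite !integral_indic_square// -!EFinD.
    + by move=> x _; exact: pos.
    + exact: mZ.
    + by move=> x _; exact: pos.
    + exact: mZ.
  - by move=> x _; rewrite adde_ge0// pos.
  - by apply: emeasurable_funD; exact: mZ.
  - by move=> x _; exact: pos.
  - exact: mZ.
apply: ge0_le_integral_subset => //.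
- by move=> x _; rewrite !adde_ge0// pos.
- move=> x dx; rewrite -!EFinM -!EFinD lee_fin.
  have i1 (r : R) : enorm x <= r -> \1_(square r) x = 1 :> R.
    by move=> hx; rewrite indicE mem_set//; exact: enorm_square.
  have [e1|e1] := leP (enorm x) r1.
    rewrite (i1 r1 e1) mulr1; apply: (le_trans (h1 x dx e1)).
    by rewrite -addrA lerDl addr_ge0// mulr_ge0.
  have [e2|e2] := leP (enorm x) r2.
    rewrite (i1 r2 e2) mulr1; apply: (le_trans (h2 x dx (ltW e1) e2)).
    by rewrite addrAC lerDr addr_ge0// mulr_ge0.
  rewrite (i1 1 (ltW dx)) mulr1; apply: (le_trans (h3 x dx (ltW e1) (ltW e2))).
  by rewrite lerDr addr_ge0// mulr_ge0.
Qed.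

End LpBound.

Lemma sqrt_sqrt_expR (R : realType) (al : R) : 0 < al ->
  Num.sqrt (Num.sqrt al) = expR (ln al / 4).
Proof.
move=> al0; have E : al = (expR (ln al / 4) ^+ 2) ^+ 2.
  by rewrite -!expRM_natl -[LHS]lnK ?posrE//; congr expR; field.
rewrite {1}E sqrtr_sqr ger0_norm ?sqr_ge0// sqrtr_sqr ger0_norm//.
Qed.

(** * Estimates for the extremal solution *)

Section Assembly.
Variables (R : realType) (f phi psi : R -> R).
Hypothesis f_C1 : C1_0y f.
Hypothesis f_pos : forall t : R, 0 <= t -> 0 < f t.
Hypothesis f_nondecr : forall s t : R, 0 <= s -> s <= t -> f s <= f t.
Hypothesis f_convex : convex_function (`[0, +oo[%classic : set R^o) f.
Hypothesis f_int : (\int[lebesgue_measure]_(s in `[0%R, +oo[) ((f s)^-1)%:E < +oo)%E.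
Hypothesis phi_ge0 : forall r : R, 0 <= r <= 1 -> 0 <= phi r.
Hypothesis psi_ge0 : forall r : R, 0 <= r <= 1 -> 0 <= psi r.
Hypothesis phi_noninc : forall r s : R, 0 <= r -> r <= s -> s <= 1 -> phi s <= phi r.
Hypothesis psi_noninc : forall r s : R, 0 <= r -> r <= s -> s <= 1 -> psi s <= psi r.
Hypothesis phi_lip : [lipschitz phi r | r in `[0, 1]%classic].
Hypothesis psi_lip : [lipschitz psi r | r in `[0, 1]%classic].
Hypothesis phi0 : phi 0 = 1.
Hypothesis psi0 : psi 0 = 1.
Hypothesis phi_pos : forall r : R, 0 <= r < 1 -> 0 < phi r.
Hypothesis M_int : (\int[lebesgue_measure]_(s in `[0%R, 1%R[) (Mratio phi psi s)%:E < +oo)%E.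

Notation ph := (phi \o @clamp R).
Notation ps := (psi \o @clamp R).
Notation F := (fext f).
Notation Fi := (prim (fun u => (fext f u)^-1)).
Notation fp := (deriv0y f).
Notation K := (Ktot f).

(** For [lam > 0] this amounts to solvability: a classical solution bounds the iterates, and bounded
    iterates converge to one. *)
Definition bounded_iterates al lam : Prop := exists B, forall n, Viter al ph ps F lam n 0 <= B.

Let cph : continuous ph. Proof. exact: continuous_lipschitz_clamp. Qed.
Let cps : continuous ps. Proof. exact: continuous_lipschitz_clamp. Qed.
Let cF : continuous F. Proof. exact: continuous_fext. Qed.
Let F0 u : 0 < F u. Proof. exact: fext_gt0. Qed.
Let F_nondecr u v : u <= v -> F u <= F v. Proof. exact: fext_nondecr. Qed.
Let ph01 s : 0 <= s <= 1 -> 0 <= ph s <= 1.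
Proof. by move=> s01; apply: (@ps_itv R phi). Qed.
Let ps01 s : 0 <= s <= 1 -> 0 <= ps s <= 1.
Proof. by move=> s01; apply: (@ps_itv R psi). Qed.
Let ph0 s : 0 <= s <= 1 -> 0 <= ph s. Proof. by move=> /ph01/andP[]. Qed.
Let noninc_clamp (h : R -> R) :
  (forall r s : R, 0 <= r -> r <= s -> s <= 1 -> h s <= h r) ->
  forall r s : R, 0 <= r -> r <= s -> s <= 1 -> (h \o @clamp R) s <= (h \o @clamp R) r.
Proof. by move=> hn r s r0 rs s1; rewrite /= !clamp_id ?r0 ?(le_trans rs) ?(le_trans r0)//; exact: hn. Qed.

Section FixedAlpha.
Variable al : R.
Hypothesis al0 : 0 < al.
Notation Viter := (Viter al ph ps F).
Notation Vsol := (Vsol al ph ps F).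

Lemma Vsol_nonincr lam r s : 0 < lam -> bounded_iterates al lam ->
  0 <= r -> r <= s -> s <= 1 -> Vsol lam s <= Vsol lam r.
Proof.
move=> l0 [B VB] r0; rewrite le_eqVlt => /orP[/eqP <-//|rs] s1.
by apply: ltW; apply: (@Vsol_decr R f phi psi al) VB _ _ r0 rs s1.
Qed.

(** All that is used of the extremal solution. The third clause transfers estimates: the minimal
    solution lies below the lift of [Vsol], and a bound valid just below the extremal value survives
    the limit from the left. *)
Lemma extremal_bounds u : extremal_solution f phi psi al u ->
  exists lams, [/\ forall lam, 0 < lam -> bounded_iterates al lam -> lam <= lams,
    forall lam, 0 < lam -> lam < lams -> bounded_iterates al lam,
    forall lam1 x C, lam1 < lams -> disk x ->
      (forall lam, 0 < lam -> lam1 < lam -> lam < lams -> Vsol lam (enorm x) <= C) -> u x <= C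
    & forall x, disk x -> 0 <= u x].
Proof.
move=> [lams [umin [[ls0 ex nex] hmin hlim]]].
have bd lam : 0 < lam -> lam < lams -> bounded_iterates al lam.
  move=> l0 l1; have [cu _] := hmin lam ltac:(by rewrite l0 l1).
  exists (umin lam (0, 0)) => n.
  by apply: (@Viter0_le_classical R f phi psi al) cu => //; exact: ltW.
exists lams; split => //.
- move=> lam l0 [B VB]; rewrite leNgt; apply/negP => /nex; apply.
  by eexists; apply: (@classical_Vsol R f phi psi al) VB.
- move=> lam1 x C l1 dx hC; rewrite leNgt; apply/negP => h.
  have n1 : \forall lam \near lams^'-, C < umin lam x.
    by have /cvgr_gt := hlim x dx; apply.
  have n2 : \forall lam \near lams^'-, Num.max 0 lam1 < lam /\ lam < lams.
    near=> lam; split; near: lam.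
      by apply: nbhs_left_gt; rewrite gt_max ls0.
    exact: nbhs_left_lt.
  have n3 : \forall lam \near lams^'-,
      C < umin lam x /\ (Num.max 0 lam1 < lam /\ lam < lams) by apply: filterS2 n1 n2.
  have [lam [hl1 [hl2 hl3]]] := @filter_ex _ _ (at_left_proper_filter lams) _ n3.
  move: hl2; rewrite gt_max => /andP[l0 ll].
  have [B VB] := bd lam l0 hl3.
  have [_ hm] := hmin lam ltac:(by rewrite l0 hl3).
  have cV : classical_solution f phi psi lam al (radial al ph (source ps F lam (Vsol lam))).
    by apply: (@classical_Vsol R f phi psi al) VB.
  have := hm _ cV x dx.
  rewrite radialE -(@Vsol_rsol R f phi psi al _ _ _ _ _ _ _ _ _ _ lam B)//.
    move=> h2; have := le_trans h2 (hC lam l0 ll hl3).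
    by rewrite leNgt hl1.
  by rewrite enorm_ge0; exact: ltW dx.
- move=> x dx; rewrite leNgt; apply/negP => h.
  have n1 : \forall lam \near lams^'-, umin lam x < 0.
    by have /cvgr_lt := hlim x dx; apply.
  have n2 : \forall lam \near lams^'-, 0 < lam /\ lam < lams.
    near=> lam; split; near: lam.
      exact: nbhs_left_gt.
    exact: nbhs_left_lt.
  have n3 : \forall lam \near lams^'-,
      umin lam x < 0 /\ (0 < lam /\ lam < lams) by apply: filterS2 n1 n2.
  have [lam [hl1 [hl2 hl3]]] := @filter_ex _ _ (at_left_proper_filter lams) _ n3.
  have [[_ _ up _] _] := hmin lam ltac:(by rewrite hl2 hl3).
  by have := up x dx; rewrite ltNge ltW.
Unshelve. all: by end_near. Qed.

(** Two parameters enter because [Z] is the difference of the two solutions; [lam < lam'] and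
    [psi 0 = 1] make its source positive at the origin. *)
Lemma Vsol_stable L lam lam' rho : 0 < L ->
  (forall r s, 0 <= r <= 1 -> 0 <= s <= 1 -> `|psi r - psi s| <= L * `|r - s|) ->
  0 < lam -> lam < lam' -> bounded_iterates al lam -> bounded_iterates al lam' ->
  0 < rho -> 2 * rho < 1 -> al * (2 * rho) ^+ 2 <= 1 -> 2^-1 <= ps rho -> 32 * L * rho <= 1 ->
  lam * fp (Vsol lam rho) * rho ^+ 2 <= 16 /\ Vsol lam 0 <= 194 * Vsol lam rho.
Proof.
move=> L0 psL l0 ll [B VB] [B' VB'] r0 r1 alr psr Lr.
have l0' : 0 < lam' by exact: lt_trans ll.
pose g := source ps F lam (Vsol lam); pose g' := source ps F lam' (Vsol lam').
have VE s : 0 <= s <= 1 -> Vsol lam s = rsol al ph g s.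
  by move=> hs; apply: (@Vsol_rsol R f phi psi al) VB _ hs.
have VE' s : 0 <= s <= 1 -> Vsol lam' s = rsol al ph g' s.
  by move=> hs; apply: (@Vsol_rsol R f phi psi al) VB' _ hs.
have VV s : 0 <= s <= 1 -> Vsol lam s <= Vsol lam' s.
  move=> hs; apply: (Vsol_le (ltW al0) cph ph0 cps ps01 cF F0 (ltW l0) VB hs).
  move=> n; apply: (@le_trans _ _ (Viter lam' n s)).
    by apply: Viter_lam; try by [|exact: ltW].
  exact: (Vsol_ge (ltW al0) cph ph0 cps ps01 cF F0 (ltW l0') VB').
have cg : continuous g by apply: (@continuous_gsol R f phi psi al) VB.
have cg' : continuous g' by apply: (@continuous_gsol R f phi psi al) VB'.
have gE s : 0 <= s <= 1 -> g s = lam * ps s * F (rsol al ph g s).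
  by move=> hs; rewrite -VE// /g /source clamp_id.
have gE' s : 0 <= s <= 1 -> g' s = lam' * ps s * F (rsol al ph g' s).
  by move=> hs; rewrite -VE'// /g' /source clamp_id.
have h01 : 0 <= (0 : R) <= 1 by rewrite lexx ler01.
have hr : 0 <= rho <= 1 by lra.
have ps_lip r s : 0 <= r -> r <= s -> s <= 1 -> ps r - L * (s - r) <= ps s.
  move=> rr rs s1; have hr1 : 0 <= r <= 1 by lra.
  have hs1 : 0 <= s <= 1 by lra.
  have := psL r s hr1 hs1; rewrite /= !clamp_id// distrC (distrC r) (ger0_norm (_ : 0 <= s - r)) ?subr_ge0//.
  by rewrite ler_norml; lra.
have gg s : 0 <= s <= 1 -> lam * ps s * (F (rsol al ph g' s) - F (rsol al ph g s)) <= g' s - g s.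
  move=> hs; rewrite gE// gE'// mulrBr lerB//; apply: ler_wpM2r; first exact: ltW.
  by apply: ler_wpM2r; [case/andP: (ps01 hs)|exact: ltW].
have gg0 : 0 < g' 0 - g 0.
  rewrite subr_gt0 gE// gE'//= clamp_id// psi0 !mulr1.
  apply: (@lt_le_trans _ _ (lam' * F (rsol al ph g 0))); first by rewrite ltr_pM2r.
  by apply: ler_wpM2l; [exact: ltW|apply: F_nondecr; rewrite -VE// -VE'//; exact: VV].
have W0 s : 0 <= s -> s < 1 -> 0 < rsol al ph g s.
  move=> s0 s1; rewrite -VE; last by rewrite s0 ltW.
  by apply: (@Vsol_gt0 R f phi psi al) VB _ s0 s1.
have Wd r s : 0 <= r -> r <= s -> s <= 1 -> rsol al ph g s <= rsol al ph g r.
  move=> rr rs s1; rewrite -!VE ?rr ?s1 ?(le_trans rs) ?(le_trans rr)//.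
  by apply: Vsol_nonincr => //; exists B.
have g_ge0 s : 0 <= s <= 1 -> 0 <= g s.
  by move=> hs; apply: (@gsol_ge0 R f phi psi).
have ZZ s : 0 <= s <= 1 -> rsol al ph g s <= rsol al ph g' s.
  by move=> hs; rewrite -VE// -VE'//; exact: VV.
have dF (u : R) : 0 < u -> is_derive u 1 F (fp u) by move=> u0; exact: is_derive_fext.
have Ft u v : 0 <= u -> 0 <= v -> fp u * (v - u) <= F v - F u.
  by move=> u0 v0; exact: fext_tangent.
have fpm u v : 0 <= u -> u <= v -> fp u <= fp v by move=> u0 uv; exact: fp_nondecr.
have fp0 u : 0 <= u -> 0 <= fp u by move=> u0; exact: fp_ge0.
rewrite !VE//; split.
- by apply: (@stable_bound R al lam ph ps F fp g g') => //; exact: noninc_clamp.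
- apply: (@stable_sup_bound R al lam L ph ps F fp g g') => //; try exact: noninc_clamp.
  exact: ltW.
Qed.

Lemma Vsol_outer lam theta b r : 0 < lam -> bounded_iterates al lam ->
  0 < b -> b <= r -> r <= 1 -> 0 <= theta ->
  (forall s, b < s -> s < r -> theta <= ps s * (1 - (wt al ph s)^-1)) ->
  Fi (Vsol lam r) + lam / al * theta * (ln r - ln b) <= K.
Proof.
move=> l0 [B VB] b0 br r1 t0 hth.
pose g := source ps F lam (Vsol lam).
have VE s : 0 <= s <= 1 -> Vsol lam s = rsol al ph g s.
  by move=> hs; apply: (@Vsol_rsol R f phi psi al) VB _ hs.
have cg : continuous g by apply: (@continuous_gsol R f phi psi al) VB.
have gE s : 0 <= s <= 1 -> g s = lam * ps s * F (rsol al ph g s).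
  by move=> hs; rewrite -VE// /g /source clamp_id.
have V0 s : 0 <= s <= 1 -> 0 <= Vsol lam s.
  by move=> hs; exact: (Vsol_ge0 (ltW al0) cph ph0 cps ps01 cF F0 (ltW l0) VB hs).
have hb : 0 <= b <= 1 by rewrite (ltW b0) (le_trans br).
have hr : 0 <= r <= 1 by rewrite r1 (le_trans (ltW b0)).
apply: (@le_trans _ _ (Fi (Vsol lam b))); last by apply: Fi_le_Ktot => //; exact: V0.
rewrite !VE//.
apply: (@outer_decay R al lam ph ps F g) => //.
- by move=> s /ps01/andP[].
- exact: noninc_clamp.
- by move=> s hs; rewrite -VE//; exact: V0.
- move=> r' s rr rs s1; rewrite -!VE ?rr ?s1 ?(le_trans rs) ?(le_trans rr)//.
  by apply: Vsol_nonincr => //; exists B.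
Qed.

End FixedAlpha.

Variable ustar : R -> R * R -> R.
Hypothesis ustarP : forall al : R, 0 < al -> extremal_solution f phi psi al (ustar al).
Notation Vs := (fun al => Vsol al ph ps F).

Let K0 : 0 < K. Proof. exact: Ktot_gt0. Qed.

Lemma ustar_ge0 al x : 0 < al -> disk x -> 0 <= ustar al x.
Proof. by move=> al0 dx; have [lams [_ _ _ h]] := extremal_bounds al0 (ustarP al0); exact: h. Qed.

(** The gap between [kappa] and [kappa'] puts [kappa al / ln al] strictly below the extremal value.
    Only [lam] in between have to be considered, and the midpoint between [lam] and the extremal
    value supplies the larger parameter [lam']. *)
Lemma near_extremal kappa kappa' : 0 < kappa -> kappa < kappa' -> kappa' / 2 < K ->
  \forall al \near +oo, forall x C, disk x ->
    (forall lam lam', 0 < lam -> kappa * al / ln al < lam -> lam < lam' ->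
       bounded_iterates al lam -> bounded_iterates al lam' -> Vs al lam (enorm x) <= C) ->
    ustar al x <= C.
Proof.
move=> k0 kk kK.
have [U0 U00 hU] := Ktot_approx f_C1 f_pos f_nondecr f_int kK.
have k0' : 0 < kappa' by exact: lt_trans kk.
have VB := Viter_bounded f_C1 f_pos f_nondecr f_convex phi_ge0 psi_ge0 phi_noninc
  psi_noninc phi_lip psi_lip phi0 psi0 phi_pos M_int k0' U00 hU.
near=> al => x C dx h.
have al0 : 0 < al by near: al; exact: nbhs_pinfty_gt.
have l0 : 0 < ln al by near: al; exact: near_ln_gt.
have hB : forall n, Viter al ph ps F (kappa' * al / ln al) n 0 <= U0 by near: al.
have [lams [h1 h2 h3 _]] := extremal_bounds al0 (ustarP al0).
have l1 : kappa * al / ln al < lams.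
  apply: (@lt_le_trans _ _ (kappa' * al / ln al)); first by rewrite !ltr_pM2r// invr_gt0.
  by apply: h1; [rewrite divr_gt0// mulr_gt0|exists U0].
apply: (h3 _ x C l1 dx) => lam p0 p1 p2.
have q1 : lam < (lam + lams) / 2 by lra.
have q2 : (lam + lams) / 2 < lams by lra.
apply: (h lam ((lam + lams) / 2)) => //; first exact: h2.
by apply: h2 => //; exact: lt_trans q1.
Unshelve. all: by end_near. Qed.

Lemma sup_bound : exists c : R, 0 < c /\ \forall al \near +oo,
  (exists A : R, 0 <= A /\ fp A = c * ln al) /\
  (forall A : R, 0 <= A -> fp A = c * ln al -> forall x, disk x -> ustar al x <= c * A).
Proof.
have K0' := K0.
(* From [lam fp (V rho) rho^2 <= 16], [rho^2 = 1 / (4 al)] and [lam > K al / (2 ln al)] it follows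
   that [fp (V rho) <= C1 ln al]. *)
pose C1 := 64 / (K / 2).
have C10 : 0 < C1 by rewrite divr_gt0// divr_gt0.
(* One constant plays both roles: being larger than [C1] it forces [V rho <= A], and it dominates
   the factor 194 between [V 0] and [V rho]. *)
pose c := C1 + 194.
have c0 : 0 < c by rewrite /c; lra.
have [L L0 hL] := lipschitz_const psi_lip.
have [d /= d0 hd] : \forall s \near (0 : R), 2^-1 < ps s.
  have /cvgr_gt : {for (0 : R), continuous ps} by exact: cps.
  by apply; rewrite /= clamp_id ?psi0 ?lexx ?ler01//; lra.
have ne : \forall al \near +oo, forall x C, disk x ->
    (forall lam lam', 0 < lam -> K / 2 * al / ln al < lam -> lam < lam' ->
       bounded_iterates al lam -> bounded_iterates al lam' -> Vs al lam (enorm x) <= C) ->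
    ustar al x <= C.
  by apply: (@near_extremal (K / 2) K); lra.
exists c; split => //.
near=> al.
have al1 : 1 < al by near: al; apply: nbhs_pinfty_gt; exact: num_real.
have al0 : 0 < al by lra.
have l0 : 0 < ln al by near: al; exact: near_ln_gt.
split.
  apply: (fp_onto f_C1 f_pos f_nondecr f_convex f_int).
  have : fp 0 / c < ln al by near: al; exact: near_ln_gt.
  by rewrite ltr_pdivrMr// mulrC => /ltW.
move=> A A0 fA x dx.
have ex : forall x C, disk x ->
    (forall lam lam', 0 < lam -> K / 2 * al / ln al < lam -> lam < lam' ->
       bounded_iterates al lam -> bounded_iterates al lam' -> Vs al lam (enorm x) <= C) ->
    ustar al x <= C by near: al.
apply: ex => // lam lam' p0 p1 p2 b1 b2.
(* The largest radius with [al * (2 * rho)^2 <= 1]. *)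
pose rho := (2 * Num.sqrt al)^-1.
have sq0 : 0 < Num.sqrt al by rewrite sqrtr_gt0.
have sqE : Num.sqrt al ^+ 2 = al by rewrite sqr_sqrtr// ltW.
have rho0 : 0 < rho by rewrite invr_gt0 mulr_gt0.
have rhoE : rho ^+ 2 = (4 * al)^-1 by rewrite /rho exprVn exprMn sqE; congr (_ * _)^-1; ring.
have rho_lt t : 0 < t -> t^-1 ^+ 2 < al -> rho < t.
  move=> t0 ht; rewrite /rho invf_plt ?posrE ?mulr_gt0//.
  have : t^-1 < Num.sqrt al.
    by rewrite -(ltr_pXn2r (n := 2)) ?nnegrE ?invr_ge0 ?(ltW t0) ?(ltW sq0)// sqE.
  by have := sq0; lra_after K0'.
have r1 : rho < 2^-1.
  by apply: rho_lt; [lra|near: al; apply: nbhs_pinfty_gt; exact: num_real].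
have rd : rho < d.
  by apply: rho_lt; [lra|near: al; apply: nbhs_pinfty_gt; exact: num_real].
have rL : rho < (32 * L)^-1.
  apply: rho_lt; first by rewrite invr_gt0 mulr_gt0.
  near: al; apply: nbhs_pinfty_gt; exact: num_real.
have [s1 s2] : lam * fp (Vs al lam rho) * rho ^+ 2 <= 16 /\ Vs al lam 0 <= 194 * Vs al lam rho.
  apply: (@Vsol_stable al al0 L lam lam' rho) => //.
  - lra.
  - have -> : al * (2 * rho) ^+ 2 = 1 by rewrite exprMn rhoE; field; rewrite gt_eqF.
    exact: lexx.
  - by apply: ltW; apply: hd; rewrite /= sub0r normrN gtr0_norm.
  - by move: rL; rewrite -[_^-1]mul1r ltr_pdivlMr ?mulr_gt0// mulrC => /ltW.
have hr : 0 <= rho <= 1 by move: rho0 r1; lra_after K0'.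
have VA : Vs al lam rho <= A.
  rewrite leNgt; apply/negP => h.
  have f1 : fp A <= fp (Vs al lam rho) by apply: fp_nondecr => //; exact: ltW.
  have f2 : c * ln al <= fp (Vs al lam rho) by rewrite -fA.
  have f3 : lam * fp (Vs al lam rho) <= 64 * al.
    by move: s1; rewrite rhoE ler_pdivrMr ?mulr_gt0//; lra_after K0'.
  have f4 : K / 2 * al * (c * ln al) <= 64 * al * ln al.
    have h1 : K / 2 * al < lam * ln al by move: p1; rewrite ltr_pdivrMr.
    apply: (@le_trans _ _ (lam * ln al * (c * ln al))).
      by apply: ler_wpM2r; [rewrite mulr_ge0 ?(ltW c0) ?(ltW l0)|exact: ltW].
    have -> : lam * ln al * (c * ln al) = (lam * (c * ln al)) * ln al by ring.
    apply: ler_wpM2r; first exact: ltW.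
    by apply: le_trans f3; apply: ler_wpM2l => //; exact: ltW.
  have f5 : (al * ln al) * (K / 2 * c) <= (al * ln al) * 64 by move: f4; lra_after K0'.
  rewrite ler_pM2l ?mulr_gt0// in f5.
  have f6 : K / 2 * c = 64 + K / 2 * 194 by rewrite /c /C1; field; rewrite gt_eqF.
  by have := K0'; move: f5; rewrite f6; lra_after K0'.
have h0 : 0 <= (0 : R) by [].
apply: (@le_trans _ _ (Vs al lam 0)).
  by apply: Vsol_nonincr => //; [exact: enorm_ge0|exact: ltW dx].
apply: le_trans s2 _; apply: (@le_trans _ _ (194 * A)); first by apply: ler_wpM2l.
by apply: ler_wpM2r => //; rewrite /c; lra.
Unshelve. all: by end_near. Qed.

(** [K] is the total budget of [Fi]. One factor [1 - tau] is lost in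
    [lam > 2 K (1 - tau) al / ln al], the other in [psi (1 - 1/w)], which is close to 1 between
    [B al^(-1/2)] and [s1]. *)
Lemma outer_near (tau : R) : 0 < tau -> tau < 1 -> exists s1 B : R,
  [/\ 0 < s1, s1 < 1, 0 < B & \forall al \near +oo, forall r C x,
    B / Num.sqrt al <= r -> r <= s1 -> 0 <= C -> disk x -> r <= enorm x ->
    K <= Fi C + 2 * K * (1 - tau) ^+ 2 / ln al * (ln r - ln B + ln al / 2) ->
    ustar al x <= C].
Proof.
move=> t0 t1; have K0' := K0.
have [s1 [s10 s11 hs1]] : exists s1 : R, [/\ 0 < s1, s1 < 1 & forall s, 0 <= s <= s1 ->
    1 - tau / 2 <= ps s /\ 2^-1 <= ph s].
  have c1 : \forall s \near (0 : R), 1 - tau / 2 < ps s.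
    have /cvgr_gt : {for (0 : R), continuous ps} by exact: cps.
    by apply; rewrite /= clamp_id ?psi0 ?lexx ?ler01//; lra.
  have c2 : \forall s \near (0 : R), 2^-1 < ph s.
    have /cvgr_gt : {for (0 : R), continuous ph} by exact: cph.
    by apply; rewrite /= clamp_id ?phi0 ?lexx ?ler01//; lra.
  have [d /= d0 hd] : \forall s \near (0 : R), 1 - tau / 2 < ps s /\ 2^-1 < ph s.
    by apply: filterS2 c1 c2.
  exists (Num.min (2^-1) (d / 2)); split.
  - by rewrite lt_min invr_gt0 ltr0n divr_gt0.
  - by rewrite gt_min; apply/orP; left; lra.
  - move=> s /andP[sp]; rewrite le_min => /andP[sh sd].
    have [] := hd s; first by rewrite /= sub0r normrN ger0_norm//; lra.
    by move=> a b; split; exact: ltW.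
(* For [B al^(-1/2) <= s <= s1] this gives [w s >= exp (al s^2 / 4) >= B^2 / 4 >= 2 / tau]. *)
pose B := 8 / tau.
have B0 : 0 < B by rewrite divr_gt0.
exists s1, B; split => //.
have ne : \forall al \near +oo, forall x C, disk x ->
    (forall lam lam', 0 < lam -> 2 * K * (1 - tau) * al / ln al < lam -> lam < lam' ->
       bounded_iterates al lam -> bounded_iterates al lam' -> Vs al lam (enorm x) <= C) ->
    ustar al x <= C.
  have p1 : 0 < K * tau by rewrite mulr_gt0.
  have p2 : 0 < K * (1 - tau) by rewrite mulr_gt0// subr_gt0.
  by apply: (@near_extremal (2 * K * (1 - tau)) (2 * K * (1 - tau / 2))); lra.
near=> al => r C x Br rs C0 dx rx hK.
have al0 : 0 < al by near: al; exact: nbhs_pinfty_gt.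
have l0 : 0 < ln al by near: al; exact: near_ln_gt.
have ex : forall x C, disk x ->
    (forall lam lam', 0 < lam -> 2 * K * (1 - tau) * al / ln al < lam -> lam < lam' ->
       bounded_iterates al lam -> bounded_iterates al lam' -> Vs al lam (enorm x) <= C) ->
    ustar al x <= C by near: al.
apply: ex => // lam lam' p0 p1 p2 b1 b2.
have sq0 : 0 < Num.sqrt al by rewrite sqrtr_gt0.
have sqE : Num.sqrt al ^+ 2 = al by rewrite sqr_sqrtr// ltW.
pose b := B / Num.sqrt al.
have b0 : 0 < b by rewrite divr_gt0.
have r0 : 0 < r by exact: lt_le_trans Br.
have lnb : ln b = ln B - ln al / 2.
  rewrite /b ln_div ?posrE//; congr (_ - _).
  by have : ln (Num.sqrt al ^+ 2) = ln al by [rewrite sqE]; rewrite lnXn// mulr2n; lra_after t0.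
apply: (@le_trans _ _ (Vs al lam r)).
  by apply: Vsol_nonincr => //; [exact: ltW|exact: ltW dx].
have h : Fi (Vs al lam r) + lam / al * (1 - tau) * (ln r - ln b) <= K.
  apply: (Vsol_outer al0 p0 b1 b0 Br _ _ _); [exact: le_trans rs (ltW s11)|by rewrite subr_ge0 ltW|].
  move=> s bs sr; have sp : 0 < s by exact: lt_trans bs.
  have ss : 0 <= s <= s1 by rewrite (ltW sp) (ltW (lt_le_trans sr rs)).
  have [q1 q2] := hs1 s ss.
  have s01 : s <= 1 by move: ss s11; lra_after t0.
  have ws : 2 / tau <= wt al ph s.
    apply: (@le_trans _ _ (expR (al * (2^-1 * (s ^+ 2 / 2))))); last first.
      apply: wt_ge_expR => //; [lra|].
      by move=> t tp ts; have [] := hs1 t ltac:(lra).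
    apply: le_trans (expR_ge1Dx _).
    have h1 : b ^+ 2 <= s ^+ 2 by rewrite lerXn2r ?nnegrE ?(ltW b0) ?(ltW bs)// ltW.
    have h2 : al * b ^+ 2 = B ^+ 2 by rewrite /b expr_div_n sqE; field; rewrite gt_eqF.
    have h3 : al * b ^+ 2 <= al * s ^+ 2 by apply: ler_wpM2l => //; exact: ltW.
    have h4 : 2 / tau <= B ^+ 2 / 4.
      have -> : B ^+ 2 / 4 = (8 / tau) * (2 / tau) by rewrite /B; field; rewrite gt_eqF.
      rewrite ler_peMl//; first by rewrite divr_ge0// ltW.
      by rewrite ler_pdivlMr//; move: t1; lra_after t0.
    by move: h2 h3 h4; lra_after t0.
  have w0 : 0 < wt al ph s by exact: wt_gt0.
  have wi : (wt al ph s)^-1 <= tau / 2.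
    rewrite -[leRHS]invrK lef_pV2 ?posrE ?invr_gt0 ?divr_gt0//.
    by apply: le_trans ws; rewrite invf_div.
  have : (1 - tau / 2) * (1 - tau / 2) <= ps s * (1 - (wt al ph s)^-1).
    by apply: ler_pM => //; have := t0; move: t1 wi q1; lra_after t0.
  by apply: le_trans; have := sqr_ge0 tau; lra_after t0.
apply: (Fi_le_inv f_C1 f_pos f_nondecr) => //.
have lnrb : 0 <= ln r - ln b by rewrite subr_ge0 ler_ln ?posrE.
have h2 : 2 * K * (1 - tau) / ln al * (1 - tau) * (ln r - ln b) <= lam / al * (1 - tau) * (ln r - ln b).
  apply: ler_wpM2r => //; apply: ler_wpM2r; first by rewrite subr_ge0 ltW.
  by rewrite ler_pdivlMr//; apply: ltW; rewrite mulrAC.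
move: hK; have -> : 2 * K * (1 - tau) ^+ 2 / ln al * (ln r - ln B + ln al / 2) =
  2 * K * (1 - tau) / ln al * (1 - tau) * (ln r - ln b) by rewrite lnb; field; rewrite gt_eqF.
lra.
Unshelve. all: by end_near. Qed.

Lemma middle_bound : exists2 C0 : R, 0 <= C0 & \forall al \near +oo, forall x, disk x ->
  (Num.sqrt (Num.sqrt al))^-1 <= enorm x -> ustar al x <= C0.
Proof.
have K0' := K0.
(* With [tau = 1/4], the fraction [9/32] of [K] is spent between [al^(-1/2)] and [al^(-1/4)]; as
   [3/4 + 9/32 = 1 + 1/32], the share [1/32] is left for the term in [ln B]. *)
have [C0 C00 hC0] : exists2 u, 0 < u & 3 / 4 * K < Fi u.
  by apply: (Ktot_approx f_C1 f_pos f_nondecr f_int); lra.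
exists C0; first exact: ltW.
have t0 : 0 < (4^-1 : R) by lra.
have t1 : (4^-1 : R) < 1 by lra.
have [s1 [B [s10 s11 B0 on]]] := outer_near t0 t1.
near=> al => x dx hx.
have al1 : 1 < al by near: al; apply: nbhs_pinfty_gt; exact: num_real.
have al0 : 0 < al by lra.
have l0 : 0 < ln al by near: al; exact: near_ln_gt.
pose q := Num.sqrt (Num.sqrt al).
have q0 : 0 < q by rewrite !sqrtr_gt0.
have qE : q ^+ 2 = Num.sqrt al by rewrite sqr_sqrtr// sqrtr_ge0.
have qE4 : q ^+ 4 = al by rewrite (exprM q 2 2) qE sqr_sqrtr// ltW.
have q_gt t : 0 < t -> t ^+ 4 < al -> t < q.
  by move=> tp; rewrite -qE4 ltr_pXn2r ?nnegrE ?(ltW tp) ?(ltW q0).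
have qB : B < q by apply: q_gt => //; near: al; apply: nbhs_pinfty_gt; exact: num_real.
have qs : s1^-1 < q.
  apply: q_gt; first by rewrite invr_gt0.
  by near: al; apply: nbhs_pinfty_gt; exact: num_real.
have lnq : ln q = ln al / 4.
  by have : ln (q ^+ 4) = ln al by [rewrite qE4]; rewrite lnXn//; lra.
have on' : forall r C x,
    B / Num.sqrt al <= r -> r <= s1 -> 0 <= C -> disk x -> r <= enorm x ->
    K <= Fi C + 2 * K * (1 - 4^-1) ^+ 2 / ln al * (ln r - ln B + ln al / 2) ->
    ustar al x <= C by near: al.
apply: (on' q^-1 C0 x) => //.
- rewrite -qE ler_pdivrMr ?exprn_gt0// expr2 mulrA mulVf ?gt_eqF// mul1r; exact: ltW.
- by rewrite -[leRHS]invrK lef_pV2 ?posrE ?invr_gt0// ltW.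
- exact: ltW.
- have lB : 36 * ln B < ln al by near: al; exact: near_ln_gt.
  rewrite lnV ?posrE// lnq.
  have -> : 2 * K * (1 - 4^-1) ^+ 2 / ln al * (- (ln al / 4) - ln B + ln al / 2) =
    9 / 32 * K - 9 / 8 * (K * (ln B / ln al)) by field; rewrite gt_eqF.
  have h : K * (ln B / ln al) <= K * 36^-1.
    by apply: ler_wpM2l; [exact: ltW|rewrite ler_pdivrMr//; lra].
  lra.
Unshelve. all: by end_near. Qed.

(** Up to a fixed radius the term [ln al / 2] uses up [K (1 - tau)^2], nearly the whole budget, so
    that less than [Fi delta] remains. *)
Lemma small_bound (delta : R) : 0 < delta -> delta < 1 -> \forall al \near +oo, forall x, disk x ->
  delta <= enorm x -> ustar al x <= delta.
Proof.
move=> d0 d1; have K0' := K0.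
have Fd : 0 < Fi delta by exact: Fi_gt0.
(* The loss [2 K tau] is then at most [Fi delta / 4]; a further [Fi delta / 2] covers the logarithms
   of the fixed radii. *)
pose tau := Num.min (4^-1) (Fi delta / (8 * K)).
have t0 : 0 < tau by rewrite lt_min invr_gt0 ltr0n divr_gt0// mulr_gt0.
have t1 : tau <= 4^-1 by rewrite ge_min lexx.
have t2 : K * tau <= Fi delta / 8.
  have : tau <= Fi delta / (8 * K) by rewrite ge_min lexx orbT.
  by rewrite ler_pdivlMr ?mulr_gt0//; lra.
have t11 : tau < 1 by lra.
have [s1 [B [s10 s11 B0 on]]] := outer_near t0 t11.
pose r := Num.min delta s1.
have r0 : 0 < r by rewrite lt_min d0 s10.
have rd : r <= delta by rewrite ge_min lexx.
have rs : r <= s1 by rewrite ge_min lexx orbT.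
near=> al => x dx hx.
have al0 : 0 < al by near: al; exact: nbhs_pinfty_gt.
have l0 : 0 < ln al by near: al; exact: near_ln_gt.
have sq0 : 0 < Num.sqrt al by rewrite sqrtr_gt0.
have sqE : Num.sqrt al ^+ 2 = al by rewrite sqr_sqrtr// ltW.
have on' : forall r C x,
    B / Num.sqrt al <= r -> r <= s1 -> 0 <= C -> disk x -> r <= enorm x ->
    K <= Fi C + 2 * K * (1 - tau) ^+ 2 / ln al * (ln r - ln B + ln al / 2) ->
    ustar al x <= C by near: al.
apply: (on' r delta x) => //.
- rewrite ler_pdivrMr// mulrC -ler_pdivrMr//; apply: ltW.
  rewrite -(ltr_pXn2r (n := 2)) ?nnegrE ?(ltW sq0) ?divr_ge0 ?(ltW r0) ?(ltW B0)// sqE.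
  by near: al; apply: nbhs_pinfty_gt; exact: num_real.
- exact: ltW.
- exact: le_trans hx.
- have lB : 2 * K * `|ln r - ln B| / (Fi delta / 2) < ln al by near: al; exact: near_ln_gt.
  rewrite ltr_pdivrMr ?divr_gt0// in lB.
  pose D := ln r - ln B.
  have E : 2 * K * (1 - tau) ^+ 2 / ln al * (D + ln al / 2) =
    K * (1 - tau) ^+ 2 + (1 - tau) ^+ 2 * (2 * K * D / ln al) by field; rewrite gt_eqF.
  rewrite -/D E.
  have h1 : - (Fi delta / 2) <= 2 * K * D / ln al.
    rewrite ler_pdivlMr//.
    have : - `|D| <= D by rewrite lerNl -normrN ler_norm.
    move=> /(ler_wpM2l (_ : 0 <= 2 * K)) h; have := h ltac:(have := K0'; lra_after d0).
    by move: lB; rewrite -/D; lra_after d0.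
  have sq1 : (1 - tau) ^+ 2 <= 1 by rewrite expr_le1//; have := d0; move: t0 t1; lra_after d0.
  have h2 : - (Fi delta / 2) <= (1 - tau) ^+ 2 * (2 * K * D / ln al).
    apply: (@le_trans _ _ ((1 - tau) ^+ 2 * - (Fi delta / 2))).
      rewrite mulrN lerN2 ler_piMl// divr_ge0// ltW//.
    by apply: ler_wpM2l => //; exact: sqr_ge0.
  have h3 : K - 2 * (K * tau) <= K * (1 - tau) ^+ 2.
    have : 0 <= K * tau ^+ 2 by rewrite mulr_ge0 ?sqr_ge0// ltW.
    by lra_after d0.
  by move: h2 h3 t2 Fd; lra_after d0.
Unshelve. all: by end_near. Qed.

Lemma sup_power_bound (p : R) : 1 <= p -> exists2 D, 0 <= D &
  \forall al \near +oo, exists2 S : R, (forall x : R * R, disk x -> ustar al x <= S) &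
    0 <= S /\ S `^ p <= D * Num.sqrt (Num.sqrt al).
Proof.
move=> p1; have [c [c0 cb]] := sup_bound.
have p0 : 0 < p by lra.
(* This exponent turns [exp (e c ln al)] into [al^(1 / (4 p))], whose [p]-th power is [al^(1/4)]. *)
have e0 : 0 < (4 * p * c)^-1 by rewrite invr_gt0 !mulr_gt0.
have [s0 s01 sb] := log_growth f_C1 f_pos f_nondecr f_convex f_int e0.
set e := _^-1 in sb.
pose D := (c * s0 * expR (e * f 0)) `^ p; exists D; first exact: powR_ge0.
near=> al.
have al0 : 0 < al by near: al; apply: nbhs_pinfty_gt; exact: num_real.
have [[A [A0 EA]] bA] : (exists A : R, 0 <= A /\ deriv0y f A = c * ln al) /\
   (forall A : R, 0 <= A -> deriv0y f A = c * ln al ->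
      forall x : R * R, disk x -> ustar al x <= c * A).
  by near: al; exact: cb.
exists (c * A); first by move=> x dx; exact: bA.
have cA0 : 0 <= c * A by apply: mulr_ge0 => //; exact: ltW.
split => //; have {sb} sb := sb A A0.
have s00 : 0 <= s0 by lra.
have c00 := ltW c0.
have h : c * A <= c * s0 * expR (e * f 0) * expR (ln al / (4 * p)).
  have Am : A <= Num.max A s0 by rewrite le_max lexx.
  apply: (le_trans (ler_wpM2l c00 (le_trans Am sb))).
  rewrite EA mulrDr expRD !mulrA le_eqVlt; apply/orP; left; apply/eqP.
  congr (_ * expR _); rewrite /e; field.
  by rewrite !gt_eqF.
apply: (le_trans (ge0_ler_powR (ltW p0) _ _ h)).
- by rewrite nnegrE.
- by rewrite nnegrE !mulr_ge0// expR_ge0.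
rewrite powRM ?expR_ge0 ?mulr_ge0 ?expR_ge0// -/D sqrt_sqrt_expR//.
rewrite -expRM le_eqVlt; apply/orP; left; apply/eqP; congr (_ * expR _).
by field; rewrite gt_eqF.
Unshelve. all: by end_near. Qed.

Lemma integral_power_cvg0 (p : R) : 1 <= p ->
  (\int[lebesgue_measure \x lebesgue_measure]_(x in @disk R)
     ((ustar al x) `^ p)%:E)%E @[al --> +oo] --> 0%E.
Proof.
move=> p1; have p0 : 0 <= p by lra.
have [D D0 Db] := sup_power_bound p1.
have [C0 C00 Cb] := middle_bound.
have small := small_bound.
set I := fun al : R => _.
have key (eps : R) : 0 < eps -> \forall al \near +oo, (0 <= I al <= eps%:E)%E.
  move=> e0; have cp0 := powR_ge0 C0 p.
  (* [d] serves both as a radius and as a bound on the values beyond it: the middle zone contributes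
     [4 C0^p d^2] and the outer one [4 d^p <= 4 d], together at most [eps / 2]. *)
  pose q := eps / (8 * (C0 `^ p + 1)).
  have q0 : 0 < q by rewrite divr_gt0// mulr_gt0//; lra.
  pose d := Num.min (1 / 2) q.
  have d0 : 0 < d by rewrite /d lt_min q0 andbT; lra.
  have d12 : d <= 1 / 2 by rewrite /d ge_min lexx.
  have dq : d <= q by rewrite /d ge_min lexx orbT.
  have d1 : d < 1 by lra.
  have eq : q * (8 * (C0 `^ p + 1)) = eps.
    by rewrite /q mulfVK// gt_eqF// mulr_gt0//; lra.
  have dp : d `^ p <= d by apply: ge1r_powR => //; rewrite d0; lra.
  have hd : C0 `^ p * (4 * d ^+ 2) + d `^ p * (4 * 1 ^+ 2) <= eps / 2.
    have a1 : d ^+ 2 <= d by rewrite expr2; nra.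
    have a2 : C0 `^ p * (4 * d ^+ 2) <= C0 `^ p * (4 * q).
      by apply: ler_wpM2l => //; lra.
    rewrite expr1n -eq; lra.
  near=> al.
  have al0 : 0 < al by near: al; apply: nbhs_pinfty_gt; exact: num_real.
  have [S Sb [S0 SD]] : exists2 S : R, (forall x : R * R, disk x -> ustar al x <= S) &
    0 <= S /\ S `^ p <= D * Num.sqrt (Num.sqrt al) by near: al; exact: Db.
  have Cb' : forall x : R * R, disk x -> (Num.sqrt (Num.sqrt al))^-1 <= enorm x ->
    ustar al x <= C0 by near: al; exact: Cb.
  have small' : forall x : R * R, disk x -> d <= enorm x -> ustar al x <= d.
    by near: al; exact: (small _ d0 d1).
  have lal : 4 * (8 * D / eps) < ln al by near: al; exact: near_ln_gt.
  have u0 (x : R * R) (dx : disk x) : 0 <= ustar al x.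
    exact: (ustar_ge0 al0 dx).
  apply/andP; split.
    by apply: integral_ge0 => x dx; rewrite lee_fin powR_ge0.
  set Y := Num.sqrt (Num.sqrt al) in SD Cb'.
  have Y0 : 0 < Y by rewrite !sqrtr_gt0.
  have YD : 8 * D / eps <= Y.
    rewrite /Y sqrt_sqrt_expR//; apply: le_trans (expR_ge1Dx _); lra.
  have mono (x : R * R) (t : R) : disk x -> 0 <= t -> ustar al x <= t ->
      ustar al x `^ p <= t `^ p.
    by move=> dx t0 h; apply: ge0_ler_powR => //; rewrite nnegrE// u0.
  apply: (le_trans (@integral_disk_le R (fun x => ustar al x `^ p)
    (S `^ p) (C0 `^ p) (d `^ p) Y^-1 d _ _ _ _ _ _ _ _ _)).
  - exact: powR_ge0.
  - exact: powR_ge0.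
  - exact: powR_ge0.
  - by rewrite invr_gt0.
  - exact: d0.
  - by move=> x _; exact: powR_ge0.
  - by move=> x dx _; apply: mono => //; exact: Sb.
  - by move=> x dx r1 _; apply: mono => //; exact: Cb'.
  - by move=> x dx _ r2; apply: mono => //; [exact: ltW|exact: small'].
  rewrite lee_fin.
  (* A peak of order [al^(1/4)] over an area of order [al^(-1/2)]. *)
  have : S `^ p * (4 * Y^-1 ^+ 2) <= eps / 2.
    apply: (@le_trans _ _ (D * Y * (4 * Y^-1 ^+ 2))).
      by apply: ler_wpM2r => //; rewrite mulr_ge0// sqr_ge0.
    have -> : D * Y * (4 * Y^-1 ^+ 2) = 4 * D / Y by field; rewrite gt_eqF.
    rewrite ler_pdivrMr//; move: YD; rewrite ler_pdivrMr//; nra.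
  lra.
have fin : \forall al \near +oo, I al \is a fin_num.
  have := key 1 ltr01; apply: filterS => al /andP[h1 h2].
  by rewrite ge0_fin_numE//; exact: (le_lt_trans h2 (ltry _)).
apply/fine_cvgP; split => //.
apply/cvgrPdist_le => eps e0 /=.
near=> al.
have hf : I al \is a fin_num by near: al; exact: fin.
have /andP[h1 h2] : (0 <= I al <= eps%:E)%E by near: al; exact: key.
rewrite sub0r normrN ger0_norm ?fine_ge0//.
by rewrite -lee_fin fineK.
Unshelve. all: by end_near. Qed.

End Assembly.

Theorem theorem1p3 (R : realType) (f phi psi : R -> R)
  (ustar : R -> R * R -> R) (c0 c1 t0 : R)
  (f_pos : forall t : R, 0 <= t -> 0 < f t)
  (f_C1 : C1_0y f)
  (f_convex : convex_function (`[0, +oo[%classic : set R^o) f)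
  (f_nondecr : forall s t : R, 0 <= s -> s <= t -> f s <= f t)
  (f_int : (\int[lebesgue_measure]_(s in `[0%R, +oo[) ((f s)^-1)%:E < +oo)%E)
  (phi_ge0 : forall r : R, 0 <= r <= 1 -> 0 <= phi r)
  (psi_ge0 : forall r : R, 0 <= r <= 1 -> 0 <= psi r)
  (phi_noninc : forall r s : R, 0 <= r -> r <= s -> s <= 1 -> phi s <= phi r)
  (psi_noninc : forall r s : R, 0 <= r -> r <= s -> s <= 1 -> psi s <= psi r)
  (phi_lip : [lipschitz phi r | r in `[0, 1]%classic])
  (psi_lip : [lipschitz psi r | r in `[0, 1]%classic])
  (phi0 : phi 0 = 1)
  (psi0 : psi 0 = 1)
  (phi_pos : forall r : R, 0 <= r < 1 -> 0 < phi r)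
  (M_int : (\int[lebesgue_measure]_(s in `[0%R, 1%R[) (Mratio phi psi s)%:E
            < +oo)%E)
  (ustarP : forall alpha : R, 0 < alpha ->
     extremal_solution f phi psi alpha (ustar alpha))
  (c0_range : 0 < c0 < 1)
  (c1_gt1 : 1 < c1)
  (t0_gt0 : 0 < t0)
  (f_growth : forall t1 t2 : R, t0 < t1 -> t1 < t2 ->
     c1 * f t1 <= f t2 -> deriv0y f t1 <= (1 - c0) * deriv0y f t2) :
  (exists c : R, 0 < c /\
     \forall alpha \near +oo,
       (exists A : R, 0 <= A /\ deriv0y f A = c * ln alpha) /\
       (forall A : R, 0 <= A -> deriv0y f A = c * ln alpha ->
          ustar alpha (0, 0) <= c * A)) /\
  (forall p : R, 1 <= p ->
     (\int[lebesgue_measure \x lebesgue_measure]_(x in @disk R)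
        ((ustar alpha x) `^ p)%:E)%E @[alpha --> +oo] --> 0%E).
Proof.
split.
  have [c [c_gt0 cP]] := sup_bound f_C1 f_pos f_nondecr f_convex f_int
    phi_ge0 psi_ge0 phi_noninc psi_noninc phi_lip psi_lip phi0 psi0 phi_pos
    M_int ustarP.
  exists c; split => //; apply: filterS cP => al [hA h]; split => // A A0 EA.
  by apply: h => //; rewrite /disk /= enorm0.
exact: (integral_power_cvg0 f_C1 f_pos f_nondecr f_convex f_int
  phi_ge0 psi_ge0 phi_noninc psi_noninc phi_lip psi_lip phi0 psi0 phi_pos
  M_int ustarP).
Qed.
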